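(* Assume conditions (A1)--(A6) listed in the context. Then $\hat\theta_n\to\theta_0$ in probability as $n\to\infty$.
   Context: **Model.** $(h_n)_{n\ge1}$ are positive numbers with $h_n\to0$, $T_n:=nh_n\to\infty$ and $nh_n^2\to0$. $(\Omega,\mathcal F,P)$ is a probability space with right-continuous filtration $(\mathcal F_t)_{t\ge0}$. $\Theta_1\subset\mathbb R^{d_1}$, $\Theta_2\subset\mathbb R^{d_2}$ are bounded open sets, $\Theta=\Theta_1\times\Theta_2$. An open $U\subset\mathbb R^m$ admits Sobolev's inequality if for every $p>m$ there is $C>0$ depending on $U,p$ with $\sup_{x\in U}|u(x)|\le C\sum_{k=0,1}(\int_U|\partial_x^ku(x)|^pdx)^{1/p}$ for all $u\in C^1(U)$; $\Theta,\Theta_1,\Theta_2$ are assumed to admit it. $X=(X^1,X^2)$ solves $dX_t=\mu_t(\theta_0)dt+b_t(\sigma_0)dW_t$, $X_0=x_0\in\mathbb R^2$, with $W$ a two-dimensional standard $(\mathcal F_t)$-Wiener process, $\mu_t(\theta)\in\mathbb R^2$, $b_t(\sigma)\in\mathbb R^{2\times2}$ deterministic, and true value $(\sigma_0,\theta_0)\in\Theta$. Put $\Sigma_t(\sigma)=b_tb_t^\top(\sigma)$. **Sampling.** For $l\in\{1,2\}$, $0=S^{n,l}_0<S^{n,l}_1<\dots<S^{n,l}_{M_l}=T_n$ are random times, $M_l$ a random positive integer depending on $n$; the family of these times is independent of $\mathcal F_{T_n}$ and its law does not depend on the parameter. $I_i^l=(S^{n,l}_{i-1},S^{n,l}_i]$,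 $|\cdot|$ is interval length, $r_n=\max_{i,l}|I_i^l|$, $M=M_1+M_2$. For $1\le i\le M$: $\varphi(i)=i,\psi(i)=1$ if $i\le M_1$, and $\varphi(i)=i-M_1,\psi(i)=2$ otherwise; $I_i=I_{\varphi(i)}^{\psi(i)}$. For a process $U=(U^1,U^2)$, $\Delta_iU=U^{\psi(i)}_{S^{n,\psi(i)}_{\varphi(i)}}-U^{\psi(i)}_{S^{n,\psi(i)}_{\varphi(i)-1}}$ and $\Delta U=(\Delta_iU)_{1\le i\le M}$. **Estimators.** $S_n(\sigma)$ is the $M\times M$ matrix $[S_n(\sigma)]_{ij}=\int_{I_i\cap I_j}[\Sigma_t(\sigma)]_{\psi(i),\psi(j)}dt$. $H_n^1(\sigma)=-\frac12\Delta X^\top S_n^{-1}(\sigma)\Delta X-\frac12\log\det S_n(\sigma)$, $\hat\sigma_n\in\operatorname{argmax}_{\sigma\in\mathrm{clos}(\Theta_1)}H_n^1(\sigma)$. With $V_t(\theta)=\int_0^t\mu_s(\theta)ds$ and $\bar X(\theta)=\Delta X-\Delta V(\theta)$: $H_n^2(\theta)=-\frac12\bar X(\theta)^\top S_n^{-1}(\hat\sigma_n)\bar X(\theta)$, $\hat\theta_n\in\operatorname{argmax}_{\theta\in\mathrm{clos}(\Theta_2)}H_n^2(\theta)$. **Notation.** $\rho_t(\sigma)=[\Sigma_t]_{12}/([\Sigma_t]_{11}^{1/2}[\Sigma_t]_{22}^{1/2})(\sigma)$, $\rho_{t,0}=\rho_t(\sigma_0)$, $B_{l,t}(\sigma)=([\Sigma_t(\sigma_0)]_{ll}/[\Sigma_t(\sigma)]_{ll})^{1/2}$,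 $\phi_{l,t}(\theta)=[\Sigma_t(\sigma_0)]_{ll}^{-1/2}(\mu_t^l(\theta)-\mu_t^l(\theta_0))$. $G$ is the $M_1\times M_2$ matrix $[G]_{ij}=|I_i^1\cap I_j^2|/(|I_i^1|^{1/2}|I_j^2|^{1/2})$; $\mathfrak I_l=(|I_i^l|^{1/2})_{i=1}^{M_l}$ (column vector). $\mathfrak S$ is the set of partitions $0=s_0<s_1<\cdots$ of $[0,\infty)$ with $\sup_k|s_k-s_{k-1}|\le1$, $\inf_k|s_k-s_{k-1}|>0$. For such a partition, $q_n=\max\{k:s_k\le T_n\}$, $M_{l,k}=\#\{i:\sup I_i^l\in(s_{k-1},s_k]\}$, and $\mathcal E^l_{(k)}$ is the $M_l\times M_l$ diagonal matrix with $i$th diagonal entry $1$ if $\sup I_i^l\in(s_{k-1},s_k]$ and $0$ otherwise. $\mathcal E_2$ is the $2\times2$ identity, $\|\cdot\|$ the operator norm, $\partial^k$ denotes the array of all $k$th order partial derivatives, $\mathbb Z_+=\{0,1,2,\dots\}$, $\mathbb N=\{1,2,\dots\}$. **Assumptions.** (A1) There are $c_1,c_2>0$ with $c_1\mathcal E_2\le\Sigma_t(\sigma)\le c_2\mathcal E_2$ for all $t\ge0$, $\sigma\in\Theta_1$. For $k\in\{0,\dots,4\}$, $\partial_\theta^k\mu_t(\theta)$, $\partial_\sigma^kb_t(\sigma)$ exist and are continuous on $[0,\infty)\times\mathrm{clos}(\Theta_1)\times\mathrm{clos}(\Theta_2)$. For any $\epsilon>0$ there are $\delta,K>0$ with $|\partial_\theta^k\mu_t(\theta)|+|\partial_\sigma^kb_t(\sigma)|\le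 K$ and $|\partial_\theta^k\mu_t(\theta)-\partial_\theta^k\mu_s(\theta)|+|\partial_\sigma^kb_t(\sigma)-\partial_\sigma^kb_s(\sigma)|\le\epsilon$ for all such $k$, $\sigma\in\Theta_1$, $\theta\in\Theta_2$, $t,s\ge0$ with $|t-s|<\delta$. (A2) $r_n\to0$ in probability. (A3) For any $l\in\{1,2\}$, $i_1\in\mathbb Z_+$, $i_2\in\{0,1\}$, $i_3\in\{0,\dots,4\}$, $k_1,k_2\in\{0,1,2\}$ with $k_1+k_2=2$, and any polynomial $F$ of degree at most $4$ (in 14 variables when $d_1=1$; in general in all entries of its arguments), there are continuous functions $\Phi^{1,F}_{i_1,i_2},\Phi^2_{l,i_3}$ on $\mathrm{clos}(\Theta_1)$ and $\Phi^{3,k_1,k_2}_{i_1,i_3}$ on $\mathrm{clos}(\Theta_2)$ such that, as $T\to\infty$, for all $\sigma\in\mathrm{clos}(\Theta_1)$, $\theta\in\mathrm{clos}(\Theta_2)$: $\frac1T\int_0^TF((\partial_\sigma^kB_{l,t}(\sigma))_{0\le k\le4,l=1,2},(\partial_\sigma^{k'}\rho_t(\sigma))_{k'=1}^4)\rho_t(\sigma)^{i_1}\rho_{t,0}^{i_2}dt\to\Phi^{1,F}_{i_1,i_2}(\sigma)$, $\frac1T\int_0^T\partial_\sigma^{i_3}\log B_{l,t}(\sigma)dt\to\Phi^2_{l,i_3}(\sigma)$, $\frac1T\int_0^T\partial_\theta^{i_3}(\phi_{1,t}^{k_1}\phi_{2,t}^{k_2})(\theta)\rho_{t,0}^{i_1}dt\to\Phi^{3,k_1,k_2}_{i_1,i_3}(\theta)$.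 (A4) There are $a_0^1,a_0^2>0$ such that, for $l\in\{1,2\}$ and any $(s_k)\in\mathfrak S$, $\{h_nM_{l,q_n+1}\}_n$ is tight and $\max_{1\le k\le q_n}|h_nM_{l,k}-a_0^l(s_k-s_{k-1})|\to0$ in probability; and for each $p\in\mathbb N$ there is $a_p^1\ge0$ with $\max_{1\le k\le q_n}|h_n\mathrm{tr}(\mathcal E^1_{(k)}(GG^\top)^p)-a_p^1(s_k-s_{k-1})|\to0$ in probability for any $(s_k)\in\mathfrak S$. (A5) For each $p\in\mathbb Z_+$ there are $f_p^{1,1},f_p^{1,2},f_p^{2,2}\ge0$ such that, for any $(s_k)\in\mathfrak S$, in probability, $\max_{1\le k\le q_n}|\mathfrak I_1^\top\mathcal E^1_{(k)}(GG^\top)^p\mathfrak I_1-f_p^{1,1}(s_k-s_{k-1})|\to0$, $\max_{1\le k\le q_n}|\mathfrak I_1^\top\mathcal E^1_{(k)}(GG^\top)^pG\mathfrak I_2-f_p^{1,2}(s_k-s_{k-1})|\to0$, $\max_{1\le k\le q_n}|\mathfrak I_2^\top\mathcal E^2_{(k)}(G^\top G)^p\mathfrak I_2-f_p^{2,2}(s_k-s_{k-1})|\to0$. (A6) $a_1^1>0$, and there are $c_3,c_4>0$ with $\limsup_{T\to\infty}\frac1T\int_0^T\|\Sigma_t(\sigma)-\Sigma_t(\sigma_0)\|^2dt\ge c_3|\sigma-\sigma_0|^2$ and $\limsup_{T\to\infty}\frac1T\int_0^T|\mu_t(\theta)-\mu_t(\theta_0)|^2dt\ge c_4|\theta-\theta_0|^2$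 for all $\sigma\in\mathrm{clos}(\Theta_1)$, $\theta\in\mathrm{clos}(\Theta_2)$. *)

(* Defs.v *)
From HB Require Import structures.
From mathcomp Require Import all_boot all_order all_algebra.
From mathcomp Require mpoly.
From mathcomp Require Import all_classical all_reals all_analysis.

Set Implicit Arguments.
Unset Strict Implicit.
Unset Printing Implicit Defensive.

Import Order.TTheory GRing.Theory Num.Theory.
Import numFieldNormedType.Exports.

Local Open Scope classical_set_scope.
Local Open Scope ring_scope.

(* The two coordinates 1 and 2 of the paper are ord0 and ord_max in 'I_2.    *)

Section Norms.
Variable R : realType.

Definition anorm (J : finType) (a : J -> R) : R :=
  Num.sqrt (\sum_j a j ^+ 2).

Definition opnorm (p q : nat) (A : 'M[R]_(p, q)) : R :=
  sup [set anorm (fun i => (A *m x) i ord0) |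
        x in [set x : 'cV[R]_q | anorm (fun i => x i ord0) <= 1]].

Definition loewner_le (p : nat) (A B : 'M[R]_p) : Prop :=
  forall x : 'cV[R]_p,
    (x^T *m A *m x) ord0 ord0 <= (x^T *m B *m x) ord0 ord0.

End Norms.

Section Calculus.
Variables (R : realType) (d : nat).
Implicit Types (D U : set 'rV[R]_d) (f u : 'rV[R]_d -> R).

Definition pd f (s : seq 'I_d) : 'rV[R]_d -> R :=
  foldr (fun j g x => 'D_(delta_mx ord0 j) g x) f s.

(* Partial derivatives of f on clos(D), for D open: the derivative itself on
   D, its limit from inside D at the remaining points of clos(D). *)
Definition pdc D f (s : seq 'I_d) (x : 'rV[R]_d) : R :=
  if nilp s || (x \in D) then pd f s x
  else lim (pd f s y @[y --> within D (nbhs x)]).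

Definition has_pd D f (k : nat) : Prop :=
  forall (s : seq 'I_d) (j : 'I_d) (x : 'rV[R]_d),
    (size s < k)%N -> D x -> derivable (pd f s) x (delta_mx ord0 j).

Definition smooth_clos D (k : nat) (f : R -> 'rV[R]_d -> R) : Prop :=
  (forall t, 0 <= t -> has_pd D (f t) k) /\
  (forall s : seq 'I_d, (size s <= k)%N ->
    {within [set z : R * 'rV[R]_d | 0 <= z.1 /\ closure D z.2],
       continuous (fun z => pdc D (f z.1) s z.2)}).

End Calculus.

Section Sobolev.
Variable R : realType.

(* Integral over R^m of a nonnegative Borel function, as the iterated
   one-dimensional Lebesgue integral (Tonelli). *)
Fixpoint integral_rV (m : nat) : ('rV[R]_m -> \bar R) -> \bar R :=
  match m with
  | 0 => fun f => f 0
  | m'.+1 => fun f => (\int[@lebesgue_measure R]_x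
      @integral_rV m' (fun y => f (row_mx (x%:M : 'rV[R]_1) y)))%E
  end.

Definition C1 (m : nat) (U : set 'rV[R]_m) (u : 'rV[R]_m -> R) : Prop :=
  has_pd U u 1 /\
  (forall s : seq 'I_m, (size s <= 1)%N -> {within U, continuous (pd u s)}).

Definition sobolev (m : nat) (U : set 'rV[R]_m) : Prop :=
  forall p : R, m%:R < p -> exists2 C : R, 0 < C &
    forall u : 'rV[R]_m -> R, C1 U u -> forall x, U x ->
    (`|u x|%:E <= C%:E *
       (integral_rV (fun y => (\1_U y * `|u y| `^ p)%:E) `^ p^-1 +
        integral_rV (fun y =>
          (\1_U y * anorm (fun j => pd u [:: j] y) `^ p)%:E) `^ p^-1))%E.

End Sobolev.

Section Probability.
Context (R : realType) (dsp : measure_display) (Om : measurableType dsp).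
Variable P : probability Om R.
Implicit Types (F : R -> set (set Om)).

Definition cvg_in_prob (Y : nat -> Om -> R) (c : R) : Prop :=
  forall e : R, 0 < e ->
    P [set w | e < `|Y n w - c|] @[n --> \oo] --> 0%E.

(* tightness of the family indexed by n >= 1 *)
Definition tight (Y : nat -> Om -> R) : Prop :=
  forall e : R, 0 < e -> exists K : R,
    forall n, (0 < n)%N -> (P [set w | (K < `|Y n w|)%R] <= e%:E)%E.

Definition indep (G H : set (set Om)) : Prop :=
  forall A B, G A -> H B -> P (A `&` B) = (P A * P B)%E.

Definition rc_filtration F : Prop :=
  [/\ forall t, 0 <= t -> sigma_algebra setT (F t) /\ F t `<=` measurable,
      forall s t, 0 <= s -> s <= t -> F s `<=` F t &
      forall t, 0 <= t -> F t = \bigcap_(u in [set u | t < u]) F u].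

Definition adapted F (U : R -> Om -> 'cV[R]_2) : Prop :=
  forall t (l : 'I_2) (A : set R), 0 <= t -> measurable A ->
    F t ((fun w => U t w l ord0) @^-1` A).

Definition continuous_paths (U : R -> Om -> 'cV[R]_2) : Prop :=
  {ae P, forall w, {within [set t | 0 <= t], continuous (U ^~ w)}}.

(* In the last clause, E = setT gives that W_t - W_s has law N(0, (t - s) I_2),
   and a general E its independence of F_s.  The second argument of
   normal_prob is the standard deviation. *)
Definition wiener F (W : R -> Om -> 'cV[R]_2) : Prop :=
  [/\ adapted F W, continuous_paths W,
      {ae P, forall w, W 0 w = 0} &
      forall s t (E : set Om) (A : 'I_2 -> set R), 0 <= s -> s < t ->
        F s E -> (forall l, measurable (A l)) ->
        P (E `&` [set w | forall l, A l ((W t w - W s w) l ord0)]) =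
        (P E * (normal_prob 0 (Num.sqrt (t - s)) (A ord0) *
                normal_prob 0 (Num.sqrt (t - s)) (A ord_max)))%E].

(* A deterministic step function sum_j c_j 1_(a_j, b_j] is coded by the
   sequence of the triples ((c_j, a_j), b_j). *)
Definition step_fun (e : seq (R * R * R)) (s : R) : R :=
  \sum_(x <- e) x.1.1 * \1_(`]x.1.2, x.2]) s.

Definition step_integral (w : R -> Om -> R) (e : seq (R * R * R)) (o : Om) : R :=
  \sum_(x <- e) x.1.1 * (w x.2 o - w x.1.2 o).

(* Y is (a version of) the stochastic integral of the deterministic function f
   over [0, t] with respect to the scalar Wiener process w. *)
Definition is_wiener_integral (w : R -> Om -> R) (f : R -> R) (t : R)
    (Y : Om -> R) : Prop :=
  measurable_fun setT Y /\
  exists e : nat -> seq (R * R * R),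
    [/\ forall n x, x \in e n -> [/\ 0 <= x.1.2, x.1.2 <= x.2 & x.2 <= t],
        (\int[@lebesgue_measure R]_(s in `[0%R, t])
           ((step_fun (e n) s - f s) ^+ 2)%:E)%E @[n --> \oo] --> 0%E &
        (\int[P]_o ((step_integral w (e n) o - Y o) ^+ 2)%:E)%E
          @[n --> \oo] --> 0%E].

(* dX_t = m_t dt + g_t dW_t, X_0 = x0, with deterministic m and g *)
Definition solves_sde F (W : R -> Om -> 'cV[R]_2) (x0 : 'cV[R]_2)
    (m : R -> 'cV[R]_2) (g : R -> 'M[R]_2) (X : R -> Om -> 'cV[R]_2) : Prop :=
  [/\ adapted F X, continuous_paths X &
      forall t (l : 'I_2), 0 <= t -> exists Y : 'I_2 -> Om -> R,
        (forall j, is_wiener_integral (fun s o => W s o j ord0)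
                     (fun s => g s l j) t (Y j)) /\
        {ae P, forall o, X t o l ord0 = x0 l ord0 +
           \int[@lebesgue_measure R]_(s in `[0, t]) m s l ord0 +
           \sum_j Y j o}].

End Probability.

(* Quantities depending on one realization of the observation times:
   tau l i is the time S^l_i (0 <= i <= m l) and m l is M_l.  Intervals are
   numbered from 0: obs_itv tau l i is the paper's I^l_(i+1). *)
Section Observation.
Variables (R : realType) (tau : 'I_2 -> nat -> R) (m : 'I_2 -> nat).

Definition leng (A : set R) : R := fine (lebesgue_measure A).

Definition obs_itv (l : 'I_2) (i : nat) : set R := `]tau l i, tau l i.+1].

Definition mesh : R :=
  \big[Num.max/0]_(l : 'I_2) \big[Num.max/0]_(i < m l) leng (obs_itv l i).

Definition psi (i : 'I_(m ord0 + m ord_max)) : 'I_2 :=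
  if fintype.split i is inl _ then ord0 else ord_max.

Definition phi (i : 'I_(m ord0 + m ord_max)) : nat :=
  match fintype.split i with inl j => j | inr j => j end.

Definition joint_itv (i : 'I_(m ord0 + m ord_max)) : set R :=
  obs_itv (psi i) (phi i).

Definition incr (u : R -> 'cV[R]_2) : 'cV[R]_(m ord0 + m ord_max) :=
  \col_i (u (tau (psi i) (phi i).+1) (psi i) ord0 -
          u (tau (psi i) (phi i)) (psi i) ord0).

Definition cov_mx (Sig : R -> 'M[R]_2) : 'M[R]_(m ord0 + m ord_max) :=
  \matrix_(i, j) \int[@lebesgue_measure R]_(t in joint_itv i `&` joint_itv j)
    Sig t (psi i) (psi j).

Definition G : 'M[R]_(m ord0, m ord_max) :=
  \matrix_(i, j) (leng (obs_itv ord0 i `&` obs_itv ord_max j) /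
    (Num.sqrt (leng (obs_itv ord0 i)) * Num.sqrt (leng (obs_itv ord_max j)))).

Definition frakI (l : 'I_2) : 'cV[R]_(m l) :=
  \col_i Num.sqrt (leng (obs_itv l i)).

Definition in_block (s : nat -> R) (k : nat) (l : 'I_2) (i : 'I_(m l)) : bool :=
  s k.-1 < sup (obs_itv l i) <= s k.

Definition Ecal (s : nat -> R) (k : nat) (l : 'I_2) : 'M[R]_(m l) :=
  diag_mx (\row_i (in_block s k i)%:R).

Definition Mcount (s : nat -> R) (l : 'I_2) (k : nat) : nat :=
  #|[pred i : 'I_(m l) | in_block s k i]|.

End Observation.

Section Partition.
Variable R : realType.

Definition frakS (s : nat -> R) : Prop :=
  [/\ s 0%N = 0, forall k, s k < s k.+1, forall k, s k.+1 - s k <= 1 &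
      exists2 c, 0 < c & forall k, c <= s k.+1 - s k].

(* max {k | s_k <= T}; this maximum exists for s in frakS and T >= 0 *)
Definition qmax (s : nat -> R) (T : R) : nat :=
  xget 0%N [set q | s q <= T /\ forall k, s k <= T -> (k <= q)%N].

Definition block_max (s : nat -> R) (T : R) (x : nat -> R) : R :=
  \big[Num.max/0]_(1 <= k < (qmax s T).+1) `|x k|.

End Partition.

Section Likelihood.
Variables (R : realType) (d1 d2 : nat).
Variables (mu : R -> 'rV[R]_d2 -> 'cV[R]_2) (b : R -> 'rV[R]_d1 -> 'M[R]_2).
Variables (sigma0 : 'rV[R]_d1) (theta0 : 'rV[R]_d2).

Definition Sigma (t : R) (sigma : 'rV[R]_d1) : 'M[R]_2 :=
  b t sigma *m (b t sigma)^T.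

Definition rho (t : R) (sigma : 'rV[R]_d1) : R :=
  Sigma t sigma ord0 ord_max /
  (Num.sqrt (Sigma t sigma ord0 ord0) *
   Num.sqrt (Sigma t sigma ord_max ord_max)).

Definition Bratio (l : 'I_2) (t : R) (sigma : 'rV[R]_d1) : R :=
  Num.sqrt (Sigma t sigma0 l l / Sigma t sigma l l).

Definition mudiff (l : 'I_2) (t : R) (theta : 'rV[R]_d2) : R :=
  (Num.sqrt (Sigma t sigma0 l l))^-1 *
  (mu t theta l ord0 - mu t theta0 l ord0).

Definition Vint (theta : 'rV[R]_d2) (t : R) : 'cV[R]_2 :=
  \col_l \int[@lebesgue_measure R]_(s in `[0, t]) mu s theta l ord0.

(* tau and m are the realized observation times, x is the realized path of X *)
Definition H1 (tau : 'I_2 -> nat -> R) (m : 'I_2 -> nat) (x : R -> 'cV[R]_2)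
    (sigma : 'rV[R]_d1) : R :=
  let S := cov_mx tau m (Sigma ^~ sigma) in
  let dX := incr tau m x in
  - 2^-1 * (dX^T *m invmx S *m dX) ord0 ord0 - 2^-1 * ln (\det S).

Definition H2 (tau : 'I_2 -> nat -> R) (m : 'I_2 -> nat) (x : R -> 'cV[R]_2)
    (sigmahat : 'rV[R]_d1) (theta : 'rV[R]_d2) : R :=
  let S := cov_mx tau m (Sigma ^~ sigmahat) in
  let Xbar := incr tau m x - incr tau m (Vint theta) in
  - 2^-1 * (Xbar^T *m invmx S *m Xbar) ord0 ord0.

End Likelihood.

Definition is_argmax (R : realType) (T : Type) (A : set T) (f : T -> R)
  (x : T) : Prop := A x /\ forall y, A y -> f y <= f x.

Section Sampling.
Context (R : realType) (dsp : measure_display) (Om : measurableType dsp).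
Variables (P : probability Om R) (F : R -> set (set Om)) (h : nat -> R).
Variables (M : nat -> 'I_2 -> Om -> nat) (S : nat -> 'I_2 -> nat -> Om -> R).

Definition horizon (n : nat) : R := n%:R * h n.

Definition step_sizes : Prop :=
  [/\ forall n, (0 < n)%N -> 0 < h n,
      h n @[n --> \oo] --> 0,
      horizon n @[n --> \oo] --> +oo &
      n%:R * h n ^+ 2 @[n --> \oo] --> 0].

(* Only S^(n,l)_i with i <= M_l are observation times; the sequence is
   extended by the constant T_n, so that sigma(S) also determines M_l. *)
Definition sampling : Prop :=
  forall n, (0 < n)%N ->
  [/\ forall l, measurable_fun setT (M n l) /\
        (forall i, measurable_fun setT (S n l i)),
      forall l w, [/\ (0 < M n l w)%N, S n l 0%N w = 0,
        forall i, (i < M n l w)%N -> S n l i w < S n l i.+1 w &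
        forall i, (M n l w <= i)%N -> S n l i w = horizon n] &
      indep P
        <<s [set C | exists l i (A : set R),
               measurable A /\ C = S n l i @^-1` A] >>
        (F (horizon n))].

Definition times (n : nat) (w : Om) : 'I_2 -> nat -> R :=
  fun l i => S n l i w.
Definition counts (n : nat) (w : Om) : 'I_2 -> nat := fun l => M n l w.

Definition A2 : Prop :=
  cvg_in_prob P (fun n w => mesh (times n w) (counts n w)) 0.

(* a0 l is a_0^l, and a1 p is a_p^1 for p >= 1 *)
Definition A4 (a0 : 'I_2 -> R) (a1 : nat -> R) : Prop :=
  (forall l, 0 < a0 l /\ forall s, frakS s ->
     tight P (fun n w =>
       h n * (Mcount (times n w) (counts n w) s l (qmax s (horizon n)).+1)%:R) /\
     cvg_in_prob P (fun n w => block_max s (horizon n) (fun k =>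
       h n * (Mcount (times n w) (counts n w) s l k)%:R -
       a0 l * (s k - s k.-1))) 0) /\
  (forall p, (0 < p)%N -> 0 <= a1 p /\ forall s, frakS s ->
     cvg_in_prob P (fun n w => block_max s (horizon n) (fun k =>
       let g := G (times n w) (counts n w) in
       h n * \tr (Ecal (times n w) (counts n w) s k ord0
                    *m ((g *m g^T) ^+ p)) -
       a1 p * (s k - s k.-1))) 0).

Definition A5 : Prop :=
  forall p : nat, exists f11 f12 f22 : R,
  [/\ 0 <= f11, 0 <= f12, 0 <= f22 &
  forall s, frakS s ->
  [/\ cvg_in_prob P (fun n w => block_max s (horizon n) (fun k =>
        let g := G (times n w) (counts n w) in
        let I1 := frakI (times n w) (counts n w) ord0 in
        (I1^T *m Ecal (times n w) (counts n w) s k ord0 *m ((g *m g^T) ^+ p) *m I1)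
          ord0 ord0 - f11 * (s k - s k.-1))) 0,
      cvg_in_prob P (fun n w => block_max s (horizon n) (fun k =>
        let g := G (times n w) (counts n w) in
        let I1 := frakI (times n w) (counts n w) ord0 in
        let I2 := frakI (times n w) (counts n w) ord_max in
        (I1^T *m Ecal (times n w) (counts n w) s k ord0 *m ((g *m g^T) ^+ p) *m g *m I2)
          ord0 ord0 - f12 * (s k - s k.-1))) 0 &
      cvg_in_prob P (fun n w => block_max s (horizon n) (fun k =>
        let g := G (times n w) (counts n w) in
        let I2 := frakI (times n w) (counts n w) ord_max in
        (I2^T *m Ecal (times n w) (counts n w) s k ord_max *m ((g^T *m g) ^+ p) *m I2)
          ord0 ord0 - f22 * (s k - s k.-1))) 0]].

End Sampling.

Section Coefficients.
Variables (R : realType) (d1 d2 : nat).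
Variables (Th1 : set 'rV[R]_d1) (Th2 : set 'rV[R]_d2).
Variables (mu : R -> 'rV[R]_d2 -> 'cV[R]_2) (b : R -> 'rV[R]_d1 -> 'M[R]_2).
Variables (sigma0 : 'rV[R]_d1) (theta0 : 'rV[R]_d2).

Definition dmu (k : nat) (t : R) (theta : 'rV[R]_d2)
    (j : k.-tuple 'I_d2 * 'I_2) : R :=
  pdc Th2 (fun y => mu t y j.2 ord0) j.1 theta.

Definition db (k : nat) (t : R) (sigma : 'rV[R]_d1)
    (j : k.-tuple 'I_d1 * ('I_2 * 'I_2)) : R :=
  pdc Th1 (fun y => b t y j.2.1 j.2.2) j.1 sigma.

Definition A1 : Prop :=
  [/\ exists c1 c2 : R, [/\ 0 < c1, 0 < c2 &
        forall t sigma, 0 <= t -> Th1 sigma ->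
          loewner_le c1%:M (Sigma b t sigma) /\
          loewner_le (Sigma b t sigma) c2%:M],
      (forall l, smooth_clos Th2 4 (fun t th => mu t th l ord0)) /\
      (forall i j, smooth_clos Th1 4 (fun t sg => b t sg i j)) &
      forall e : R, 0 < e -> exists delta K : R, [/\ 0 < delta, 0 < K &
        forall k sigma theta t s, (k <= 4)%N -> Th1 sigma -> Th2 theta ->
          0 <= t -> 0 <= s -> `|t - s| < delta ->
          anorm (@dmu k t theta) + anorm (@db k t sigma) <= K /\
          anorm (fun j => @dmu k t theta j - @dmu k s theta j) +
          anorm (fun j => @db k t sigma j - @db k s sigma j) <= e]].

(* The arguments of the polynomial F: the entries of d^k B_l for l = 1, 2 and
   0 <= k <= 4, and those of d^k rho for 1 <= k <= 4 (14 of them if d1 = 1). *)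
Definition Fvar : finType :=
  ('I_2 * {k : 'I_5 & k.-tuple 'I_d1} + {k : 'I_4 & k.+1.-tuple 'I_d1})%type.

Definition Fval (t : R) (sigma : 'rV[R]_d1) (v : Fvar) : R :=
  match v with
  | inl (l, s) => pdc Th1 (Bratio b sigma0 l t) (tagged s) sigma
  | inr s => pdc Th1 (rho b t) (tagged s) sigma
  end.

Definition time_avg (f : R -> R) (T : R) : R :=
  T^-1 * \int[@lebesgue_measure R]_(t in `[0, T]) f t.

Definition A3 : Prop :=
  [/\ forall (i1 i2 : nat) (F : mpoly.mpoly #|Fvar| R),
        (i2 <= 1)%N -> all (fun m => mpoly.mdeg m <= 4)%N (mpoly.msupp F) ->
        exists2 Phi : 'rV[R]_d1 -> R, {within closure Th1, continuous Phi} &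
        forall sigma, closure Th1 sigma ->
        time_avg (fun t =>
          mpoly.meval (fun i => Fval t sigma (enum_val i)) F *
          rho b t sigma ^+ i1 * rho b t sigma0 ^+ i2) T
        @[T --> +oo] --> Phi sigma,
      forall (l : 'I_2) (s : seq 'I_d1), (size s <= 4)%N ->
        exists2 Phi : 'rV[R]_d1 -> R, {within closure Th1, continuous Phi} &
        forall sigma, closure Th1 sigma ->
        time_avg (fun t =>
          pdc Th1 (fun y => ln (Bratio b sigma0 l t y)) s sigma) T
        @[T --> +oo] --> Phi sigma &
      forall (i1 : nat) (s : seq 'I_d2) (k1 k2 : nat),
        (size s <= 4)%N -> (k1 + k2 = 2)%N ->
        exists2 Phi : 'rV[R]_d2 -> R, {within closure Th2, continuous Phi} &
        forall theta, closure Th2 theta ->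
        time_avg (fun t =>
          pdc Th2 (fun y => mudiff mu b sigma0 theta0 ord0 t y ^+ k1 *
                            mudiff mu b sigma0 theta0 ord_max t y ^+ k2)
              s theta * rho b t sigma0 ^+ i1) T
        @[T --> +oo] --> Phi theta].

Definition A6 (a1 : nat -> R) : Prop :=
  0 < a1 1%N /\
  exists c3 c4 : R, [/\ 0 < c3, 0 < c4,
    forall sigma, closure Th1 sigma ->
      ((c3 * anorm (fun j => (sigma - sigma0) ord0 j) ^+ 2)%:E <=
       limf_esup (fun T => (time_avg (fun t =>
         opnorm (Sigma b t sigma - Sigma b t sigma0) ^+ 2) T)%:E)
         (pinfty_nbhs R))%E &
    forall theta, closure Th2 theta ->
      ((c4 * anorm (fun j => (theta - theta0) ord0 j) ^+ 2)%:E <=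
       limf_esup (fun T => (time_avg (fun t =>
         anorm (fun l => (mu t theta - mu t theta0) l ord0) ^+ 2) T)%:E)
         (pinfty_nbhs R))%E].

End Coefficients.

Definition is_param_set (R : realType) (d : nat) (Th : set 'rV[R]_d) : Prop :=
  [/\ (0 < d)%N, open Th, bounded_set Th & sobolev Th].

Definition prod_set (R : realType) (d1 d2 : nat) (Th1 : set 'rV[R]_d1)
    (Th2 : set 'rV[R]_d2) : set 'rV[R]_(d1 + d2) :=
  [set x | Th1 (lsubmx x) /\ Th2 (rsubmx x)].

(* Main.v *)
Require Import Defs.
From HB Require Import structures.
From mathcomp Require Import all_boot all_order all_algebra.
From mathcomp Require Import all_classical all_reals all_analysis.
From mathcomp Require Import measurable_realfun.
From mathcomp Require Import ring lra.

Set Implicit Arguments.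
Unset Strict Implicit.
Unset Printing Implicit Defensive.

Import Order.TTheory GRing.Theory Num.Theory.
Import numFieldNormedType.Exports.

Local Open Scope classical_set_scope.
Local Open Scope ring_scope.

(** Let Z be the vector of the increments of X minus those of its true drift, D(theta)
    the vector of the increments of the difference between the drifts at theta and at
    theta0, S(sigma) the covariance matrix of the increments, and T the horizon.  Up to
    a term free of theta, the second quasi-log-likelihood is
    Z^T S^-1 D - D^T S^-1 D / 2, which vanishes at theta0.  Hence at a maximizer theta
    (for whatever value of sigma has been plugged in)
      D^T S^-1 D <= 2 Z^T S^-1 D        ([argmax_ineq]),
    and the proof bounds the left side from below by a multiple of T as long as theta
    is away from theta0, and the right side from above by an arbitrarily small multiple
    of T, with probability tending to one and uniformly in sigma and theta.

    Left side.  However the two families of observation intervals overlap, the quadratic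
    form of S is the time integral of the form Sigma_t at a step function
    ([cov_form]).  The bounds c1 <= Sigma_t <= c2 therefore compare S with the diagonal
    matrix of the interval lengths ([cov_lower], [cov_upper]), and D^T S^-1 D dominates
    the sum of the D_i^2 / |I_i| ([inv_form_ge]).  For a fine mesh that sum is close to
    the integral over [0, T] of |mu_t(theta) - mu_t(theta0)|^2 ([dincr_lower],
    [drift_energy]).  The existence of the limits of time averages together with the
    identifiability condition bounds the integral below by a multiple of T, uniformly
    outside a neighbourhood of theta0 ([drift_identifiable]).  The uniformity is the
    first use of Sobolev's inequality: bounded functions which tend to 0 pointwise with
    their gradients tend to 0 uniformly ([sobolev_unif], [time_avg_cvg_unif]).

    Right side.  Fix the observation times.  The vector S^-1 D and its derivatives with
    respect to the parameters have a length-weighted squared norm of order T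
    ([solved_at_norm2], [dsolved_norm2]), so that Z^T S^-1 D and its derivatives are
    Wiener integrals of functions whose squared L2 norm is of order T, and their moments
    of order 2q are of order T^q ([gauss_moment]).  Sobolev's inequality, now applied to
    the random function (sigma, theta) |-> Z^T S^-1 D with 2q larger than the dimension,
    turns these moments into a bound of order T^-q for the probability that the supremum
    exceeds eta T ([sobolev_prob], [fixed_sup]).

    Random times.  The bound for fixed times holds outside an event of the sigma-algebra
    F_T, of which the times are independent.  When the times take
    finitely many values, conditioning on them preserves the bound ([decouple]).
    General times are rounded up to a grid; as the grid is refined the rounded times
    converge to the true ones from the right and every ingredient of Z^T S^-1 D converges, so that the
    bound passes to the limit ([random_sup]). *)

(** * Iterated integrals over row vectors *)

Section IteratedIntegral.
Variable R : realType.

Definition measurable_coords d (T : measurableType d) m (v : T -> 'rV[R]_m) :=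
  forall j, measurable_fun setT (fun t => v t ord0 j).

(** Joint measurability in a point of T and a row vector, tested against all measurable
    families of such pairs, so that no sigma-algebra on row vectors is involved.  This is closed under freezing or splitting coordinates, which is what inductions on the
    dimension need. *)
Definition jointly_measurable d (T : measurableType d) m (f : T -> 'rV[R]_m -> \bar R) :=
  forall d' (T' : measurableType d') (a : T' -> T) (v : T' -> 'rV[R]_m),
    measurable_fun setT a -> measurable_coords v ->
    measurable_fun setT (fun t => f (a t) (v t)).

Lemma measurable_coords_row_mx d (T : measurableType d) m (x : T -> R) (v : T -> 'rV[R]_m) :
  measurable_fun setT x -> measurable_coords v ->
  measurable_coords (fun t => row_mx ((x t)%:M : 'rV[R]_1) (v t)).
Proof.
move=> mx mv j; rewrite -(splitK j); case: (fintype.split j) => k /=.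
  rewrite (_ : (fun t => _) = x)//; apply/funext => t.
  by rewrite row_mxEl mxE (ord1 k) eqxx mulr1n.
rewrite (_ : (fun t => _) = fun t => v t ord0 k); last first.
  by apply/funext => t; rewrite row_mxEr.
exact: mv.
Qed.

Lemma jointly_measurable_row_mx d (T : measurableType d) m
    (f : T -> 'rV[R]_m.+1 -> \bar R) :
  jointly_measurable f ->
  jointly_measurable (fun (z : T * R) y => f z.1 (row_mx (z.2%:M : 'rV[R]_1) y)).
Proof.
move=> jf d' T' a v ma mv.
apply: (jf _ _ (fun t => (a t).1) (fun t => row_mx ((a t).2%:M : 'rV[R]_1) (v t))).
  exact: measurableT_comp.
by apply: (@measurable_coords_row_mx _ _ _ (fun t => (a t).2)) => //; exact: measurableT_comp.
Qed.

Lemma jointly_measurable_comp d (T : measurableType d) d1 (T1 : measurableType d1) m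
    (f : T -> 'rV[R]_m -> \bar R) (g : T1 -> T) :
  jointly_measurable f -> measurable_fun setT g -> jointly_measurable (fun t y => f (g t) y).
Proof.
move=> jf mg d' T' a v ma mv; apply: (jf _ _ (g \o a)) => //.
exact: measurableT_comp.
Qed.

Lemma jointly_measurable_row_mx1 d (T : measurableType d) m
    (f : T -> 'rV[R]_m.+1 -> \bar R) (x : R) :
  jointly_measurable f -> jointly_measurable (fun z y => f z (row_mx (x%:M : 'rV[R]_1) y)).
Proof.
move=> jf; apply: (@jointly_measurable_comp _ _ _ _ _ _ (fun t : T => (t, x)) (jointly_measurable_row_mx jf)).
exact: measurable_fun_pair.
Qed.

Lemma integral_rV_ge0 m (f : 'rV[R]_m -> \bar R) :
  (forall y, 0 <= f y)%E -> (0 <= integral_rV f)%E.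
Proof.
elim: m f => [|m IH] f f0 //=.
by apply: integral_ge0 => x _; apply: IH.
Qed.

Lemma integral_rV0 m : integral_rV (cst 0%E : 'rV[R]_m -> \bar R) = 0%E.
Proof.
elim: m => [//|m IH] /=.
rewrite -[RHS](@integral0 _ _ _ (@lebesgue_measure R) setT).
by apply: eq_integral => x _; exact: IH.
Qed.

Lemma measurable_integral_rV d (T : measurableType d) m
    (f : T -> 'rV[R]_m -> \bar R) :
  jointly_measurable f -> (forall t y, 0 <= f t y)%E ->
  measurable_fun setT (fun t => integral_rV (f t)).
Proof.
elim: m d T f => [|m IH] d T f jf f0 /=.
  by apply: (jf _ _ id (fun=> 0)) => // j.
apply: (measurable_fun_fubini_tonelli_F (m2 := @lebesgue_measure R)
  (fun z : T * R => integral_rV (fun y => f z.1 (row_mx (z.2%:M : 'rV[R]_1) y)))).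
  by apply: IH => //; exact: jointly_measurable_row_mx.
by move=> z; apply: integral_rV_ge0.
Qed.

Lemma measurable_integral_rV_slice d (T : measurableType d) m (t : T)
    (f : T -> 'rV[R]_m.+1 -> \bar R) :
  jointly_measurable f -> (forall t y, 0 <= f t y)%E ->
  measurable_fun setT (fun x : R => integral_rV (fun y => f t (row_mx (x%:M : 'rV[R]_1) y))).
Proof.
move=> jf f0.
have /= := @measurable_integral_rV _ _ _ _ (jointly_measurable_row_mx jf) (fun _ _ => f0 _ _).
move=> mf; apply: (measurableT_comp (f := fun z : T * R => _) mf (g := fun x : R => (t, x))).
exact: measurable_fun_pair.
Qed.

(** The one-dimensional theorem peels off the first coordinate, and the induction
    hypothesis handles the slice. *)
Lemma tonelli_rV d (T : measurableType d)
    (P : {sigma_finite_measure set T -> \bar R}) m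
    (f : T -> 'rV[R]_m -> \bar R) :
  jointly_measurable f -> (forall t y, 0 <= f t y)%E ->
  (\int[P]_t integral_rV (f t) = integral_rV (fun y => \int[P]_t f t y))%E.
Proof.
elim: m f => [|m IH] f jf f0 //=.
apply: (etrans (fubini_tonelli (m1 := P) (m2 := @lebesgue_measure R)
  (fun z : T * R => integral_rV (fun y => f z.1 (row_mx (z.2%:M : 'rV[R]_1) y))) _ _)).
- by apply: measurable_integral_rV => //; exact: jointly_measurable_row_mx.
- by move=> z; apply: integral_rV_ge0.
- by apply: eq_integral => x _ /=; apply: IH => //; exact: jointly_measurable_row_mx1.
Qed.

(** A function supported in the cube [-r, r]^m is integrated over volume (2 r)^m only. *)
Lemma integral_rV_le m (B r : R) (f : 'rV[R]_m -> \bar R) :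
  0 <= B -> 0 <= r ->
  jointly_measurable (fun _ : unit => f) -> (forall y, 0 <= f y)%E ->
  (forall y, (f y <= B%:E)%E) ->
  (forall y : 'rV[R]_m, (exists j, r < `|y ord0 j|) -> f y = 0%E) ->
  (integral_rV f <= (B * (2 * r) ^+ m)%:E)%E.
Proof.
move=> B0 r0; elim: m f => [|m IH] f jf f0 fB fr /=.
  by rewrite expr0 mulr1.
have IHx (x : R) : (integral_rV (fun y => f (row_mx (x%:M : 'rV[R]_1) y)) <=
    (B * (2 * r) ^+ m)%:E * (\1_(`[- r, r]) x)%:E)%E.
  rewrite indicE; have [xr|/negP xr] := boolP (x \in `[-r, r]%classic).
    rewrite mule1; apply: IH => //; first exact: (jointly_measurable_row_mx1 _ jf).
    move=> y [j jr]; apply: fr; exists (rshift 1 j).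
    by rewrite (row_mxEr (x%:M : 'rV[R]_1) y).
  rewrite mule0 (_ : (fun y => _) = cst 0%E); last first.
    apply/funext => y; apply: fr; exists (lshift m (ord0 : 'I_1) : 'I_(1 + m)).
    rewrite (row_mxEl (x%:M : 'rV[R]_1) y) mxE eqxx mulr1n ltNge ler_norml; apply/negP => h; apply: xr.
    by rewrite inE /= in_itv.
  by rewrite integral_rV0.
apply: (@le_trans _ _ (\int[@lebesgue_measure R]_x
    ((B * (2 * r) ^+ m)%:E * (\1_(`[- r, r]) x)%:E))%E).
  apply: ge0_le_integral => //.
  - by move=> x _; apply: integral_rV_ge0.
  - exact: (@measurable_integral_rV_slice _ _ _ tt (fun _ => f)).
  - apply: measurable_funeM; apply/measurable_EFinP.
    exact: measurable_indic.
rewrite integralZl//; last first.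
  by apply: integrable_indic_itv.
rewrite integral_indic// setIT [X in (_ * X <= _)%E](lebesgue_measure_itv _) /= lte_fin.
case: ifPn => h; rewrite -?EFinD -?EFinM ?mule0 ?lee_fin.
  rewrite exprSr mulrA opprK; lra.
by rewrite mulr0 mulr_ge0 ?exprn_ge0// mulr_ge0.
Qed.

(** Dominated convergence in each coordinate; [integral_rV_le] provides the dominating
    function for the inner integrals. *)
Lemma integral_rV_cvg0 m (B r : R) (f : nat -> 'rV[R]_m -> \bar R) :
  0 <= B -> 0 <= r ->
  (forall k, jointly_measurable (fun _ : unit => f k)) -> (forall k y, 0 <= f k y)%E ->
  (forall k y, (f k y <= B%:E)%E) ->
  (forall k (y : 'rV[R]_m), (exists j, r < `|y ord0 j|) -> f k y = 0%E) ->
  (forall y, f k y @[k --> \oo] --> 0%E) ->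
  integral_rV (f k) @[k --> \oo] --> 0%E.
Proof.
move=> B0 r0; elim: m f => [|m IH] f jf f0 fB fr fcvg /=; first exact: fcvg.
have slice_out k (x : R) (y : 'rV[R]_m) :
    (exists j, r < `|y ord0 j|) -> f k (row_mx (x%:M : 'rV[R]_1) y) = 0%E.
  move=> [j jr]; apply: fr; exists (rshift 1 j).
  by rewrite (row_mxEr (x%:M : 'rV[R]_1) y).
have gB k (x : R) : (integral_rV (fun y => f k (row_mx (x%:M : 'rV[R]_1) y)) <=
    (B * (2 * r) ^+ m)%:E * (\1_(`[- r, r]) x)%:E)%E.
  rewrite indicE; have [xr|/negP xr] := boolP (x \in `[-r, r]%classic).
    rewrite mule1; apply: integral_rV_le => //.
    - exact: (jointly_measurable_row_mx1 _ (jf k)).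
    - by move=> y yr; exact: slice_out.
  rewrite mule0 (_ : (fun y => _) = cst 0%E) ?integral_rV0//.
  apply/funext => y; apply: fr; exists (lshift m (ord0 : 'I_1) : 'I_(1 + m)).
  rewrite (row_mxEl (x%:M : 'rV[R]_1) y) mxE eqxx mulr1n ltNge ler_norml.
  by apply/negP => h; apply: xr; rewrite inE /= in_itv.
have mg k : measurable_fun setT (fun x : R => integral_rV
    (fun y => f k (row_mx (x%:M : 'rV[R]_1) y))).
  exact: (@measurable_integral_rV_slice _ _ _ tt (fun _ => f k)).
have := @dominated_convergence _ _ _ (@lebesgue_measure R) setT measurableT
  (fun k x => integral_rV (fun y => f k (row_mx (x%:M : 'rV[R]_1) y)))
  (cst 0%E) (fun x => (B * (2 * r) ^+ m)%:E * (\1_(`[- r, r]) x)%:E)%E.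
case => //.
- apply: aeW => x _; apply: IH => //.
  + by move=> k; exact: (jointly_measurable_row_mx1 _ (jf k)).
  + by move=> k y yr; exact: slice_out.
- by apply: integrableZl => //; exact: integrable_indic_itv.
- apply: aeW => x k _; rewrite gee0_abs ?gB//.
  exact: integral_rV_ge0.
- by move=> _ _; rewrite integral0.
Qed.

End IteratedIntegral.

(** * Measurability through coordinates *)

Section OpenSets.
Variable R : realType.

Lemma row_ballP m (x y : 'rV[R]_m) (e : R) :
  ball x e y <-> 0 < e /\ forall j, `|x ord0 j - y ord0 j| < e.
Proof.
split=> [[e0 h]|[e0 h]]; split => //.
  by move=> j; exact: (h ord0 j).
by move=> i j; rewrite (ord1 i); exact: h.
Qed.

(** An open set is the union of the countably many rational boxes that it contains, and
    the preimage of a box only involves coordinates. *)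
Lemma measurable_coords_open d (T : measurableType d) m (v : T -> 'rV[R]_m)
    (O : set 'rV[R]_m) :
  open O -> measurable_coords v -> measurable (v @^-1` O).
Proof.
move=> oO mv.
pose box (c : 'rV[rat]_m * rat) : set 'rV[R]_m :=
  [set z | forall j, `|z ord0 j - ratr (c.1 ord0 j)| < ratr c.2].
have mbox c : measurable (v @^-1` box c).
  rewrite (_ : _ @^-1` _ = \bigcap_(j in [set: 'I_m])
      ((fun t => v t ord0 j) @^-1` `]ratr (c.1 ord0 j) - ratr c.2,
         ratr (c.1 ord0 j) + ratr c.2[%classic)); last first.
    apply/seteqP; split => t /= h j.
      by move=> _; rewrite /= in_itv /= -ltr_distl; exact: h.
    by have := h j I; rewrite /= in_itv /= -ltr_distl.
  apply: fin_bigcap_measurable => // j _.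
  rewrite -[X in measurable X]setTI; apply: mv => //.
rewrite (_ : _ @^-1` _ = \bigcup_c (if `[< box c `<=` O >]
    then v @^-1` box c else set0)); last first.
  apply/seteqP; split => [t /= Ot|t [c _]]; last first.
    by case: asboolP => // h; exact: h.
  have [e /= e0 eO] : exists2 e : R, 0 < e & ball (v t) e `<=` O.
    by move: oO; rewrite openE => /(_ _ Ot); rewrite /interior => /nbhs_ballP.
  have [q] : exists q : rat, ratr q \in `]0%R, (e / 2)[.
    by apply: rat_in_itvoo; rewrite divr_gt0.
  rewrite in_itv /= => /andP[q0 qe].
  have /choice[c hc] : forall j, exists c : rat,
      ratr c \in `](v t ord0 j - ratr q), (v t ord0 j + ratr q)[.
    by move=> j; apply: rat_in_itvoo; lra.
  exists (\row_j c j, q) => //; case: asboolP => [_ j /=|].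
    by rewrite mxE distrC ltr_distl; move: (hc j); rewrite in_itv.
  case => z /= hz; apply: eO; apply/row_ballP; split => // j.
  have := hz j; rewrite mxE; move: (hc j); rewrite in_itv /= -ltr_distl => h1 h2.
  have -> : v t ord0 j - z ord0 j =
    - (ratr (c j) - v t ord0 j) - (z ord0 j - ratr (c j))by lra.
  apply: (le_lt_trans (ler_normB _ _)); rewrite normrN.
  by rewrite [e](splitr e) ltrD// (lt_trans _ qe).
apply: countable_bigcupT_measurable => [|c].
  exact: countableP.
by case: ifP.
Qed.

(** The indicator makes the statement meaningful for functions that are continuous on U
    only: a level set is an open subset of U, together with the complement of U when it
    contains the value 0. *)
Lemma measurable_coords_comp d (T : measurableType d) m (v : T -> 'rV[R]_m)
    (U : set 'rV[R]_m) (g : 'rV[R]_m -> R) :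
  open U -> {within U, continuous g} -> measurable_coords v ->
  measurable_fun setT (fun t => \1_U (v t) * g (v t)).
Proof.
move=> oU cg mv; apply: (measurability (@RGenOInfty.G R)).
  exact: RGenOInfty.measurableE.
move=> _ [_ [x ->] <-]; rewrite setTI.
have oUx : open (U `&` g @^-1` `]x, +oo[%classic).
  move: cg; rewrite continuous_open_subspace// => cg.
  rewrite openE => y [Uy gy]; rewrite /interior; apply: filterI.
    by move: oU; rewrite openE; exact.
  have /(_ (`]x, +oo[%classic)) := cg y (mem_set Uy); apply.
  by apply: open_nbhs_nbhs; split => //; exact: itv_open_ray_gt.
have mU := measurable_coords_open oU mv.
have mUx := measurable_coords_open oUx mv.
(* the level set contains the complement of U exactly when x < 0 *)
have [x0|x0] := ltP x 0.
  rewrite (_ : _ @^-1` _ = (~` (v @^-1` U)) `|`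
      v @^-1` (U `&` g @^-1` `]x, +oo[%classic)).
    by apply: measurableU => //; exact: measurableC.
  apply/seteqP; split => t /=; rewrite !in_itv /= !andbT indicE.
    have [Ut|/negP Ut] := boolP (v t \in U).
      by rewrite mul1r => h; right; split => //; exact: set_mem.
    by move=> _; left => h; apply: Ut; exact: mem_set.
  case=> [Ut|[Ut h]]; last by rewrite mem_set// mul1r.
  by rewrite memNset// mul0r.
rewrite (_ : _ @^-1` _ = v @^-1` (U `&` g @^-1` `]x, +oo[%classic))//.
apply/seteqP; split => t /=; rewrite !in_itv /= !andbT indicE.
  have [Ut|/negP Ut] := boolP (v t \in U).
    by rewrite mul1r => h; split => //; exact: set_mem.
  by rewrite mul0r ltNge x0.
by case=> Ut h; rewrite mem_set// mul1r.
Qed.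

End OpenSets.

(** * Supremum bounds from Sobolev's inequality *)

Section SobolevBounds.
Variable R : realType.

(** Sobolev's inequality with the p-th roots removed, since integrals of p-th powers are
    what can be averaged over a probability space. *)
Lemma sobolev_sup m (U : set 'rV[R]_m) (p : R) :
  m%:R < p -> sobolev U -> exists2 C : R, 0 < C &
  forall u, C1 U u -> forall c : R, 0 < c ->
   (integral_rV (fun y => (\1_U y * `|u y| `^ p)%:E) <= (c `^ p)%:E)%E ->
   (integral_rV (fun y =>
          (\1_U y * anorm (fun j => pd u [:: j] y) `^ p)%:E) <= (c `^ p)%:E)%E ->
   forall x, U x -> `|u x| <= C * c.
Proof.
move=> mp sU; have [C C0 hC] := sU _ mp.
have p0 : 0 < p by apply: le_lt_trans mp.
exists (C * 2); first by rewrite mulr_gt0.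
move=> u Cu c c0 h1 h2 x Ux.
have root_le (I : \bar R) : (0 <= I)%E -> (I <= (c `^ p)%:E)%E ->
    (I `^ p^-1 <= c%:E)%E.
  move=> I0 h; have -> : c%:E = ((c `^ p)%:E `^ p^-1)%E.
    by rewrite poweR_EFin -powRrM mulfV ?gt_eqF// powRr1// ltW.
  apply: gt0_ler_poweR => //.
  - by rewrite invr_ge0 ltW.
  - by rewrite in_itv /= I0 leey.
  - by rewrite in_itv /= leey andbT lee_fin powR_ge0.
have ge0 (f : 'rV[R]_m -> R) : (0 <= integral_rV (fun y => (\1_U y * f y `^ p)%:E))%E.
  by apply: integral_rV_ge0 => y; rewrite lee_fin mulr_ge0 ?powR_ge0// indicE.
rewrite -lee_fin; apply: (le_trans (hC u Cu x Ux)).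
have -> : (C * 2 * c)%:E = (C%:E * (c%:E + c%:E))%E.
  by rewrite -EFinD -EFinM; congr EFin; lra.
apply: lee_pmul => //; first by rewrite lee_fin ltW.
  by rewrite adde_ge0 ?poweR_ge0.
by apply: leeD; apply: root_le => //; exact: ge0.
Qed.

Lemma jointly_measurable_sum d (T : measurableType d) m (U : set 'rV[R]_m) (N : nat)
    (Z : 'I_N -> T -> R) (g : 'I_N -> 'rV[R]_m -> R) d' (T' : measurableType d')
    (a : T' -> T) (v : T' -> 'rV[R]_m) :
  open U -> (forall i, measurable_fun setT (Z i)) ->
  (forall i, {within U, continuous (g i)}) ->
  measurable_fun setT a -> measurable_coords v ->
  measurable_fun setT (fun t => \1_U (v t) * (\sum_i Z i (a t) * g i (v t))).
Proof.
move=> oU mZ cg ma mv.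
rewrite (_ : (fun t => _) = fun t => \sum_i Z i (a t) * (\1_U (v t) * g i (v t))).
  apply: measurable_sum => i; apply: measurable_funM.
    exact: measurableT_comp.
  exact: measurable_coords_comp.
apply/funext => t; rewrite mulr_sumr; apply: eq_bigr => i _.
by rewrite mulrCA.
Qed.

Lemma indic_powR m (U : set 'rV[R]_m) (p : R) y (x : R) : 0 < p ->
  \1_U y * `|x| `^ p = `|\1_U y * x| `^ p.
Proof.
move=> p0; rewrite indicE; case: (y \in U); rewrite ?mul1r// !mul0r normr0.
by rewrite powR0// gt_eqF.
Qed.

Lemma jointly_measurable_power d (T : measurableType d) m (U : set 'rV[R]_m) (N : nat)
    (Z : 'I_N -> T -> R) (g : 'I_N -> 'rV[R]_m -> R) (p : R) :
  0 < p -> open U -> (forall i, measurable_fun setT (Z i)) ->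
  (forall i, {within U, continuous (g i)}) ->
  jointly_measurable (fun w y => (\1_U y * `|\sum_i Z i w * g i y| `^ p)%:E).
Proof.
move=> p0 oU mZ cg d' T' a v ma mv; apply/measurable_EFinP.
under eq_fun do rewrite indic_powR//.
apply: (measurableT_comp (measurable_powR p)).
apply: measurableT_comp => //; exact: jointly_measurable_sum.
Qed.

Lemma sqrt_sum_indic m (U : set 'rV[R]_m) y n (f : 'I_n -> R) :
  \1_U y * anorm f = anorm (fun j => \1_U y * f j).
Proof.
rewrite /anorm indicE; case: (y \in U).
  by rewrite mul1r; under [in RHS]eq_bigr do rewrite mul1r.
rewrite mul0r big1 ?sqrtr0// => j _; by rewrite mul0r expr0n.
Qed.

Lemma anorm_ge0 (J : finType) (a : J -> R) : 0 <= anorm a.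
Proof. exact: sqrtr_ge0. Qed.

Lemma jointly_measurable_grad_power d (T : measurableType d) m (U : set 'rV[R]_m) (N n : nat)
    (Z : 'I_N -> T -> R) (g : 'I_N -> 'I_n -> 'rV[R]_m -> R) (p : R) :
  0 < p -> open U -> (forall i, measurable_fun setT (Z i)) ->
  (forall i j, {within U, continuous (g i j)}) ->
  jointly_measurable (fun w y => (\1_U y * anorm (fun j => \sum_i Z i w * g i j y) `^ p)%:E).
Proof.
move=> p0 oU mZ cg d' T' a v ma mv; apply/measurable_EFinP.
under eq_fun => t do rewrite -[anorm _]ger0_norm ?anorm_ge0// indic_powR//.
under eq_fun => t do rewrite sqrt_sum_indic ger0_norm ?anorm_ge0//.
apply: (measurableT_comp (measurable_powR p)).
rewrite /anorm; apply: measurableT_comp.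
  by apply: continuous_measurable_fun; exact: sqrt_continuous.
apply: measurable_sum => j; apply: measurable_funX.
exact: (@jointly_measurable_sum _ _ _ _ _ Z (fun i => g i j)).
Qed.

Lemma cvg_sumr (T : Type) {F : set_system T} {FF : Filter F} (I : Type)
    (r : seq I) (f : I -> T -> R) (l : I -> R) :
  (forall i, f i t @[t --> F] --> l i) ->
  (\sum_(i <- r) f i t) @[t --> F] --> \sum_(i <- r) l i.
Proof.
move=> fl; elim: r => [|i r IH].
  rewrite big_nil; under eq_fun do rewrite big_nil.
  exact: cvg_cst.
rewrite big_cons; under eq_fun do rewrite big_cons.
by apply: cvgD.
Qed.

Lemma cvg_expr (T : Type) {F : set_system T} {FF : Filter F} (f : T -> R) (l : R) n :
  f t @[t --> F] --> l -> f t ^+ n @[t --> F] --> l ^+ n.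
Proof.
move=> fl; elim: n => [|n IH]; first exact: cvg_cst.
under eq_fun do rewrite exprS; rewrite exprS; exact: cvgM.
Qed.

Lemma cvg_fin (T : Type) {F : set_system T} {FF : Filter F} (f : T -> R) (l : R) :
  f t @[t --> F] --> l -> (f t)%:E @[t --> F] --> l%:E.
Proof. by move=> fl; apply: cvg_EFin => //; exact: nearW. Qed.

Lemma derivable_lin m (N : nat) (z : 'I_N -> R) (u : 'I_N -> 'rV[R]_m -> R)
    (x v : 'rV[R]_m) :
  (forall i, derivable (u i) x v) ->
  is_derive x v (fun y => \sum_i z i * u i y) (\sum_i z i * 'D_v (u i) x).
Proof.
move=> du.
have -> : (fun y => \sum_i z i * u i y) = \sum_i (z i \*: u i).
  by apply/funext => y; rewrite fct_sumE.
apply: is_derive_sum => i; apply: DeriveDef.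
  exact: derivableZ.
by rewrite deriveZ.
Qed.

Lemma C1_lin m (U : set 'rV[R]_m) (N : nat) (z : 'I_N -> R)
    (u : 'I_N -> 'rV[R]_m -> R) :
  open U -> (forall i, C1 U (u i)) ->
  C1 U (fun y => \sum_i z i * u i y) /\
  forall x j, U x -> pd (fun y => \sum_i z i * u i y) [:: j] x =
     \sum_i z i * pd (u i) [:: j] x.
Proof.
move=> oU Cu.
have du i x j : U x -> derivable (u i) x (delta_mx ord0 j).
  by move=> Ux; apply: ((Cu i).1 [::] j x).
have pdE x j : U x -> pd (fun y => \sum_i z i * u i y) [:: j] x =
     \sum_i z i * pd (u i) [:: j] x.
  move=> Ux /=; have dd i := du i x j Ux.
  by have /(@derive_val _ _ _ _ _ _ _) := derivable_lin z dd.
split=> //; split.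
  move=> [|//] j x _ Ux /=; have dd i := du i x j Ux.
  by have /(@ex_derive _ _ _ _ _ _ _) := derivable_lin z dd.
have csum (g : 'I_N -> 'rV[R]_m -> R) : (forall i, {within U, continuous (g i)}) ->
    {within U, continuous (fun y => \sum_i z i * g i y)}.
  move=> cg x; apply: (@cvg_sumr _ _ _ _ _ (fun i y => z i * g i y)) => i.
  by apply: cvgM; [exact: cvg_cst|exact: cg].
move=> [|j [|//]] _; first by apply: csum => i; exact: ((Cu i).2 [::]).
have cc : {within U, continuous (fun y => \sum_i z i * pd (u i) [:: j] y)}.
  by apply: csum => i; exact: ((Cu i).2 [:: j]).
apply: (subspace_eq_continuous _ cc).
by move=> y /set_mem Uy; rewrite /from_subspace; exact: (esym (pdE _ _ Uy)).
Qed.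

(** Crude convexity: the sum is at most n times its largest term. *)
Lemma sum_pow_le n (a : 'I_n -> R) q : (0 < n)%N -> (forall j, 0 <= a j) ->
  (\sum_j a j) ^+ q <= n%:R ^+ q * \sum_j a j ^+ q.
Proof.
case: n a => // n a _ a0.
have [k _ hk] := @arg_maxP _ _ _ (ord0 : 'I_n.+1) xpredT a isT.
apply: (@le_trans _ _ ((n.+1%:R * a k) ^+ q)).
  rewrite lerXn2r ?nnegrE ?mulr_ge0 ?sumr_ge0//.
  rewrite mulr_natl -[X in _ <= _ *+ X](card_ord n.+1) -sumr_const.
  by apply: ler_sum => i _; exact: hk.
rewrite exprMn ler_wpM2l ?exprn_ge0//.
by rewrite (bigD1 k)//= lerDl sumr_ge0// => i _; rewrite exprn_ge0.
Qed.

Lemma powR_even (x : R) q : `|x| `^ (2 * q)%:R = x ^+ (2 * q).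
Proof. by rewrite powR_mulrn// exprM real_normK ?num_real// -exprM. Qed.

Lemma anorm_even n (f : 'I_n -> R) q :
  anorm f `^ (2 * q)%:R = (\sum_j f j ^+ 2) ^+ q.
Proof.
by rewrite powR_mulrn ?anorm_ge0// exprM sqr_sqrtr// sumr_ge0// => j _; rewrite sqr_ge0.
Qed.

(** If the supremum of |u| exceeds c, then by [sobolev_sup] one of the two integrals of
    |u|^2q and |grad u|^2q over U exceeds (c / C)^2q.  By Tonelli the expectations of these
    integrals are at most the volume of the cube times the moment bound B, and Markov's
    inequality concludes.  The constant depends on U, r and q only, so the lemma applies to
    any number N of summands and any probability space. *)
Lemma sobolev_prob m (U : set 'rV[R]_m) (r : R) (q : nat) :
  (0 < m)%N -> (m < 2 * q)%N -> 0 < r ->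
  open U -> sobolev U -> (forall y, U y -> forall j, `|y ord0 j| <= r) ->
  exists2 C : R, 0 < C & forall d (T : measurableType d) (P : probability T R)
    (N : nat) (Z : 'I_N -> T -> R) (u : 'I_N -> 'rV[R]_m -> R) (B c : R),
  (forall i, measurable_fun setT (Z i)) -> (forall i, C1 U (u i)) ->
  0 <= B -> 0 < c ->
  (forall y, U y -> (\int[P]_w ((\sum_i Z i w * u i y) ^+ (2 * q))%:E <= B%:E)%E) ->
  (forall y j, U y ->
    (\int[P]_w ((\sum_i Z i w * pd (u i) [:: j] y) ^+ (2 * q))%:E <= B%:E)%E) ->
  exists A : set T, [/\ measurable A, (P A <= (C * B / c ^+ (2 * q))%:E)%E &
    forall w, ~ A w -> forall y, U y -> `|\sum_i Z i w * u i y| <= c].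
Proof.
move=> m0 mq r0 oU sU Ur.
have p0 : 0 < (2 * q)%:R :> R by rewrite ltr0n (leq_trans _ mq).
have mq' : m%:R < (2 * q)%:R :> R by rewrite ltr_nat.
have [C C0 hC] := sobolev_sup mq' sU.
(* V is the volume of the cube; K adds the factor lost in comparing (sum of squares)^q with
   the sum of 2q-th powers *)
pose V : R := (2 * r) ^+ m.
have V0 : 0 <= V by rewrite exprn_ge0// mulr_ge0// ltW.
pose K : R := V * (1 + m%:R ^+ q * m%:R).
(* adding 1 makes the constant positive *)
exists (C ^+ (2 * q) * K + 1).
  rewrite ltr_wpDl// mulr_ge0 ?exprn_ge0 ?(ltW C0)// mulr_ge0// addr_ge0// mulr_ge0// exprn_ge0.
move=> d T P N Z u B c mZ Cu B0 c0 hB0 hB1.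
pose f0 w y := (\1_U y * `|\sum_i Z i w * u i y| `^ (2 * q)%:R)%:E.
pose f1 w y := (\1_U y * anorm (fun j => \sum_i Z i w * pd (u i) [:: j] y)
    `^ (2 * q)%:R)%:E.
have jf0 : jointly_measurable f0 by apply: jointly_measurable_power => // i; exact: ((Cu i).2 [::]).
have jf1 : jointly_measurable f1 by apply: jointly_measurable_grad_power => // i j; exact: ((Cu i).2 [:: j]).
have f00 w y : (0 <= f0 w y)%E by rewrite lee_fin mulr_ge0 ?powR_ge0// indicE.
have f10 w y : (0 <= f1 w y)%E by rewrite lee_fin mulr_ge0 ?powR_ge0// indicE.
have cC : 0 < (c / C) `^ (2 * q)%:R by apply: powR_gt0; exact: divr_gt0.
have out (y : 'rV[R]_m) : (exists j, r < `|y ord0 j|) -> y \notin U.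
  by move=> [j jr]; apply/negP => /set_mem /Ur /(_ j); rewrite leNgt jr.
have jint (f : T -> 'rV[R]_m -> \bar R) : jointly_measurable f -> (forall w y, (0 <= f w y)%E) ->
    jointly_measurable (fun _ : unit => fun y => \int[P]_w f w y)%E.
  move=> jf ff d' T' a v ma mv.
  apply: (measurable_fun_fubini_tonelli_F (m2 := P)
    (fun z : T' * T => f z.2 (v z.1))) => [|z]; last exact: ff.
  apply: (jf _ _ (fun z : T' * T => z.2) (fun z => v z.1)) => [|j].
    exact: measurable_snd.
  exact: (measurableT_comp (mv j) measurable_fst).
have EI (f : T -> 'rV[R]_m -> \bar R) (B' : R) : 0 <= B' -> jointly_measurable f ->
    (forall w y, (0 <= f w y)%E) -> (forall w y, y \notin U -> f w y = 0%E) ->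
    (forall y, U y -> (\int[P]_w f w y <= B'%:E)%E) ->
    (\int[P]_w integral_rV (f w) <= (B' * V)%:E)%E.
  move=> B'0 jf ff fU fB; rewrite tonelli_rV//.
  apply: integral_rV_le => //; first exact: ltW.
  - exact: jint.
  - by move=> y; exact: integral_ge0.
  - move=> y; have [/set_mem|Uy] := boolP (y \in U); first exact: fB.
    by under eq_integral do rewrite fU//; rewrite integral0 lee_fin.
  - move=> y /out Uy; by under eq_integral do rewrite fU//; rewrite integral0.
have MK (f : T -> 'rV[R]_m -> \bar R) (B' : R) : 0 <= B' -> jointly_measurable f ->
    (forall w y, (0 <= f w y)%E) -> (forall w y, y \notin U -> f w y = 0%E) ->
    (forall y, U y -> (\int[P]_w f w y <= B'%:E)%E) ->
    measurable [set w | ((((c / C) `^ (2 * q)%:R)%:E) <= integral_rV (f w))%E] /\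
    (P [set w | ((((c / C) `^ (2 * q)%:R)%:E) <= integral_rV (f w))%E] <=
      (B' * V * C ^+ (2 * q) / c ^+ (2 * q))%:E)%E.
  move=> B'0 jf ff fU fB.
  have mI : measurable_fun setT (fun w => integral_rV (f w)).
    exact: measurable_integral_rV.
  have := @le_integral_comp_abse _ _ _ P setT measurableT (fun w => integral_rV (f w))
    ((c / C) `^ (2 * q)%:R) id (@measurable_id _ _ setT) _ _ mI cC.
  rewrite setTI => /(_ (fun _ h => h) (fun _ _ _ _ h => h)).
  rewrite (_ : [set x | _] =
    [set w | ((((c / C) `^ (2 * q)%:R)%:E) <= integral_rV (f w))%E]); last first.
    by apply/seteqP; split => w /=; rewrite gee0_abs//; exact: integral_rV_ge0.
  under [X in (_ <= X)%E]eq_integral => w _ do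
    rewrite gee0_abs ?integral_rV_ge0//.
  move=> h; split.
    rewrite -[X in measurable X]setTI.
    by apply: emeasurable_fun_c_infty.
  have := le_trans h (EI f B' B'0 jf ff fU fB).
  rewrite -lee_pdivlMl// => /le_trans; apply.
  rewrite -EFinM lee_fin powR_mulrn ?divr_ge0 ?(ltW c0) ?(ltW C0)// expr_div_n invf_div.
  by rewrite mulrC mulrA.
have fU0 w y : y \notin U -> f0 w y = 0%E.
  by move=> h; rewrite /f0 indicE (negbTE h) mul0r.
have fU1 w y : y \notin U -> f1 w y = 0%E.
  by move=> h; rewrite /f1 indicE (negbTE h) mul0r.
have [|mA0 PA0] := MK f0 B B0 jf0 f00 fU0.
  move=> y Uy; apply: (le_trans _ (hB0 y Uy)).
  rewrite le_eqVlt; apply/orP; left; apply/eqP; apply: eq_integral => w _.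
  by rewrite /f0 indicE mem_set// mul1r powR_even.
have [||mA1 PA1] := MK f1 (m%:R ^+ q * (m%:R * B)) _ jf1 f10 fU1.
- by rewrite mulr_ge0 ?exprn_ge0// mulr_ge0.
- move=> y Uy.
  have mS j : measurable_fun setT (fun w =>
      ((\sum_i Z i w * pd (u i) [:: j] y) ^+ (2 * q))%:E).
    apply/measurable_EFinP; apply: measurable_funX; apply: measurable_sum => i.
    by apply: measurable_funM.
  have eint n x : (0 <= (x ^+ (2 * n))%:E :> \bar R)%E.
    by rewrite lee_fin exprM exprn_ge0// sqr_ge0.
  apply: (@le_trans _ _ (\int[P]_w ((m%:R ^+ q)%:E * \sum_j
      ((\sum_i Z i w * pd (u i) [:: j] y) ^+ (2 * q))%:E))%E).
    apply: ge0_le_integral => //.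
    - apply: (jf1 _ _ id (fun=> y)) => //.
    - by apply: measurable_funeM; exact: emeasurable_sum.
    - move=> w _; rewrite /f1 indicE mem_set// mul1r anorm_even sumEFin -EFinM lee_fin.
      apply: le_trans; first by apply: sum_pow_le => // j; exact: sqr_ge0.
      by under eq_bigr do rewrite -exprM.
  rewrite ge0_integralZl ?lee_fin ?exprn_ge0//; last 2 first.
  - exact: emeasurable_sum.
  - by move=> w _; apply: sume_ge0.
  rewrite EFinM lee_wpmul2l ?lee_fin ?exprn_ge0//.
  rewrite ge0_integral_sum//.
  apply: le_trans; first by apply: lee_sum => j _; exact: hB1.
  by rewrite sumEFin lee_fin sumr_const card_ord mulr_natl.
exists ([set w | ((((c / C) `^ (2 * q)%:R)%:E) <= integral_rV (f0 w))%E] `|`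
  [set w | ((((c / C) `^ (2 * q)%:R)%:E) <= integral_rV (f1 w))%E]); split.
- exact: measurableU.
- apply: (le_trans (measureU2 _ _ _)) => //.
  apply: (le_trans (leeD PA0 PA1)); rewrite -EFinD lee_fin.
  rewrite -mulrDl ler_wpM2r// ?invr_ge0 ?exprn_ge0 ?(ltW c0)//.
  rewrite mulrDl mul1r -[leLHS]addr0 lerD// /K.
  by rewrite le_eqVlt; apply/orP; left; apply/eqP; ring.
move=> w /not_orP[/negP h0 /negP h1] y Uy.
rewrite -ltNge in h0; rewrite -ltNge in h1.
have [Cw pdw] := @C1_lin m U N (fun i => Z i w) u oU Cu.
have -> : c = C * (c / C) by rewrite mulrC divfK// gt_eqF.
apply: (hC _ Cw _ (divr_gt0 c0 C0) (ltW h0) _ y Uy).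
apply: (le_trans _ (ltW h1)); rewrite le_eqVlt; apply/orP; left; apply/eqP.
congr integral_rV; apply/funext => x; rewrite /f1 indicE.
have [/set_mem Ux|] := boolP (x \in U); last by rewrite !mul0r.
by congr ((_ * (anorm _ `^ _))%:E); apply/funext => j; rewrite pdw.
Qed.

(** By dominated convergence the integrals of |u_k|^p and |grad u_k|^p over the bounded set
    U tend to 0, and [sobolev_sup] turns this into uniform convergence. *)
Lemma sobolev_unif m (U : set 'rV[R]_m) (r K : R) (u : nat -> 'rV[R]_m -> R) :
  0 < r -> 0 <= K ->
  open U -> sobolev U -> (forall y, U y -> forall j, `|y ord0 j| <= r) ->
  (forall k, C1 U (u k)) ->
  (forall k x, U x -> `|u k x| <= K) ->
  (forall k x j, U x -> `|pd (u k) [:: j] x| <= K) ->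
  (forall x, U x -> u k x @[k --> \oo] --> 0) ->
  (forall x j, U x -> pd (u k) [:: j] x @[k --> \oo] --> 0) ->
  forall e, 0 < e -> \forall k \near \oo, forall x, U x -> `|u k x| <= e.
Proof.
move=> r0 K0 oU sU Ur Cu uK duK u0 du0 e e0.
(* any even exponent larger than the dimension *)
pose q := m.+1.
have mq : m%:R < (2 * q)%:R :> R by rewrite ltr_nat mul2n -addnn ltn_addr.
have p0 : 0 < (2 * q)%:R :> R by rewrite (le_lt_trans _ mq).
have [C C0 hC] := sobolev_sup mq sU.
pose f0 k y := (\1_U y * `|\sum_(i < 1) 1 * u k y| `^ (2 * q)%:R)%:E.
pose f1 k y := (\1_U y * anorm (fun j => \sum_(i < 1) 1 * pd (u k) [:: j] y)
    `^ (2 * q)%:R)%:E.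
have jf0 k : jointly_measurable (fun _ : unit => f0 k).
  apply: (@jointly_measurable_power _ _ _ _ _ (fun (_ : 'I_1) _ => 1) (fun _ y => u k y)) => // _.
  exact: ((Cu k).2 [::]).
have jf1 k : jointly_measurable (fun _ : unit => f1 k).
  apply: (@jointly_measurable_grad_power _ _ _ _ _ _ (fun (_ : 'I_1) _ => 1)
    (fun _ j y => pd (u k) [:: j] y)) => // _ j.
  exact: ((Cu k).2 [:: j]).
have f00 k y : (0 <= f0 k y)%E by rewrite lee_fin mulr_ge0 ?powR_ge0// indicE.
have f10 k y : (0 <= f1 k y)%E by rewrite lee_fin mulr_ge0 ?powR_ge0// indicE.
have out (y : 'rV[R]_m) : (exists j, r < `|y ord0 j|) -> y \notin U.
  by move=> [j jr]; apply/negP => /set_mem /Ur /(_ j); rewrite leNgt jr.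
have fU0 k y : y \notin U -> f0 k y = 0%E.
  by move=> h; rewrite /f0 indicE (negbTE h) mul0r.
have fU1 k y : y \notin U -> f1 k y = 0%E.
  by move=> h; rewrite /f1 indicE (negbTE h) mul0r.
have sum1 (x : R) : \sum_(i < 1) 1 * x = x by rewrite big_ord_recl big_ord0 mul1r addr0.
have f0E k y : U y -> f0 k y = ((u k y) ^+ (2 * q))%:E.
  by move=> Uy; rewrite /f0 sum1 indicE mem_set// mul1r powR_even.
have f1E k y : U y -> f1 k y = ((\sum_j pd (u k) [:: j] y ^+ 2) ^+ q)%:E.
  move=> Uy; rewrite /f1 indicE mem_set// mul1r anorm_even; congr ((_ ^+ _)%:E).
  by apply: eq_bigr => j _; rewrite sum1.
pose B := K ^+ (2 * q) + (m%:R * K ^+ 2) ^+ q.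
have B0 : 0 <= B by rewrite addr_ge0 ?exprn_ge0// mulr_ge0// exprn_ge0.
have f0B k y : (f0 k y <= B%:E)%E.
  have [/set_mem Uy|/fU0 ->] := boolP (y \in U); last by rewrite lee_fin.
  rewrite f0E// lee_fin ler_wpDr ?exprn_ge0 ?mulr_ge0 ?exprn_ge0//.
  by rewrite !exprM lerXn2r ?nnegrE ?sqr_ge0// -real_normK ?num_real// lerXn2r ?nnegrE ?uK.
have f1B k y : (f1 k y <= B%:E)%E.
  have [/set_mem Uy|/fU1 ->] := boolP (y \in U); last by rewrite lee_fin.
  rewrite f1E// lee_fin ler_wpDl ?exprn_ge0//.
  rewrite lerXn2r ?nnegrE ?mulr_ge0 ?exprn_ge0 ?sumr_ge0//.
    by move=> j _; rewrite sqr_ge0.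
  rewrite mulr_natl -[X in _ <= _ *+ X](card_ord m) -sumr_const ler_sum// => j _.
  by rewrite -real_normK ?num_real// lerXn2r ?nnegrE ?duK.
have c0 : integral_rV (f0 k) @[k --> \oo] --> 0%E.
  apply: (@integral_rV_cvg0 _ _ B r) => //; first exact: ltW.
  - by move=> k y /out /fU0.
  move=> y; have [/set_mem Uy|/fU0 h] := boolP (y \in U); last first.
    by under eq_fun do rewrite h; exact: cvg_cst.
  under eq_fun do rewrite f0E//.
  have := cvg_fin (cvg_expr (n := 2 * q) (u0 y Uy)).
  by rewrite expr0n (_ : (2 * q == 0)%N = false)//; exact.
have c1 : integral_rV (f1 k) @[k --> \oo] --> 0%E.
  apply: (@integral_rV_cvg0 _ _ B r) => //; first exact: ltW.
  - by move=> k y /out /fU1.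
  move=> y; have [/set_mem Uy|/fU1 h] := boolP (y \in U); last first.
    by under eq_fun do rewrite h; exact: cvg_cst.
  under eq_fun do rewrite f1E//.
  have := cvg_fin (cvg_expr (n := q) (cvg_sumr (r := enum 'I_m)
    (fun j => cvg_expr (n := 2) (du0 y j Uy)))).
  rewrite big1_seq => [|j _]; last by rewrite expr0n.
  rewrite expr0n (_ : (q == 0)%N = false)//.
  by under eq_fun do rewrite big_enum; exact.
have cC : 0 < (e / C) `^ (2 * q)%:R by apply: powR_gt0; exact: divr_gt0.
have ev (f : nat -> 'rV[R]_m -> \bar R) : (forall k y, 0 <= f k y)%E ->
    integral_rV (f k) @[k --> \oo] --> 0%E ->
    \forall k \near \oo, (integral_rV (f k) <= ((e / C) `^ (2 * q)%:R)%:E)%E.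
  move=> f_0 fc; have := fc; move/fine_cvgP => [ff fc'].
  have : \forall k \near \oo, `|fine (integral_rV (f k)) - 0| <
     (e / C) `^ (2 * q)%:R by move/cvgrPdistC_lt : fc'; exact.
  move: ff; apply: filterS2 => k fk; rewrite subr0 => /ltW h.
  by rewrite -(fineK fk) lee_fin (le_trans (ler_norm _)).
have := ev _ f10 c1; have := ev _ f00 c0; apply: filterS2 => k h0 h1 y Uy.
have -> : e = C * (e / C) by rewrite mulrC divfK// gt_eqF.
apply: (hC _ (Cu k) _ (divr_gt0 e0 C0) _ _ y Uy).
- apply: (le_trans _ h0); rewrite le_eqVlt; apply/orP; left; apply/eqP.
  by congr integral_rV; apply/funext => x; rewrite /f0 sum1.
- apply: (le_trans _ h1); rewrite le_eqVlt; apply/orP; left; apply/eqP.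
  congr integral_rV; apply/funext => x; rewrite /f1.
  by congr ((_ * (anorm _ `^ _))%:E); apply/funext => j; rewrite sum1.
Qed.

End SobolevBounds.

(** * Exponential moments of normal variables *)

Section NormalMGF.
Variable R : realType.
Local Notation leb := (@lebesgue_measure R).

Lemma ge0_integral_normal_prob (m s : R) (f : R -> \bar R) :
  (forall x, 0 <= f x)%E -> measurable_fun setT f ->
  (\int[normal_prob m s]_x f x = \int[leb]_x (f x * (normal_pdf m s x)%:E))%E.
Proof.
move=> f0 mf.
have dom := normal_prob_dominates m s.
have fi := Radon_Nikodym_SigmaFinite.f_integrable dom.
rewrite -(Radon_Nikodym_SigmaFinite.change_of_variables dom f0 measurableT mf).
apply: ae_eq_integral => //.
- by apply: emeasurable_funM => //; exact: (measurable_int _ fi).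
- by apply: emeasurable_funM => //; apply/measurable_EFinP; exact: measurable_normal_pdf.
- apply: ae_eqe_mul2l; apply: integral_ae_eq => //.
    by apply/measurable_EFinP; exact: measurable_normal_pdf.
  by move=> E _ mE; rewrite -Radon_Nikodym_SigmaFinite.f_integral.
Qed.

(** Completing the square shifts the mean of the density to l s^2. *)
Lemma normal_mgf (s l : R) : s != 0 ->
  (\int[normal_prob 0 s]_x (expR (l * x))%:E = (expR (l ^+ 2 * s ^+ 2 / 2))%:E)%E.
Proof.
move=> s0; rewrite ge0_integral_normal_prob; last 2 first.
- by move=> x; rewrite lee_fin expR_ge0.
- by apply/measurable_EFinP; apply: measurableT_comp => //; exact: measurable_funM.
under eq_integral => x _.
  rewrite -EFinM (_ : expR (l * x) * normal_pdf 0 s x = expR (l ^+ 2 * s ^+ 2 / 2) * normal_pdf (l * s ^+ 2) s x).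
    rewrite EFinM; over.
  have E (a b c e p : R) : a * b = c * e -> a * (p * b) = c * (p * e).
    by move=> h; rewrite mulrCA h mulrCA.
  rewrite !normal_pdfE//; apply: E.
  rewrite /normal_fun -!expRD; congr expR; field.
  by rewrite s0.
rewrite integralZl//; last exact: integrable_normal_pdf.
by rewrite integral_normal_pdf mule1.
Qed.

End NormalMGF.

(** * Integrals of products of independent variables *)

Section Independence.
Context (R : realType) d (Om : measurableType d) (P : probability Om R).

(** The product rule on rectangles identifies the joint law of (U, V) with a product
    measure, to which Tonelli's theorem applies. *)
Lemma ge0_integral_indep d1 d2 (T1 : measurableType d1) (T2 : measurableType d2)
    (U : Om -> T1) (V : Om -> T2) (N : {sigma_finite_measure set T2 -> \bar R})
    (f : T1 -> \bar R) (g : T2 -> \bar R) :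
  measurable_fun setT U -> measurable_fun setT V ->
  (forall A B, measurable A -> measurable B ->
     P (U @^-1` A `&` V @^-1` B) = (P (U @^-1` A) * N B)%E) ->
  measurable_fun setT f -> measurable_fun setT g ->
  (forall x, 0 <= f x)%E -> (forall x, 0 <= g x)%E ->
  (\int[P]_w (f (U w) * g (V w)) = \int[P]_w f (U w) * \int[N]_y g y)%E.
Proof.
move=> mU mV UV mf mg f0 g0.
have mUV : measurable_fun setT (fun w => (U w, V w)) by exact: measurable_fun_pair.
pose m1 : probability T1 R := distribution P (mfun_Sub (mem_set mU)).
pose m' : probability _ R := distribution P (mfun_Sub (mem_set mUV)).
have mfg : measurable_fun setT (fun z : T1 * T2 => f z.1 * g z.2)%E.
  by apply: emeasurable_funM; apply: measurableT_comp.
transitivity (\int[m']_z (f z.1 * g z.2))%E.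
  rewrite ge0_integral_distribution//.
  by move=> z; rewrite mule_ge0.
transitivity (\int[(m1 \x N)%E]_z (f z.1 * g z.2))%E.
  apply: eq_measure_integral => X mX _.
  apply/esym; apply: product_measure_unique => // A B mA mB; exact: UV.
rewrite fubini_tonelli1//; last by move=> z; rewrite mule_ge0.
under eq_integral => x _.
  rewrite /fubini_F /= ge0_integralZl//; over.
rewrite ge0_integralZr//; last exact: integral_ge0.
congr (_ * _)%E.
by rewrite ge0_integral_distribution.
Qed.

End Independence.

(** * From exponential moments to moments *)

Section MGFLimit.
Context (R : realType) d (Om : measurableType d) (P : probability Om R).

(** The series of the squares has finite expectation, so it converges almost surely and its
    terms tend to 0. *)
Lemma ae_cvg_of_summable (Z : nat -> Om -> R) :
  (forall k, measurable_fun setT (Z k)) ->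
  (forall k, \int[P]_w ((Z k w) ^+ 2)%:E <= ((1 / 2) ^+ k)%:E)%E ->
  {ae P, forall w, Z k w @[k --> \oo] --> 0}.
Proof.
move=> mZ hZ.
pose f k w : \bar R := ((Z k w) ^+ 2)%:E.
have mf k : measurable_fun setT (f k).
  by apply/measurable_EFinP; exact: measurable_funX.
have f0 k w : (0 <= f k w)%E by rewrite lee_fin sqr_ge0.
have iS : P.-integrable setT (fun w => \sum_(0 <= k <oo) f k w)%E.
  apply/integrableP; split.
    apply: ge0_emeasurable_sum => //.
  under eq_integral => w _ do rewrite gee0_abs ?nneseries_ge0//.
  rewrite integral_nneseries//.
  apply: (@le_lt_trans _ _ (\sum_(0 <= k <oo) ((1 / 2) ^+ k)%:E)%E).
    by apply: lee_nneseries => [k _ _|k _]; [exact: integral_ge0|exact: hZ].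
  apply: (@le_lt_trans _ _ 2%:E); last by rewrite ltry.
  apply: lime_le; first by apply: is_cvg_nneseries => k _ _; rewrite lee_fin exprn_ge0.
  apply: nearW => n; rewrite sumEFin lee_fin.
  suff -> : \sum_(0 <= k < n) (1 / 2) ^+ k = 2 - 2 * (1 / 2) ^+ n :> R.
    by rewrite lerBlDr lerDl mulr_ge0// exprn_ge0.
  elim: n => [|n IH]; first by rewrite big_nil expr0; lra.
  by rewrite big_nat_recr//= IH exprS; lra.
have := integrable_ae measurableT iS.
apply: filterS => w /(_ I) fin.
have : cvgn (series (fun k => (Z k w) ^+ 2)).
  apply: nnseries_is_cvg; first by move=> k; exact: sqr_ge0.
  by rewrite -ge0_fin_numE// nneseries_ge0// => k _ _; exact: f0.
move=> cs; have h := cvg_series_cvg_0 cs.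
apply/norm_cvg0P.
have := cvg_comp _ _ h (@sqrt_continuous R 0).
rewrite sqrtr0 (_ : _ \o _ = fun k => `|Z k w|)//.
by apply/funext => k /=; rewrite sqrtr_sqr.
Qed.

(** Convergence in L2 gives almost sure convergence along a subsequence, and Fatou's lemma
    preserves upper bounds of exponential moments. *)
Lemma mgf_limit (Yn : nat -> Om -> R) (Y : Om -> R) (en : nat -> R) (e l : R) :
  (forall n, measurable_fun setT (Yn n)) -> measurable_fun setT Y ->
  (\int[P]_w ((Yn n w - Y w) ^+ 2)%:E)%E @[n --> \oo] --> 0%E ->
  (forall n, \int[P]_w (expR (l * Yn n w))%:E <= (en n)%:E)%E ->
  en n @[n --> \oo] --> e ->
  (\int[P]_w (expR (l * Y w))%:E <= e%:E)%E.
Proof.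
move=> mYn mY h2 hm he; apply/lee_addgt0Pr => r r0.
(* indices where the squared distance is at most 2^-k and the bound is within r of its
   limit *)
have ev k : exists n, (\int[P]_w ((Yn n w - Y w) ^+ 2)%:E <= ((1 / 2) ^+ k)%:E)%E /\
    en n <= e + r.
  have k0 : 0 < (1 / 2 : R) ^+ k by rewrite exprn_gt0.
  have e1 : \forall n \near \oo, (\int[P]_w ((Yn n w - Y w) ^+ 2)%:E <= ((1 / 2) ^+ k)%:E)%E.
    have /fine_cvgP[ff /cvgrPdistC_lt/(_ _ k0) fc] := h2.
    move: ff fc; apply: filterS2 => n fn; rewrite subr0 => /ltW fc.
    by rewrite -(fineK fn) lee_fin (le_trans (ler_norm _)).
  have e2 : \forall n \near \oo, en n <= e + r.
    have /cvgrPdistC_lt/(_ _ r0) := he; apply: filterS => n hn.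
    by rewrite -lerBlDl (le_trans (ler_norm _)) ?ltW.
  have [n _ hn] := filterI e1 e2.
  by exists n; have := hn n (leqnn n).
have [nk hnk] := choice ev.
have mZ k : measurable_fun setT (fun w => Yn (nk k) w - Y w) by exact: measurable_funB.
have ac := ae_cvg_of_summable mZ (fun k => (hnk k).1).
have mexp (Z : Om -> R) : measurable_fun setT Z ->
    measurable_fun setT (fun w => (expR (l * Z w))%:E).
  move=> mZ'; apply/measurable_EFinP; apply: measurableT_comp => //.
  exact: measurable_funM.
have : (\int[P]_w limn_einf (fun k => (expR (l * Yn (nk k) w))%:E) <=
   limn_einf (fun k => \int[P]_w (expR (l * Yn (nk k) w))%:E))%E.
  apply: fatou => //.
  - by move=> n; exact: mexp.
have -> : (\int[P]_w limn_einf (fun k => (expR (l * Yn (nk k) w))%:E) =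
    \int[P]_w (expR (l * Y w))%:E)%E.
  apply: ae_eq_integral => //.
  - apply: (emeasurable_fun_cvg
      (fun n w => einfs (fun k => (expR (l * Yn (nk k) w))%:E) n)).
      by move=> n; apply: measurable_fun_einfs => k; exact: mexp.
    by move=> w _; rewrite limn_einf_lim; exact: is_cvg_einfs.
  - exact: mexp.
  - move: ac; apply: filterS => w hw _.
    have : (expR (l * Yn (nk k) w))%:E @[k --> \oo] --> (expR (l * Y w))%:E.
      apply: cvg_fin.
      have h : l * Yn (nk k) w @[k --> \oo] --> l * Y w.
        apply: cvgM; first exact: cvg_cst.
        rewrite -[X in _ --> X]add0r.
        under eq_fun => k do rewrite -[Yn (nk k) w](subrK (Y w)).
        by apply: cvgD => //; exact: cvg_cst.
      exact: (cvg_comp _ _ h (@continuous_expR R _)).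
    by move=> /cvg_limn_einf_sup[].
move=> /le_trans; apply.
rewrite limn_einf_lim; apply: lime_le; first exact: is_cvg_einfs.
apply: nearW => n.
apply: (@le_trans _ _ (\int[P]_w (expR (l * Yn (nk n) w))%:E)%E).
  by apply: ereal_inf_lbound; exists n => /=.
by apply: (le_trans (hm _)); rewrite -EFinD lee_fin; exact: (hnk n).2.
Qed.

Lemma expR_ge_pow (x : R) n : 0 <= x -> x ^+ n / n`!%:R <= expR x.
Proof.
case: n => [|n] x0; last by apply: le_trans (expR_ge1Dxn n x0); rewrite lerDr.
by rewrite expr0 fact0 divr1 -expR0 ler_expR.
Qed.

(** The bound x^2q / (2q)! <= e^x + e^-x is used at x = l Y with l = V^(-1/2), the scale at
    which both exponential moments are at most e^(1/2). *)
Lemma moment_of_mgf (Y : Om -> R) (V : R) q : 0 < V ->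
  measurable_fun setT Y ->
  (forall l, \int[P]_w (expR (l * Y w))%:E <= (expR (l ^+ 2 * V / 2))%:E)%E ->
  (\int[P]_w ((Y w) ^+ (2 * q))%:E <=
     (2 * (2 * q)`!%:R * expR (1 / 2) * V ^+ q)%:E)%E.
Proof.
move=> V0 mY hm; pose l := (Num.sqrt V)^-1.
have sV : 0 < Num.sqrt V by rewrite sqrtr_gt0.
have l2 : l ^+ 2 * V = 1.
  by rewrite /l exprVn sqr_sqrtr ?ltW// mulVf ?gt_eqF.
have mexp a : measurable_fun setT (fun w => (expR (a * Y w))%:E).
  apply/measurable_EFinP; apply: measurableT_comp => //.
  exact: measurable_funM.
apply: (@le_trans _ _ (\int[P]_w (((2 * q)`!%:R * V ^+ q)%:E *
    ((expR (l * Y w))%:E + (expR (- l * Y w))%:E)))%E).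
  apply: ge0_le_integral => //.
  - by move=> w _; rewrite lee_fin exprM exprn_ge0// sqr_ge0.
  - by apply/measurable_EFinP; exact: measurable_funX.
  - by apply: measurable_funeM; exact: emeasurable_funD.
  move=> w _; rewrite -EFinD -EFinM lee_fin.
  have := @expR_ge_pow `|l * Y w| (2 * q) (normr_ge0 _).
  rewrite ler_pdivrMr ?ltr0n ?fact_gt0// => h.
  have hl : expR `|l * Y w| <= expR (l * Y w) + expR (- l * Y w).
    rewrite mulNr; have [_|_] := ger0P (l * Y w); rewrite ?lerDl ?lerDr expR_ge0//.
  have -> : Y w ^+ (2 * q) = V ^+ q * `|l * Y w| ^+ (2 * q).
    rewrite [in RHS]exprM real_normK ?num_real// -exprMn [(l * _) ^+ 2]exprMn mulrA [V * _]mulrC l2.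
    by rewrite mul1r exprM.
  rewrite -mulrA mulrCA ler_wpM2l ?exprn_ge0 ?(ltW V0)//.
  by apply: (le_trans h); rewrite mulrC ler_wpM2l.
rewrite ge0_integralZl ?lee_fin ?mulr_ge0 ?exprn_ge0 ?(ltW V0)//; last 2 first.
- exact: emeasurable_funD.
- by move=> w _; rewrite adde_ge0// lee_fin expR_ge0.
rewrite ge0_integralD//.
have h1 a : a ^+ 2 * V = 1 ->
    (\int[P]_w (expR (a * Y w))%:E <= (expR (1 / 2))%:E)%E.
  by move=> aV; have := hm a; rewrite aV.
apply: (@le_trans _ _ (((2 * q)`!%:R * V ^+ q)%:E *
   ((expR (1 / 2))%:E + (expR (1 / 2))%:E))%E).
  rewrite lee_wpmul2l ?lee_fin ?mulr_ge0 ?exprn_ge0 ?(ltW V0)//.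
  by apply: leeD; apply: h1 => //; rewrite sqrrN.
by rewrite -EFinD -EFinM lee_fin le_eqVlt; apply/orP; left; apply/eqP; ring.
Qed.

End MGFLimit.

(** * Increments of the Wiener process *)

Section WienerIncrements.
Context (R : realType) d (Om : measurableType d) (P : probability Om R).
Variables (F : R -> set (set Om)) (W : R -> Om -> 'cV[R]_2).
Hypotheses (hF : rc_filtration F) (hW : wiener P F W).

(** Measurability with respect to F s without changing the measurable structure of the
    sample space; [FmeasE] links it to the generated type. *)
Definition Fmeas s (Y : Om -> R) :=
  forall A : set R, measurable A -> F s (Y @^-1` A).

Lemma F_measurable s E : 0 <= s -> F s E -> measurable E.
Proof. by case: hF => h _ _ s0; case: (h _ s0) => _; exact. Qed.

Lemma F_gE s : 0 <= s -> <<s F s >> = F s.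
Proof. by case: hF => h _ _ s0; apply: sigma_algebra_id; exact: (h _ s0).1. Qed.

Lemma Fmeas_measurable s Y : 0 <= s -> Fmeas s Y -> measurable_fun setT Y.
Proof.
move=> s0 mY _ A mA; rewrite setTI; exact: F_measurable (mY A mA).
Qed.

Lemma FmeasE s Y : 0 <= s ->
  Fmeas s Y <-> measurable_fun (setT : set (g_sigma_algebraType (F s))) Y.
Proof.
move=> s0; split=> [mY _ A mA|mY A mA].
  by rewrite setTI /measurable /= F_gE//; exact: mY.
have := mY measurableT A mA.
by rewrite setTI /measurable /= F_gE.
Qed.

Lemma Fmeas_mono s t Y : 0 <= s -> s <= t -> Fmeas s Y -> Fmeas t Y.
Proof. by case: hF => _ h _ s0 st mY A mA; apply: (h _ _ s0 st); exact: mY. Qed.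

Lemma Fmeas_W t j : 0 <= t -> Fmeas t (fun o => W t o j ord0).
Proof. by case: hW => h _ _ _ t0 A mA; exact: h. Qed.

Let N t s : subprobability (measurableTypeR R) R :=
  normal_prob 0 (Num.sqrt (t - s)).
Local Notation mR2 := (measurableTypeR R * measurableTypeR R)%type.
Let N2 t s : subprobability mR2 R := product_subprobability (N t s, N t s).
Let V s t (o : Om) : mR2 := (W t o ord0 ord0 - W s o ord0 ord0,
                    W t o ord_max ord0 - W s o ord_max ord0).

Lemma measurable_V s t : 0 <= s -> s < t -> measurable_fun setT (V s t).
Proof.
move=> s0 st; have t0 := le_trans s0 (ltW st).
have mW r l : 0 <= r -> measurable_fun setT (fun o => W r o l ord0).
  by move=> r0; exact: (Fmeas_measurable r0 (@Fmeas_W r l r0)).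
by apply: measurable_fun_pair; apply: measurable_funB; exact: mW.
Qed.

(** A Wiener process comes with the product rule for rectangles only.  Given E of positive
    probability, the conditional law of the increment agrees on rectangles with a product
    of two normal laws, hence everywhere. *)
Lemma indep_incr s t E (D : set mR2) : 0 <= s -> s < t -> F s E ->
  measurable D ->
  P (E `&` V s t @^-1` D) = (P E * (N t s \x N t s) D)%E.
Proof.
move=> s0 st FE mD.
have mE := F_measurable s0 FE.
have mV := measurable_V s0 st.
have mVD D' : measurable D' -> measurable (V s t @^-1` D').
  by move=> mD'; rewrite -[X in measurable X]setTI; exact: mV.
(* conditioning on E requires positive probability *)
have [p0|p0] := eqVneq (P E) 0%E.
  rewrite p0 mul0e; apply/eqP; rewrite eq_le measure_ge0 andbT -p0.
  exact: (le_measure P (mem_set (measurableI _ _ mE (mVD _ mD))) (mem_set mE)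
    (@subIsetl _ _ _)).
have pf : P E \is a fin_num by exact: fin_num_measure.
have p1 : 0 < fine (P E) by apply: fine_gt0; rewrite lt0e p0 measure_ge0 ltey_eq pf.
have p1i : 0 <= (fine (P E))^-1 by rewrite invr_ge0 ltW.
pose m0 : {measure set mR2 -> \bar R} :=
  pushforward (mrestr P mE) (V s t).
pose m' : {measure set mR2 -> \bar R} := mscale (NngNum p1i) (m0 mV).
have -> : (N t s \x N t s)%E D = m' D.
  apply: product_measure_unique => // A B mA mB.
  rewrite /m' /= /mscale /m0 /= /pushforward /mrestr.
  have [_ _ _ hw] := hW.
  have := hw s t E (fun l => if l == ord0 then A else B) s0 st FE.
  have -> : V s t @^-1` (A `*` B) `&` E = E `&` [set w | forall l : 'I_2,
      (if l == ord0 then A else B) ((W t w - W s w) l ord0)].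
    apply/seteqP; split => o /=.
      move=> [[h0 h1] Eo]; split => // l; rewrite !mxE.
      case: ifP => [/eqP ->//|]; case: l => [[|[|//]]] //= p _.
      by rewrite (_ : Ordinal p = ord_max)//; apply/val_inj.
    move=> [Eo h]; split => //; split => /=.
      by have := h ord0; rewrite /= !mxE.
    by have := h ord_max; rewrite /= !mxE.
  move=> -> /=; last by move=> l; case: ifP.
  rewrite muleA (_ : (((fine (P E))^-1)%:E * P E = 1)%E) ?mul1e//.
  by rewrite -[X in (_ * X)%E](fineK pf) -EFinM mulVf ?gt_eqF.
rewrite /m' /= /mscale /m0 /= /pushforward /mrestr muleA.
by rewrite -{1}(fineK pf) -EFinM mulfV ?gt_eqF// mul1e setIC.
Qed.

(** The increment is independent of the past, so the exponential factorizes; both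
    components are treated at once because only their joint law is known to be independent
    of F s. *)
Lemma mgf_incr s t (Y : Om -> R) (c0 c1 : R) : 0 <= s -> s < t -> Fmeas s Y ->
  (\int[P]_o (expR (Y o + (c0 * (W t o ord0 ord0 - W s o ord0 ord0) +
       c1 * (W t o ord_max ord0 - W s o ord_max ord0))))%:E =
   (\int[P]_o (expR (Y o))%:E) * (expR ((c0 ^+ 2 + c1 ^+ 2) * (t - s) / 2))%:E)%E.
Proof.
move=> s0 st mY; have mV := measurable_V s0 st.
have mg : measurable_fun setT (fun z : mR2 => (expR (c0 * z.1 + c1 * z.2))%:E).
  apply/measurable_EFinP; apply: measurableT_comp => //.
  by apply: measurable_funD; apply: measurable_funM.
have mX c : measurable_fun setT (fun x : R => (expR (c * x))%:E).
  by apply/measurable_EFinP; apply: measurableT_comp => //; exact: measurable_funM.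
have ts0 : Num.sqrt (t - s) != 0 by rewrite gt_eqF// sqrtr_gt0 subr_gt0.
transitivity (\int[P]_o ((expR (Y o))%:E * (expR (c0 * (V s t o).1 + c1 * (V s t o).2))%:E))%E.
  by apply: eq_integral => o _; rewrite -EFinM -expRD.
rewrite (@ge0_integral_indep _ _ _ P _ _ _ _ Y (V s t) (N2 t s)
  (fun y => (expR y)%:E) (fun z : mR2 => (expR (c0 * z.1 + c1 * z.2))%:E)) //.
- congr (_ * _)%E.
  rewrite (@eq_measure_integral _ _ _ _
    (N t s \x N t s : {measure set mR2 -> \bar R})%E)//.
  rewrite fubini_tonelli1//.
  transitivity (\int[N t s]_x ((expR (c0 * x))%:E *
      (expR (c1 ^+ 2 * (t - s) / 2))%:E))%E.
    apply: eq_integral => x _; rewrite /fubini_F /=.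
    under eq_integral => y _ do rewrite expRD EFinM.
    rewrite ge0_integralZl ?lee_fin ?expR_ge0//; last exact: mX.
    by rewrite normal_mgf// sqr_sqrtr ?subr_ge0 ?(ltW st).
  rewrite ge0_integralZr ?lee_fin ?expR_ge0//; last exact: mX.
  rewrite normal_mgf// sqr_sqrtr ?subr_ge0 ?(ltW st)// -EFinM -expRD.
  by congr (expR _)%:E; lra.
- exact: Fmeas_measurable mY.
- by move=> A B mA mB; rewrite indep_incr//; exact: mY.
- by apply/measurable_EFinP.
Qed.

End WienerIncrements.

(** * Sums over a partition of an interval *)

Section PathSums.
Variable R : realType.
Implicit Types (c g : R -> R) (ts : seq R).

(** The weights are taken at right endpoints to suit the intervals ]a, b].  The sum serves
    both as a stochastic sum (g a Wiener path) and as an exact integral (g the identity). *)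
Fixpoint path_sum c g (t0 : R) ts : R :=
  if ts is t :: ts' then c t * (g t - g t0) + path_sum c g t ts' else 0.

Lemma path_sum_rcons c g t0 ts t :
  path_sum c g t0 (rcons ts t) = path_sum c g t0 ts + c t * (g t - g (last t0 ts)).
Proof.
by elim: ts t0 => [|u ts IH] t0 /=; rewrite ?addr0 ?add0r// IH addrA.
Qed.

Lemma eq_path_sum c c' g t0 ts : {in ts, c =1 c'} -> path_sum c g t0 ts = path_sum c' g t0 ts.
Proof.
elim: ts t0 => [//|u ts IH] t0 h /=; rewrite h ?mem_head// IH// => x xts.
by apply: h; rewrite inE xts orbT.
Qed.

Lemma path_sum_lin (I : Type) (r : seq I) (k : I -> R) (c : I -> R -> R) g t0 ts :
  path_sum (fun t => \sum_(i <- r) k i * c i t) g t0 ts =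
  \sum_(i <- r) k i * path_sum (c i) g t0 ts.
Proof.
elim: ts t0 => [|u ts IH] t0 /=; first by rewrite big1// => i _; rewrite mulr0.
rewrite IH mulr_suml -big_split /=; apply: eq_bigr => i _.
by rewrite [RHS]mulrDr mulrA.
Qed.

(** The sum telescopes between two partition points. *)
Lemma path_sum_indic g t0 ts a b : path <%R t0 ts -> a <= b ->
  a \in t0 :: ts -> b \in t0 :: ts ->
  path_sum (\1_(`]a, b])) g t0 ts = g b - g a.
Proof.
have itv_ind (x u v : R) : \1_(`]u, v]) x = ((u < x) && (x <= v))%:R :> R.
  rewrite indicE; congr (nat_of_bool _)%:R; apply/idP/idP.
    by move=> /set_mem /=; rewrite in_itv.
  by move=> h; apply/mem_set; rewrite /= in_itv.
have zero u v t1 us : path <%R t1 us -> v <= t1 -> path_sum (\1_(`]u, v])) g t1 us = 0.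
  elim: us t1 => [//|w us IH] t1 /= /andP[tw pw] vt.
  rewrite IH// ?(le_trans vt (ltW tw))// itv_ind [w <= v]leNgt (le_lt_trans vt tw).
  by rewrite andbF mul0r addr0.
have change u u' v t1 us : path <%R t1 us -> u <= t1 -> u' <= t1 ->
    path_sum (\1_(`]u, v])) g t1 us = path_sum (\1_(`]u', v])) g t1 us.
  move=> pt ut ut'; apply: eq_path_sum => x xus.
  have tx : t1 < x by move: pt; rewrite lt_path_sortedE => /andP[/allP/(_ _ xus)].
  by rewrite !itv_ind (le_lt_trans ut tx) (le_lt_trans ut' tx).
elim: ts t0 a => [|t ts IH] t0 a /=.
  by move=> _ _; rewrite !inE => /eqP-> /eqP->; rewrite subrr.
move=> /andP[t0t pt] ab; rewrite inE => /orP[/eqP at0|ats].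
  rewrite at0 inE => /orP[/eqP ->|bts].
    by rewrite zero ?(ltW t0t)// itv_ind leNgt t0t mul0r addr0 subrr.
  have tb : t <= b.
    move: bts; rewrite inE => /orP[/eqP->//|bts].
    by move: pt; rewrite lt_path_sortedE => /andP[/allP/(_ _ bts)/ltW].
  rewrite itv_ind t0t tb mul1r (change _ t) ?(ltW t0t)// IH ?mem_head//; lra.
have ta : t <= a.
  move: ats; rewrite inE => /orP[/eqP->//|bts].
  by move: pt; rewrite lt_path_sortedE => /andP[/allP/(_ _ bts)/ltW].
rewrite inE => /orP[/eqP bt0|bts].
  by move: (le_trans ta ab); rewrite bt0 leNgt t0t.
by rewrite IH// itv_ind ltNge ta mul0r add0r.
Qed.

(** A function that only changes just after partition points equals its right endpoint value
    on each half-open cell. *)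
Lemma integral_path_sum (f : R -> R) t0 ts : path <%R t0 ts ->
  measurable_fun setT f -> (forall s, 0 <= f s) ->
  (forall s u, t0 < s -> s <= u -> (forall x, x \in ts -> ~~ (s <= x < u)) ->
     f s = f u) ->
  (\int[@lebesgue_measure R]_(s in `]t0, last t0 ts]) (f s)%:E =
     (path_sum f idfun t0 ts)%:E)%E.
Proof.
move=> + mf f0; elim: ts t0 => [|t ts IH] t0 /=.
  by move=> _ _; rewrite set_itvoc0// integral_set0.
move=> /andP[t0t pt] hf.
have tl : t <= last t ts.
  elim: ts t pt {IH hf t0t} => [//|u us IH] t /= /andP[tu pu].
  exact: (le_trans (ltW tu) (IH _ pu)).
have -> : `]t0, last t ts]%classic = `]t0, t] `|` `]t, last t ts].
  apply/seteqP; split => x /=; rewrite !in_itv /=.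
    move=> /andP[h1 h2]; have [xt|tx] := leP x t; [left|right].
      by rewrite h1.
    by rewrite h2.
  case=> /andP[h1 h2]; first by rewrite h1 (le_trans h2).
  by rewrite h2 (lt_trans t0t).
rewrite ge0_integral_setU//.
- rewrite IH//; last first.
    move=> s u ts' su h; apply: hf => //; first exact: lt_trans t0t ts'.
    move=> x; rewrite inE => /orP[/eqP ->|]; last exact: h.
    by rewrite leNgt ts'.
  rewrite EFinD; congr (_ + _)%E.
  rewrite (_ : (\int[_]_(x in _) _)%E =
      \int[@lebesgue_measure R]_(x in `]t0, t]) (cst (f t)%:E x))%E.
    rewrite integral_cst//= lebesgue_measure_itv /= lte_fin t0t.
    by rewrite -EFinD -EFinM.
  apply: eq_integral => x /set_mem /=; rewrite in_itv /= => /andP[h1 h2].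
  congr (_%:E); apply: hf => // y; rewrite inE => /orP[/eqP ->|yts].
    by rewrite ltxx andbF.
  move: pt; rewrite lt_path_sortedE => /andP[/allP/(_ _ yts) ty _].
  by rewrite [y < t]ltNge (ltW ty) andbF.
- by apply/measurable_EFinP; exact: measurable_funTS.
- by move=> x _; rewrite lee_fin.
- apply/disj_setPS => x /= []; rewrite !in_itv /= => /andP[_ h1] /andP[h2 _].
  by move: h1; rewrite leNgt h2.
Qed.

End PathSums.

Definition wcomp (R : realType) (Om : Type) (W : R -> Om -> 'cV[R]_2) j s o :=
  W s o j ord0.

(** * Wiener integrals of deterministic functions *)

Section StepMGF.
Context (R : realType) d (Om : measurableType d) (P : probability Om R).
Variables (F : R -> set (set Om)) (W : R -> Om -> 'cV[R]_2).
Hypotheses (hF : rc_filtration F) (hW : wiener P F W).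

Local Notation w := (wcomp W).

(** Along an increasing partition the increments are added one at a time, each independent
    of the sigma-algebra for which the previous partial sum is measurable. *)
Lemma mgf_path_sum (c0 c1 : R -> R) t0 ts : 0 <= t0 -> path <%R t0 ts ->
  let Q o := path_sum c0 (fun s => w ord0 s o) t0 ts +
             path_sum c1 (fun s => w ord_max s o) t0 ts in
  Fmeas F (last t0 ts) Q /\
  (\int[P]_o (expR (Q o))%:E =
   (expR ((path_sum (fun s => c0 s ^+ 2) idfun t0 ts +
           path_sum (fun s => c1 s ^+ 2) idfun t0 ts) / 2))%:E)%E.
Proof.
move=> t00; elim/last_ind: ts => [_ /=|ts t IH].
  split; last first.
    rewrite !addr0 mul0r expR0.
    have := integral_cst P measurableT 1%E.
    by move=> ->; rewrite mul1e; exact: probability_setT.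
  by apply/(FmeasE hF _ t00); exact: measurable_cst.
rewrite rcons_path => /andP[pt lt].
have [mQ hQ] := IH pt.
have l0 : 0 <= last t0 ts.
  elim: ts t0 t00 pt {IH lt mQ hQ} => [//|u us IH] t0 t00 /= /andP[tu pu].
  by apply: IH => //; exact: le_trans t00 (ltW tu).
have l0t : 0 <= t := le_trans l0 (ltW lt).
move=> Q.
have QE : Q = fun o => (path_sum c0 (fun s => w ord0 s o) t0 ts +
             path_sum c1 (fun s => w ord_max s o) t0 ts) +
     (c0 t * (W t o ord0 ord0 - W (last t0 ts) o ord0 ord0) +
      c1 t * (W t o ord_max ord0 - W (last t0 ts) o ord_max ord0)).
  by apply/funext => o; rewrite /Q !path_sum_rcons /wcomp; lra.
rewrite last_rcons; split.
  rewrite QE; apply/(FmeasE hF _ l0t).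
  have mW s j : 0 <= s -> s <= t ->
      measurable_fun (setT : set (g_sigma_algebraType (F t))) (fun o => W s o j ord0).
    move=> s0 st; apply/(FmeasE hF _ l0t).
    exact: (Fmeas_mono hF s0 st (Fmeas_W hW j s0)).
  apply: measurable_funD.
    by apply/(FmeasE hF _ l0t); exact: (Fmeas_mono hF l0 (ltW lt) mQ).
  by apply: measurable_funD; apply: measurable_funM => //; apply: measurable_funB;
    apply: mW => //; exact: ltW.
rewrite QE (mgf_incr hF hW (c0 t) (c1 t) l0 lt mQ) hQ -EFinM -expRD !path_sum_rcons.
by congr (expR _)%:E; rewrite /=; lra.
Qed.

Definition valid_steps (T : R) (e : seq (R * R * R)) :=
  forall x, x \in e -> [/\ 0 <= x.1.2, x.1.2 <= x.2 & x.2 <= T].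

Lemma step_fun_measurable (e : seq (R * R * R)) : measurable_fun setT (step_fun e).
Proof.
by apply: measurable_sum => x; apply: measurable_funM.
Qed.

(** Two step functions are refined to a common partition, on which their stochastic
    integrals become the sums of [mgf_path_sum] and the integral of the squares becomes
    [integral_path_sum]. *)
Lemma mgf_step (e0 e1 : seq (R * R * R)) (T l V : R) :
  valid_steps T e0 -> valid_steps T e1 ->
  (\int[@lebesgue_measure R]_(s in `[0%R, T])
      (step_fun e0 s ^+ 2 + step_fun e1 s ^+ 2)%:E <= V%:E)%E ->
  (\int[P]_o (expR (l * (step_integral (w ord0) e0 o +
      step_integral (w ord_max) e1 o)))%:E <= (expR (l ^+ 2 * V / 2))%:E)%E.
Proof.
move=> v0 v1 hV.
(* all endpoints of both step functions *)
pose pts := [seq x.1.2 | x <- e0 ++ e1] ++ [seq x.2 | x <- e0 ++ e1].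
pose ts := sort <=%R (undup [seq x <- pts | 0 < x]).
have pts0 x : x \in pts -> 0 <= x /\ x <= T.
  rewrite mem_cat => /orP[] /mapP[y ye ->]; move: ye; rewrite mem_cat => /orP[].
  - by move=> /v0[? ? ?]; split; lra.
  - by move=> /v1[? ? ?]; split; lra.
  - by move=> /v0[? ? ?]; split; lra.
  - by move=> /v1[? ? ?]; split; lra.
have tsE x : (x \in ts) = (0 < x) && (x \in pts).
  by rewrite mem_sort mem_undup mem_filter.
have pT : path <%R 0 ts.
  rewrite lt_path_sortedE; apply/andP; split.
    by apply/allP => x; rewrite tsE => /andP[].
  by rewrite sort_lt_sorted undup_uniq.
have in0 x : x \in pts -> x \in 0 :: ts.
  move=> xp; rewrite inE tsE xp andbT; have [x0 _] := pts0 x xp.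
  by rewrite le_eqVlt in x0; rewrite eq_sym.
have ine (e : seq (R * R * R)) : {subset e <= e0 ++ e1} ->
   forall x, x \in e -> x.1.2 \in 0 :: ts /\ x.2 \in 0 :: ts.
  move=> sub x xe; split; apply: in0; rewrite mem_cat; apply/orP; [left|right].
    by apply/mapP; exists x => //; exact: sub.
  by apply/mapP; exists x => //; exact: sub.
have sub0 : {subset e0 <= e0 ++ e1} by move=> x; rewrite mem_cat => ->.
have sub1 : {subset e1 <= e0 ++ e1} by move=> x; rewrite mem_cat => ->; rewrite orbT.
have SI j (e : seq (R * R * R)) o : {subset e <= e0 ++ e1} -> valid_steps T e ->
    l * step_integral (w j) e o =
    path_sum (fun t => l * step_fun e t) (fun s => w j s o) 0 ts.
  move=> sub ve; rewrite /step_integral mulr_sumr.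
  rewrite (_ : (fun t => _) =
     fun t => \sum_(x <- e) (l * x.1.1) * \1_(`]x.1.2, x.2]) t); last first.
    by apply/funext => t; rewrite /step_fun mulr_sumr; apply: eq_bigr => x _; rewrite mulrA.
  rewrite path_sum_lin big_seq [RHS]big_seq; apply: eq_bigr => x xe.
  have [h1 h2] := ine e sub x xe; have [_ h3 _] := ve x xe.
  by rewrite path_sum_indic// mulrA.
under eq_integral => o _ do rewrite mulrDr SI// SI//.
have [_ ->] := mgf_path_sum (fun t => l * step_fun e0 t) (fun t => l * step_fun e1 t) (lexx 0) pT.
rewrite lee_fin ler_expR ler_pM2r ?invr_gt0//.
pose f s := step_fun e0 s ^+ 2 + step_fun e1 s ^+ 2.
have f0 s : 0 <= f s by rewrite addr_ge0 ?sqr_ge0.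
have mf : measurable_fun setT f.
  by apply: measurable_funD; apply: measurable_funX; exact: step_fun_measurable.
have -> : path_sum (fun s => (l * step_fun e0 s) ^+ 2) idfun 0 ts +
    path_sum (fun s => (l * step_fun e1 s) ^+ 2) idfun 0 ts = l ^+ 2 * path_sum f idfun 0 ts.
  elim: (ts) 0 => [|t us IH] t0 /=; first by rewrite mulr0 addr0.
  by rewrite [RHS]mulrDr -(IH t) /f; ring.
rewrite ler_wpM2l ?sqr_ge0// -lee_fin -integral_path_sum//.
- apply: le_trans hV; apply: ge0_subset_integral => //.
  + by apply/measurable_EFinP; exact: measurable_funTS.
  + by move=> s _; rewrite lee_fin.
  + move=> s /=; rewrite !in_itv /= => /andP[s0 sl]; rewrite (ltW s0) /=.
    apply: (le_trans sl); have : last 0 ts \in 0 :: ts by exact: mem_last.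
    rewrite inE => /orP[/eqP l0|]; last by rewrite tsE => /andP[_ /pts0[]].
    by move: (lt_le_trans s0 sl); rewrite l0 ltxx.
move=> s u s0 su h.
(* no endpoint lies in [s, u[, so no indicator changes between s and u *)
have itv_ind e : {subset e <= e0 ++ e1} -> step_fun e s = step_fun e u.
  move=> sub; rewrite /step_fun big_seq [RHS]big_seq; apply: eq_bigr => x xe.
  have [h1 h2] := ine e sub x xe; congr (_ * _).
  have no y : y \in 0 :: ts -> ~~ (s <= y < u).
    rewrite inE => /orP[/eqP->|]; last exact: h.
    by rewrite leNgt s0.
  have := no _ h1; have := no _ h2; rewrite !indicE => n2 n1.
  congr (nat_of_bool _)%:R; apply/idP/idP => /set_mem /=; rewrite in_itv /= => /andP[k1 k2];
    apply/mem_set; rewrite /= in_itv /=; apply/andP; split.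
  - exact: lt_le_trans k1 su.
  - by move: n2; rewrite negb_and -!leNgt -ltNge => /orP[|//]; rewrite ltNge k2.
  - by move: n1; rewrite negb_and -!leNgt -ltNge => /orP[//|]; rewrite leNgt k1.
  - exact: le_trans su k2.
by rewrite /f !itv_ind.
Qed.

(** The integral over [0, T] of f0 dW^1 + f1 dW^2 as one object: the approximation
    in L2 is imposed on the sum, since moments are needed for sums that mix both components. *)
Definition wiener_int (T : R) (f0 f1 : R -> R) (Y : Om -> R) : Prop :=
  [/\ measurable_fun setT Y, measurable_fun setT f0, measurable_fun setT f1 &
  exists e0 e1 : nat -> seq (R * R * R),
  [/\ forall n, valid_steps T (e0 n) /\ valid_steps T (e1 n),
      (\int[@lebesgue_measure R]_(s in `[0%R, T])
         ((step_fun (e0 n) s - f0 s) ^+ 2)%:E)%E @[n --> \oo] --> 0%E,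
      (\int[@lebesgue_measure R]_(s in `[0%R, T])
         ((step_fun (e1 n) s - f1 s) ^+ 2)%:E)%E @[n --> \oo] --> 0%E &
      (\int[P]_o ((step_integral (w ord0) (e0 n) o +
         step_integral (w ord_max) (e1 n) o - Y o) ^+ 2)%:E)%E
          @[n --> \oo] --> 0%E]].

(** Comparison of L2 norms under a pointwise inequality such as (x + y)^2 <= 2 x^2 + 2 y^2. *)
Lemma cvg0_le d' (X : measurableType d') (mu : {measure set X -> \bar R}) (D : set X)
    (g g1 g2 : nat -> X -> R) (a : R) :
  measurable D -> 0 <= a ->
  (forall n, measurable_fun D (g n)) ->
  (forall n, measurable_fun D (g1 n)) -> (forall n, measurable_fun D (g2 n)) ->
  (forall n x, D x -> g n x ^+ 2 <= a * (g1 n x ^+ 2 + g2 n x ^+ 2)) ->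
  (\int[mu]_(x in D) (g1 n x ^+ 2)%:E)%E @[n --> \oo] --> 0%E ->
  (\int[mu]_(x in D) (g2 n x ^+ 2)%:E)%E @[n --> \oo] --> 0%E ->
  (\int[mu]_(x in D) (g n x ^+ 2)%:E)%E @[n --> \oo] --> 0%E.
Proof.
move=> mD a0 mg mg1 mg2 hle c1 c2.
have m2 (h : X -> R) : measurable_fun D h -> measurable_fun D (fun x => (h x ^+ 2)%:E).
  by move=> mh; apply/measurable_EFinP; exact: measurable_funX.
have n0 (x : R) : (0 <= (x ^+ 2)%:E)%E by rewrite lee_fin sqr_ge0.
apply: (squeeze_cvge (f := fun=> 0%E) (h := fun n => (a%:E *
    (\int[mu]_(x in D) (g1 n x ^+ 2)%:E + \int[mu]_(x in D) (g2 n x ^+ 2)%:E))%E)).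
- apply: nearW => n; rewrite integral_ge0//=.
  apply: (@le_trans _ _ (\int[mu]_(x in D) (a%:E * ((g1 n x ^+ 2)%:E + (g2 n x ^+ 2)%:E)))%E).
    apply: ge0_le_integral => //; first exact: m2.
      by apply: measurable_funeM; apply: emeasurable_funD; exact: m2.
    by move=> x Dx; rewrite -EFinD -EFinM lee_fin; exact: hle.
  rewrite ge0_integralZl//; last 2 first.
  + by apply: emeasurable_funD; exact: m2.
  + by move=> x _; rewrite adde_ge0.
  by rewrite ge0_integralD//; exact: m2.
- exact: cvg_cst.
- rewrite -[X in _ --> X](mule0 a%:E) -[X in (_ * X)%E](adde0 0%E).
  by apply: cvgeZl => //; apply: cvgeD.
Qed.

Lemma w_measurable j s : 0 <= s -> measurable_fun setT (w j s).
Proof. by move=> s0; apply: (Fmeas_measurable hF s0); exact: (Fmeas_W hW j s0). Qed.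

Lemma step_integral_measurable T j e : valid_steps T e ->
  measurable_fun setT (step_integral (w j) e).
Proof.
move=> v; rewrite (_ : step_integral _ _ = fun o => \sum_(x <- e | x \in e)
    x.1.1 * (w j x.2 o - w j x.1.2 o)); last first.
  by apply/funext => o; rewrite /step_integral big_seq.
elim: {1}e => [|x r IH].
  by under eq_fun do rewrite big_nil; exact: measurable_cst.
under eq_fun do rewrite big_cons.
have [/v[h1 h2 h3]|_] := boolP (x \in e); last exact: IH.
apply: measurable_funD => //.
apply: measurable_funM => //; apply: measurable_funB; apply: w_measurable => //.
exact: le_trans h2.
Qed.

Lemma step_fun_cat e e' : step_fun (e ++ e') = (step_fun e \+ step_fun e' : R -> R).
Proof. by apply/funext => s; rewrite /step_fun big_cat. Qed.

Lemma step_integral_cat (v : R -> Om -> R) e e' o :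
  step_integral v (e ++ e') o = step_integral v e o + step_integral v e' o.
Proof. by rewrite /step_integral big_cat. Qed.

Definition step_scale (a : R) (e : seq (R * R * R)) :=
  [seq (a * x.1.1, x.1.2, x.2) | x <- e].

Lemma step_fun_scale a e s : step_fun (step_scale a e) s = a * step_fun e s.
Proof.
by rewrite /step_fun big_map mulr_sumr; apply: eq_bigr => x _; rewrite mulrA.
Qed.

Lemma step_integral_scale (v : R -> Om -> R) a e o :
  step_integral v (step_scale a e) o = a * step_integral v e o.
Proof.
by rewrite /step_integral big_map mulr_sumr; apply: eq_bigr => x _; rewrite mulrA.
Qed.

(** Concatenating the lists of steps adds the step functions and their integrals. *)
Lemma wiener_int_lin T f0 f1 g0 g1 Y Z (a : R) :
  wiener_int T f0 f1 Y -> wiener_int T g0 g1 Z ->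
  wiener_int T (fun s => f0 s + a * g0 s) (fun s => f1 s + a * g1 s)
    (fun o => Y o + a * Z o).
Proof.
move=> [mY mf0 mf1 [e0 [e1 [v c0 c1 c]]]] [mZ mg0 mg1 [e0' [e1' [v' c0' c1' c']]]].
split.
- by apply: measurable_funD => //; exact: measurable_funM.
- by apply: measurable_funD => //; exact: measurable_funM.
- by apply: measurable_funD => //; exact: measurable_funM.
exists (fun n => e0 n ++ step_scale a (e0' n)), (fun n => e1 n ++ step_scale a (e1' n)).
have ab (x y : R) : (x + a * y) ^+ 2 <= (2 + 2 * a ^+ 2) * (x ^+ 2 + y ^+ 2).
  have := sqr_ge0 (x - a * y); have := mulr_ge0 (sqr_ge0 a) (sqr_ge0 x).
  have := sqr_ge0 y; rewrite !expr2 => h1 h2 h3; nra.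
have a2 : 0 <= 2 + 2 * a ^+ 2 by rewrite addr_ge0// mulr_ge0// sqr_ge0.
have vs e : valid_steps T e -> valid_steps T (step_scale a e).
  by move=> ve x /mapP[y ye ->] /=; exact: ve.
have vc e e' : valid_steps T e -> valid_steps T e' -> valid_steps T (e ++ e').
  by move=> h h' x; rewrite mem_cat => /orP[/h|/h'].
have mstep e (g : R -> R) : measurable_fun setT g ->
    measurable_fun `[0%R, T]%classic (fun s => step_fun e s - g s).
  move=> mg; apply: measurable_funTS; apply: measurable_funB => //.
  exact: step_fun_measurable.
split.
- by move=> n; have [h1 h2] := v n; have [h3 h4] := v' n; split; apply: vc => //; exact: vs.
- apply: (@cvg0_le _ _ (@lebesgue_measure R) `[0%R, T]%classic
    (fun n s => step_fun (e0 n ++ step_scale a (e0' n)) s - (f0 s + a * g0 s))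
    (fun n s => step_fun (e0 n) s - f0 s)
    (fun n s => step_fun (e0' n) s - g0 s) (2 + 2 * a ^+ 2)) => // [n|n|n|n s _].
  + by apply: mstep; apply: measurable_funD => //; exact: measurable_funM.
  + exact: mstep.
  + exact: mstep.
  + rewrite step_fun_cat /= step_fun_scale; apply: le_trans (ab _ _).
    by rewrite le_eqVlt; apply/orP; left; apply/eqP; congr (_ ^+ 2); lra.
- apply: (@cvg0_le _ _ (@lebesgue_measure R) `[0%R, T]%classic
    (fun n s => step_fun (e1 n ++ step_scale a (e1' n)) s - (f1 s + a * g1 s))
    (fun n s => step_fun (e1 n) s - f1 s)
    (fun n s => step_fun (e1' n) s - g1 s) (2 + 2 * a ^+ 2)) => // [n|n|n|n s _].
  + by apply: mstep; apply: measurable_funD => //; exact: measurable_funM.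
  + exact: mstep.
  + exact: mstep.
  + rewrite step_fun_cat /= step_fun_scale; apply: le_trans (ab _ _).
    by rewrite le_eqVlt; apply/orP; left; apply/eqP; congr (_ ^+ 2); lra.
have mSI e e' : valid_steps T e -> valid_steps T e' ->
  measurable_fun setT (fun o => step_integral (w ord0) e o + step_integral (w ord_max) e' o).
  by move=> h h'; apply: measurable_funD; [exact: step_integral_measurable h
    |exact: step_integral_measurable h'].
apply: (@cvg0_le _ _ P setT
  (fun n o => step_integral (w ord0) (e0 n ++ step_scale a (e0' n)) o +
    step_integral (w ord_max) (e1 n ++ step_scale a (e1' n)) o - (Y o + a * Z o))
  (fun n o => step_integral (w ord0) (e0 n) o + step_integral (w ord_max) (e1 n) o - Y o)
  (fun n o => step_integral (w ord0) (e0' n) o + step_integral (w ord_max) (e1' n) o - Z o)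
  (2 + 2 * a ^+ 2)) => // [n|n|n|n o _].
- apply: measurable_funB; last by apply: measurable_funD => //; exact: measurable_funM.
  have [h1 h2] := v n; have [h3 h4] := v' n.
  by apply: mSI; apply: vc => //; exact: vs.
- by apply: measurable_funB => //; apply: mSI; [exact: (v n).1|exact: (v n).2].
- by apply: measurable_funB => //; apply: mSI; [exact: (v' n).1|exact: (v' n).2].
rewrite !step_integral_cat !step_integral_scale; apply: le_trans (ab _ _).
by rewrite le_eqVlt; apply/orP; left; apply/eqP; congr (_ ^+ 2); lra.
Qed.

Lemma wiener_int0 T : wiener_int T (fun=> 0) (fun=> 0) (fun=> 0).
Proof.
split => //; exists (fun=> [::]), (fun=> [::]).
have z d' (X : measurableType d') (mu : {measure set X -> \bar R}) D (f : X -> R) :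
    f = (fun=> 0) -> (\int[mu]_(s in D) ((f s) ^+ 2)%:E)%E = 0%E.
  by move=> ->; under eq_integral do rewrite expr0n; rewrite integral0.
split => //.
- apply: cvg_near_cst; apply: nearW => n; apply: z.
  by apply/funext => s; rewrite /step_fun big_nil subr0.
- apply: cvg_near_cst; apply: nearW => n; apply: z.
  by apply/funext => s; rewrite /step_fun big_nil subr0.
- apply: cvg_near_cst; apply: nearW => n; apply: z.
  by apply/funext => s; rewrite /step_integral !big_nil addr0 subr0.
Qed.

(** The exact exponent is l^2 V / 2.  The factor 2 comes from bounding the norm of an
    approximating step function by (a + b)^2 <= 2 a^2 + 2 b^2, which is shorter than
    proving convergence of the norms and harmless for moment bounds. *)
Lemma mgf_wiener_int T f0 f1 Y (l V : R) :
  wiener_int T f0 f1 Y ->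
  (\int[@lebesgue_measure R]_(s in `[0%R, T])
      (f0 s ^+ 2 + f1 s ^+ 2)%:E <= V%:E)%E ->
  (\int[P]_o (expR (l * Y o))%:E <= (expR (l ^+ 2 * (2 * V) / 2))%:E)%E.
Proof.
move=> [mY mf0 mf1 [e0 [e1 [v c0 c1 c]]]] hV.
pose two : R := 2.
set leb := @lebesgue_measure R.
pose A0 n := (\int[leb]_(s in `[0%R, T]) ((step_fun (e0 n) s - f0 s) ^+ 2)%:E)%E.
pose A1 n := (\int[leb]_(s in `[0%R, T]) ((step_fun (e1 n) s - f1 s) ^+ 2)%:E)%E.
have [fA0 cA0] : (\forall n \near \oo, A0 n \is a fin_num) /\ fine (A0 n) @[n --> \oo] --> 0.
  by have /fine_cvgP := c0.
have [fA1 cA1] : (\forall n \near \oo, A1 n \is a fin_num) /\ fine (A1 n) @[n --> \oo] --> 0.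
  by have /fine_cvgP := c1.
(* the squared L2 distances are finite from the index N on *)
have [N _ hN] := filterI fA0 fA1.
pose en n := expR (l ^+ 2 * (2 * V + 2 * (fine (A0 n) + fine (A1 n))) / 2).
have sh (u : nat -> R) a : u n @[n --> \oo] --> a -> u (n + N)%N @[n --> \oo] --> a.
  by move=> h; apply: (cvg_comp _ _ (cvg_addnr N) h).
apply: (@mgf_limit _ _ _ _ (fun n o => step_integral (w ord0) (e0 (n + N)%N) o +
   step_integral (w ord_max) (e1 (n + N)%N) o) _ (fun n => en (n + N)%N)) => //.
- move=> n; have [h1 h2] := v (n + N)%N; apply: measurable_funD;
  [exact: step_integral_measurable h1|exact: step_integral_measurable h2].
- exact: (cvg_comp _ _ (cvg_addnr N) c).
- move=> n; have [h1 h2] := v (n + N)%N.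
  have [/= f0n f1n] := hN (n + N)%N (leq_addl _ _).
  apply: (@mgf_step _ _ T l (2 * V + 2 * (fine (A0 (n + N)%N) + fine (A1 (n + N)%N))) h1 h2).
  have m2 (g : R -> R) : measurable_fun setT g ->
      measurable_fun `[0%R, T]%classic (fun x => (g x ^+ 2)%:E).
    by move=> mg; apply/measurable_EFinP; apply: measurable_funTS; exact: measurable_funX.
  have n0 (x : R) : (0 <= (x ^+ 2)%:E)%E by rewrite lee_fin sqr_ge0.
  have mB e (g : R -> R) : measurable_fun setT g ->
      measurable_fun setT (fun s => step_fun e s - g s).
    by move=> mg; apply: measurable_funB => //; exact: step_fun_measurable.
  apply: (@le_trans _ _ (\int[leb]_(s in `[0%R, T]) (two%:E * (f0 s ^+ 2 + f1 s ^+ 2)%:E +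
     two%:E * (((step_fun (e0 (n + N)%N) s - f0 s) ^+ 2)%:E +
      ((step_fun (e1 (n + N)%N) s - f1 s) ^+ 2)%:E)))%E).
    apply: ge0_le_integral => //.
    - by move=> s _; rewrite lee_fin addr_ge0// sqr_ge0.
    - by apply/measurable_EFinP; apply: measurable_funTS; apply: measurable_funD;
        apply: measurable_funX; exact: step_fun_measurable.
    - apply: emeasurable_funD; apply: measurable_funeM.
        by apply/measurable_EFinP; apply: measurable_funTS; apply: measurable_funD;
          apply: measurable_funX.
      by apply: emeasurable_funD; apply: m2; exact: mB.
    move=> s _; rewrite -!EFinD lee_fin.
    set x0 := step_fun _ s; set x1 := step_fun _ s.
    have := sqr_ge0 (x0 - 2 * f0 s); have := sqr_ge0 (x1 - 2 * f1 s).
    by rewrite /two !expr2 => k1 k2; nra.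
  rewrite ge0_integralD//; last 4 first.
  - by move=> s _; rewrite mule_ge0 ?lee_fin// addr_ge0// sqr_ge0.
  - apply: measurable_funeM; apply/measurable_EFinP; apply: measurable_funTS.
    by apply: measurable_funD; apply: measurable_funX.
  - by move=> s _; apply: mule_ge0; [rewrite lee_fin|exact: adde_ge0].
  - by apply: measurable_funeM; apply: emeasurable_funD; apply: m2; exact: mB.
  rewrite ge0_integralZl; last 4 first.
  - by [].
  - by apply/measurable_EFinP; apply: measurable_funTS; apply: measurable_funD;
        apply: measurable_funX.
  - by move=> s _; rewrite lee_fin addr_ge0// sqr_ge0.
  - by rewrite lee_fin.
  rewrite ge0_integralZl; last 4 first.
  - by [].
  - by apply: emeasurable_funD; apply: m2; exact: mB.
  - by move=> s _; exact: adde_ge0.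
  - by rewrite lee_fin.
  rewrite ge0_integralD//; last 2 first.
  - by apply: m2; exact: mB.
  - by apply: m2; exact: mB.
  rewrite -/(A0 _) -/(A1 _).
  have -> : (2 * V + 2 * (fine (A0 (n + N)%N) + fine (A1 (n + N)%N)))%:E =
      (two%:E * V%:E + two%:E * (A0 (n + N)%N + A1 (n + N)%N))%E.
    by rewrite -[in RHS](fineK f0n) -[in RHS](fineK f1n).
  by apply: leeD; apply: lee_wpmul2l => //; rewrite lee_fin.
- apply: sh; rewrite (_ : expR (l ^+ 2 * (2 * V) / 2) =
    expR (l ^+ 2 * (2 * V + 2 * (0 + 0)) / 2)); last by rewrite addr0 mulr0 addr0.
  have h : l ^+ 2 * (2 * V + 2 * (fine (A0 n) + fine (A1 n))) / 2 @[n --> \oo] -->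
     l ^+ 2 * (2 * V + 2 * (0 + 0)) / 2.
    apply: cvgM; last exact: cvg_cst.
    apply: cvgM; first exact: cvg_cst.
    apply: cvgD; first exact: cvg_cst.
    apply: cvgM; first exact: cvg_cst.
    exact: cvgD.
  exact: (cvg_comp _ _ h (@continuous_expR R _)).
Qed.

(** An integral up to time t is the integral up to T of the function cut off at t, since the
    approximating steps stay in [0, t].  This brings integrals up to different times under
    one horizon, where they can be combined linearly. *)
Lemma wiener_int_restrict (t T : R) (g0 g1 : R -> R) Y0 Y1 : t <= T ->
  measurable_fun `[0%R, t]%classic g0 -> measurable_fun `[0%R, t]%classic g1 ->
  is_wiener_integral P (w ord0) g0 t Y0 -> is_wiener_integral P (w ord_max) g1 t Y1 ->
  wiener_int T (fun s => \1_(`[0%R, t]) s * g0 s) (fun s => \1_(`[0%R, t]) s * g1 s)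
    (fun o => Y0 o + Y1 o).
Proof.
move=> tT mg0 mg1 [mY0 [e0 [v0 c0 C0]]] [mY1 [e1 [v1 c1 C1]]].
have mg (g : R -> R) : measurable_fun `[0%R, t]%classic g ->
    measurable_fun setT (fun s : R => \1_(`[0%R, t]) s * g s).
  move=> mg; have := (measurable_restrictT g (measurable_itv `[0%R, t])).1 mg; congr (measurable_fun _ _); apply/funext => s.
  rewrite patchE indicE; case: ifP => _; by rewrite ?mul1r ?mul0r.
split; [exact: measurable_funD|exact: mg|exact: mg|].
exists e0, e1.
have vT (e : seq (R * R * R)) : (forall x, x \in e -> [/\ 0 <= x.1.2, x.1.2 <= x.2 & x.2 <= t]) ->
    valid_steps T e.
  by move=> h x /h[? ? ?]; split => //; exact: le_trans tT.
have ext (e : seq (R * R * R)) (g : R -> R) : (forall x, x \in e -> [/\ 0 <= x.1.2, x.1.2 <= x.2 & x.2 <= t]) ->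
   measurable_fun `[0%R, t]%classic g ->
   (\int[@lebesgue_measure R]_(s in `[0%R, T]) ((step_fun e s - \1_(`[0%R, t]) s * g s) ^+ 2)%:E =
   \int[@lebesgue_measure R]_(s in `[0%R, t]) ((step_fun e s - g s) ^+ 2)%:E)%E.
  move=> ve mgt.
  rewrite integral_mkcond [RHS]integral_mkcond; apply: eq_integral => s _.
  rewrite !patchE; have [st|st] := boolP (s \in `[0%R, t]%classic).
    rewrite indicE st mul1r ifT//; move: st; rewrite !inE /= !in_itv /= => /andP[-> st].
    exact: le_trans tT.
  case: ifPn => // sT; rewrite indicE (negbTE st) mul0r subr0.
  rewrite /step_fun big_seq big1 ?expr0n// => x /ve[h1 h2 h3].
  rewrite indicE memNset ?mulr0//= in_itv /= => /andP[k1 k2].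
  move/negP : st; apply; rewrite inE /= in_itv /=.
  by rewrite (le_trans h1 (ltW k1)) (le_trans k2 h3).
split.
- by move=> n; split; apply: vT; [exact: v0|exact: v1].
- by under eq_fun => n do rewrite (ext _ _ (v0 n) mg0).
- by under eq_fun => n do rewrite (ext _ _ (v1 n) mg1).
apply: (@cvg0_le _ _ P setT
  (fun n o => step_integral (w ord0) (e0 n) o + step_integral (w ord_max) (e1 n) o - (Y0 o + Y1 o))
  (fun n o => step_integral (w ord0) (e0 n) o - Y0 o)
  (fun n o => step_integral (w ord_max) (e1 n) o - Y1 o) 2) => // [n|n|n|n o _].
- apply: measurable_funB; last exact: measurable_funD.
  by apply: measurable_funD; [exact: step_integral_measurable (v0 n)
    |exact: step_integral_measurable (v1 n)].
- by apply: measurable_funB => //; exact: step_integral_measurable (v0 n).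
- by apply: measurable_funB => //; exact: step_integral_measurable (v1 n).
set x := step_integral _ _ _; set y := step_integral _ _ _.
by have := sqr_ge0 ((x - Y0 o) - (y - Y1 o)); rewrite !expr2; nra.
Qed.

End StepMGF.

(** * Limits along sequences *)

Section SequentialTools.
Variable R : realType.

(** Row vectors form a metric space, so limits may be tested on sequences; this gives
    access to dominated convergence. *)
Lemma seq_within_cvg m (A : set 'rV[R]_m) (f : 'rV[R]_m -> R) (x : 'rV[R]_m) :
  A x ->
  (forall u : nat -> 'rV[R]_m, (forall k, A (u k)) -> u k @[k --> \oo] --> x ->
     f (u k) @[k --> \oo] --> f x) ->
  f y @[y --> within A (nbhs x)] --> f x.
Proof.
move=> Ax hf; apply/cvgrPdist_lt => e e0; apply: contrapT => nh.
(* a sequence tending to x along which f stays at distance e from f x *)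
have ex (k : nat) : exists y, [/\ A y, ball x (k.+1%:R^-1) y & e <= `|f x - f y|].
  apply: contrapT => nex; apply: nh; rewrite near_withinE.
  have : nbhs x (ball x (k.+1%:R^-1 : R)).
    by apply: nbhsx_ballx; rewrite invr_gt0.
  apply: filterS => y xy Ay; rewrite ltNge; apply/negP => le.
  by apply: nex; exists y.
have [u hu] := choice ex.
have ux : u k @[k --> \oo] --> x.
  apply/cvg_ballP => r r0; have := near_infty_natSinv_lt (PosNum r0).
  by apply: filterS => k /= kr; have [_ bk _] := hu k; exact: (le_ball (ltW kr) bk).
have := hf u (fun k => let: And3 a _ _ := hu k in a) ux.
move=> /cvgrPdist_lt/(_ _ e0)[N _ hN].
by have [_ _] := hu N; rewrite leNgt hN//=.
Qed.

Lemma within_cvg_seq m (A : set 'rV[R]_m) (f : 'rV[R]_m -> R) (x : 'rV[R]_m)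
    (u : nat -> 'rV[R]_m) :
  A x -> {within A, continuous f} -> (forall k, A (u k)) ->
  u k @[k --> \oo] --> x -> f (u k) @[k --> \oo] --> f x.
Proof.
move=> Ax /subspace_continuousP/(_ _ Ax) cf Au ux.
apply: (cvg_comp _ _ _ cf) => B /ux; rewrite /nbhs /=.
by apply: filterS => k; exact.
Qed.

Lemma closure_seq m (A : set 'rV[R]_m) (x : 'rV[R]_m) :
  closure A x -> exists u : nat -> 'rV[R]_m,
    (forall k, A (u k)) /\ u k @[k --> \oo] --> x.
Proof.
move=> cx.
have ex (k : nat) : exists y, A y /\ ball x (k.+1%:R^-1) y.
  have /cx[y [Ay xy]] : nbhs x (ball x (k.+1%:R^-1 : R)).
    by apply: nbhsx_ballx; rewrite invr_gt0.
  by exists y.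
have [u hu] := choice ex.
exists u; split => [k|]; first exact: (hu k).1.
apply/cvg_ballP => r r0; have := near_infty_natSinv_lt (PosNum r0).
by apply: filterS => k /= kr; have [_ bk] := hu k; exact: (le_ball (ltW kr) bk).
Qed.

End SequentialTools.

(** * Directional derivatives *)

Section Derivatives.
Variable R : realType.

(** A directional derivative is the derivative of a function of one real variable; this
    makes the one-dimensional theorem on differentiation under the integral available. *)
Lemma line_quotient m (f : 'rV[R]_m -> R) (x v : 'rV[R]_m) (a : R) :
  (fun h : R => h^-1 *: (((fun s : R => f (s *: v + x)) \o shift a) (h *: (1 : R))
       - f (a *: v + x))) =
  (fun h : R => h^-1 *: ((f \o shift (a *: v + x)) (h *: v) - f (a *: v + x))).
Proof.
apply/funext => h /=; congr (_ *: (f _ - _)).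
by rewrite [h *: 1]mulr1 scalerDl addrA.
Qed.

Lemma derivable_line m (f : 'rV[R]_m -> R) (x v : 'rV[R]_m) (a : R) :
  derivable (fun s : R => f (s *: v + x)) a 1 <-> derivable f (a *: v + x) v.
Proof. by rewrite /derivable line_quotient. Qed.

Lemma derive_line m (f : 'rV[R]_m -> R) (x v : 'rV[R]_m) (a : R) :
  'D_1 (fun s : R => f (s *: v + x)) a = 'D_v f (a *: v + x).
Proof. by rewrite /derive line_quotient. Qed.

Lemma derivable_of_cvg m (f : 'rV[R]_m -> R) (x v : 'rV[R]_m) (l : R) :
  h^-1 * (f (h *: v + x) - f x) @[h --> 0^'] --> l ->
  derivable f x v /\ 'D_v f x = l.
Proof. by move=> h; split; [apply/cvg_ex; exists l|exact: cvg_lim]. Qed.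

Lemma cvg_of_derivable m (f : 'rV[R]_m -> R) (x v : 'rV[R]_m) :
  derivable f x v -> h^-1 * (f (h *: v + x) - f x) @[h --> 0^'] --> 'D_v f x.
Proof. by []. Qed.

Lemma line_nbhs m (U : set 'rV[R]_m) (x v : 'rV[R]_m) : open U -> U x ->
  exists2 r : R, 0 < r & forall h : R, `|h| < r -> U (h *: v + x).
Proof.
move=> oU Ux.
have c : h *: v + x @[h --> (0:R)] --> x.
  rewrite -[X in _ --> X]add0r -(scale0r v).
  by apply: cvgD; [apply: cvgZr_tmp; exact: cvg_id|exact: cvg_cst].
have /c : nbhs x U by move: oU; rewrite openE; exact.
move=> /nbhs_ballP[r /= r0 hr]; exists r => // h hr'; apply: hr => /=.
by rewrite /ball /= sub0r normrN.
Qed.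

End Derivatives.

(** * Integrals depending on a parameter *)

Section ParamFamilies.
Variables (R : realType) (m : nat).
Implicit Types (A U : set 'rV[R]_m) (f g : R -> 'rV[R]_m -> R).
Local Notation leb := (@lebesgue_measure R).

(** A time-dependent function of the parameter, with a bound that is uniform in time:
    exactly what dominated convergence over a bounded time set requires. *)
Definition bounded_family A (K : R) f :=
  [/\ forall x, A x -> measurable_fun `[(0:R), +oo[%classic (fun t => f t x),
      forall t, 0 <= t -> {within A, continuous (f t)} &
      forall t x, 0 <= t -> A x -> `|f t x| <= K].

Lemma within_cvgD A (f g : 'rV[R]_m -> R) : {within A, continuous f} ->
  {within A, continuous g} -> {within A, continuous (fun x => f x + g x)}.
Proof. by move=> cf cg x; apply: cvgD; [exact: cf|exact: cg]. Qed.

Lemma within_cvgM A (f g : 'rV[R]_m -> R) : {within A, continuous f} ->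
  {within A, continuous g} -> {within A, continuous (fun x => f x * g x)}.
Proof. by move=> cf cg x; apply: cvgM; [exact: cf|exact: cg]. Qed.

Lemma bounded_familyD A K K' f g : bounded_family A K f -> bounded_family A K' g ->
  bounded_family A (K + K') (fun t x => f t x + g t x).
Proof.
move=> [mf cf bf] [mg cg bg]; split.
- by move=> x Ax; apply: measurable_funD; [exact: mf|exact: mg].
- by move=> t t0; apply: within_cvgD; [exact: cf|exact: cg].
- by move=> t x t0 Ax; apply: (le_trans (ler_normD _ _)); apply: lerD; [exact: bf|exact: bg].
Qed.

Lemma bounded_familyM A K K' f g : bounded_family A K f -> bounded_family A K' g ->
  bounded_family A (K * K') (fun t x => f t x * g t x).
Proof.
move=> [mf cf bf] [mg cg bg]; split.
- by move=> x Ax; apply: measurable_funM; [exact: mf|exact: mg].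
- by move=> t t0; apply: within_cvgM; [exact: cf|exact: cg].
- by move=> t x t0 Ax; rewrite normrM ler_pM//; [exact: bf|exact: bg].
Qed.

Lemma bounded_family_cst A K (g : R -> R) : measurable_fun `[(0:R), +oo[%classic g ->
  (forall t, 0 <= t -> `|g t| <= K) -> bounded_family A K (fun t _ => g t).
Proof.
move=> mg bg; split => [x _ //|t t0 x|t x t0 _]; last exact: bg.
exact: cvg_cst.
Qed.

Lemma bounded_family_le A K K' f : K <= K' -> bounded_family A K f -> bounded_family A K' f.
Proof.
move=> KK [h1 h2 h3]; split => // t x t0 Ax; exact: le_trans (h3 _ _ t0 Ax) KK.
Qed.

Lemma bounded_family_sub A B K f : B `<=` A -> bounded_family A K f -> bounded_family B K f.
Proof.
move=> BA [h1 h2 h3]; split => [x /BA|t t0|t x t0 /BA]; [exact: h1| |exact: h3].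
exact: continuous_subspaceW BA (h2 _ t0).
Qed.

Lemma eq_bounded_family A K f g : (forall t x, 0 <= t -> A x -> f t x = g t x) ->
  bounded_family A K f -> bounded_family A K g.
Proof.
move=> fg [h1 h2 h3]; split.
- move=> x Ax; apply: (eq_measurable_fun (fun t => f t x)) (h1 x Ax) => t.
  by rewrite inE /= in_itv /= andbT => t0; exact: fg.
- move=> t t0; apply: (subspace_eq_continuous _ (h2 t t0)).
  by move=> x /set_mem Ax; rewrite /from_subspace; exact: fg.
- by move=> t x t0 Ax; rewrite -fg//; exact: h3.
Qed.

Lemma sub_itv0 (D : set R) (T : R) : D `<=` `[(0:R), T]%classic ->
  D `<=` `[(0:R), +oo[%classic.
Proof. by move=> h t /h /=; rewrite !in_itv /= => /andP[-> _]. Qed.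

Lemma leb_fin (D : set R) (T : R) : measurable D -> D `<=` `[(0:R), T]%classic ->
  (leb D < +oo)%E.
Proof.
move=> mD sub; apply: (@le_lt_trans _ _ (leb `[(0:R), T]%classic)).
  by apply: le_measure; rewrite ?inE//=.
by rewrite lebesgue_measure_itv /=; case: ifP => _; rewrite ltry.
Qed.

Lemma bounded_integrable (D : set R) (T K : R) (f : R -> R) :
  measurable D -> D `<=` `[(0:R), T]%classic -> measurable_fun D f ->
  (forall t, D t -> `|f t| <= K) -> leb.-integrable D (EFin \o f).
Proof.
move=> mD sub mf bf; apply: measurable_bounded_integrable => //.
  exact: (leb_fin mD sub).
exists K; split; first exact: num_real.
by move=> x Kx t Dt /=; apply: (le_trans (bf t Dt)); exact: ltW.
Qed.

Lemma bounded_family_integrable A K f (D : set R) (T : R) x : bounded_family A K f -> A x ->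
  measurable D -> D `<=` `[(0:R), T]%classic ->
  leb.-integrable D (EFin \o (fun t => f t x)).
Proof.
move=> [mf _ bf] Ax mD sub; apply: (@bounded_integrable _ T K) => //.
  exact: (measurable_funS _ (sub_itv0 sub) (mf x Ax)).
by move=> t /sub /=; rewrite in_itv /= => /andP[t0 _]; exact: bf.
Qed.

(** Dominated convergence with the integration set and the parameter varying together, as
    happens when the observation times and the parameter both move. *)
Lemma param_int_cvg A K f (D : set R) (Dk : nat -> set R) (T : R) x
    (u : nat -> 'rV[R]_m) :
  bounded_family A K f -> A x -> (forall k, A (u k)) -> u k @[k --> \oo] --> x ->
  measurable D -> D `<=` `[(0:R), T]%classic ->
  (forall k, measurable (Dk k)) -> (forall k, Dk k `<=` `[(0:R), T]%classic) ->
  (forall t, \1_(Dk k) t @[k --> \oo] --> (\1_D t : R)) ->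
  \int[leb]_(t in Dk k) f t (u k) @[k --> \oo] --> \int[leb]_(t in D) f t x.
Proof.
move=> bf Ax Au ux mD sub mDk subk Dcvg.
have [mf cf bK] := bf.
have intE (E : set R) y : A y -> measurable E -> E `<=` `[(0:R), T]%classic ->
    \int[leb]_(t in E) f t y = fine (\int[leb]_(t in `[0%R, T]) (\1_E t * f t y)%:E)%E.
  move=> Ay mE subE; rewrite /Rintegral integral_mkcond [in RHS]integral_mkcond.
  congr fine; apply: eq_integral => t _; rewrite !patchE indicE.
  have [tE|tE] := boolP (t \in E); last by case: ifP => //; rewrite mul0r.
  by rewrite mem_set ?mul1r//; apply: subE; exact: set_mem.
rewrite intE//; under eq_fun => k do rewrite intE//.
have m0T (E : set R) y : A y -> measurable E ->
    measurable_fun `[(0:R), T]%classic (fun t => (\1_E t * f t y)%:E).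
  move=> Ay mE; apply/measurable_EFinP; apply: measurable_funM.
    by apply: measurable_funTS; exact: measurable_indic.
  exact: (measurable_funS _ (@sub_itv0 _ T (fun _ h => h)) (mf y Ay)).
have := @dominated_convergence _ _ _ leb `[(0:R), T]%classic (measurable_itv _)
  (fun k t => (\1_(Dk k) t * f t (u k))%:E) (fun t => (\1_D t * f t x)%:E)
  (cst K%:E).
case => //.
- by move=> k; exact: m0T.
- exact: m0T.
- apply: aeW => t /=; rewrite in_itv /= => /andP[t0 _]; apply: cvg_fin.
  apply: cvgM; first exact: Dcvg.
  exact: (within_cvg_seq Ax (cf t t0)).
- apply: (@bounded_integrable _ T `|K|) => //.
- apply: aeW => t k /=; rewrite in_itv /= => /andP[t0 _]; rewrite lee_fin normrM.
  rewrite indicE; case: (_ \in _); rewrite ?normr1 ?mul1r ?normr0 ?mul0r; last first.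
    exact: le_trans (bK t x t0 Ax).
  exact: bK.
move=> di _ dc; apply: fine_cvg; rewrite fineK//.
exact: (integrable_fin_num _ di).
Qed.

Lemma param_int_continuous A K f (D : set R) (T : R) : bounded_family A K f ->
  measurable D -> D `<=` `[(0:R), T]%classic ->
  {within A, continuous (fun x => \int[leb]_(t in D) f t x)}.
Proof.
move=> bf mD sub; apply/subspace_continuousP => x Ax; apply: seq_within_cvg => // u Au ux.
by apply: (param_int_cvg bf Ax Au ux mD sub) => // t; exact: cvg_cst.
Qed.

Lemma param_int_le A K f (D : set R) (T : R) x : bounded_family A K f -> A x ->
  measurable D -> D `<=` `[(0:R), T]%classic ->
  `|\int[leb]_(t in D) f t x| <= K * fine (leb D).
Proof.
move=> bf Ax mD sub; have [mf cf bK] := bf.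
have fi := bounded_family_integrable bf Ax mD sub.
have h := @le_normr_Rintegral _ _ _ leb D (fun t => f t x) mD fi.
apply: (le_trans h).
rewrite -Rintegral_cst//; apply: le_Rintegral => //.
- exact: integrable_norm.
- by apply: (@bounded_integrable _ T `|K|).
- by move=> t /sub /=; rewrite in_itv /= => /andP[t0 _]; exact: bK.
Qed.

(** Values are controlled up to the boundary of U because the estimators live in the
    closure, whereas derivatives are only used inside U. *)
Definition C1_family U K f := bounded_family (closure U) K f /\
  forall j, (forall t x, 0 <= t -> U x -> derivable (f t) x (delta_mx ord0 j)) /\
    bounded_family U K (fun t x => pd (f t) [:: j] x).

(** Differentiation under the integral along the line through x in direction j, the
    derivatives being dominated by the constant K. *)
Lemma param_int_deriv U K f (D : set R) (T : R) j x : open U -> C1_family U K f ->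
  measurable D -> D `<=` `[(0:R), T]%classic -> U x ->
  derivable (fun y => \int[leb]_(t in D) f t y) x (delta_mx ord0 j) /\
  'D_(delta_mx ord0 j) (fun y => \int[leb]_(t in D) f t y) x =
    \int[leb]_(t in D) pd (f t) [:: j] x.
Proof.
move=> oU [bf cf] mD sub Ux; have [df bd] := cf j.
set v := delta_mx ord0 j.
have [r r0 hr] := line_nbhs v oU Ux.
(* the restriction to the line through x *)
pose F (s : R) (t : R) := f t (s *: v + x).
have D0 t : D t -> 0 <= t by move=> /sub /=; rewrite in_itv /= => /andP[].
have Us s : `]- r, r[%classic s -> U (s *: v + x).
  by rewrite /= in_itv /= => h; apply: hr; rewrite ltr_norml.
have d1E s t : D t -> `]- r, r[%classic s ->
    partial1of2 F s t = pd (f t) [:: j] (s *: v + x).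
  by move=> Dt rs; rewrite /partial1of2 derive1E derive_line.
have r00 : `]- r, r[%classic 0 by rewrite /= in_itv /= oppr_lt0 r0.
have Fi s : `]- r, r[%classic s -> leb.-integrable D (EFin \o F s).
  by move=> rs; apply: (bounded_family_integrable bf _ mD sub); apply: subset_closure; exact: Us.
have Fd s t : `]- r, r[%classic s -> D t -> derivable (F ^~ t) s 1.
  by move=> rs Dt; apply/derivable_line; apply: df; [exact: D0|exact: Us].
have [_ _ bK] := bd.
have K0 : 0 <= K by exact: le_trans (bK 0 x (lexx 0) Ux).
have iK : leb.-integrable D (EFin \o cst K) by apply: (@bounded_integrable _ T `|K|).
have Fb s t : `]- r, r[%classic s -> D t -> `|partial1of2 F s t| <= cst K t.
  by move=> rs Dt; rewrite d1E//; apply: bK; [exact: D0|exact: Us].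
have := @cvg_differentiation_under_integral R _ _ leb F D mD 0 (- r) r r00 Fi Fd
  (cst K) (fun=> K0) iK Fb.
have -> : \int[leb]_(y in D) partial1of2 F 0 y = \int[leb]_(t in D) pd (f t) [:: j] x.
  apply: eq_Rintegral => t /set_mem Dt; rewrite d1E//.
  by rewrite scale0r add0r.
move=> h; apply: derivable_of_cvg; move: h.
rewrite (_ : (fun h : R => h^-1 *: _) = fun h => h^-1 * (\int[leb]_(t in D) f t (h *: v + x) -
  \int[leb]_(t in D) f t x))//.
by apply/funext => h; rewrite /F addr0 scale0r add0r.
Qed.

Lemma C1_familyD U K K' f g : C1_family U K f -> C1_family U K' g ->
  C1_family U (K + K') (fun t x => f t x + g t x).
Proof.
move=> [bf hf] [bg hg]; split; first exact: bounded_familyD.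
move=> j; have [df bdf] := hf j; have [dg bdg] := hg j; split.
  by move=> t x t0 Ux; apply: derivableD; [exact: df|exact: dg].
apply: eq_bounded_family (bounded_familyD bdf bdg) => t x t0 Ux /=.
by rewrite [RHS]deriveD//; [exact: df|exact: dg].
Qed.

Lemma C1_familyM U K K' f g : 0 <= K -> 0 <= K' -> C1_family U K f -> C1_family U K' g ->
  C1_family U (K * K' + K * K') (fun t x => f t x * g t x).
Proof.
move=> K0 K'0 [bf hf] [bg hg]; split.
  by apply: bounded_family_le (bounded_familyM bf bg); rewrite lerDl mulr_ge0.
move=> j; have [df bdf] := hf j; have [dg bdg] := hg j; split.
  by move=> t x t0 Ux; apply: derivableM; [exact: df|exact: dg].
have bf' := bounded_family_sub (@subset_closure _ U) bf.
have bg' := bounded_family_sub (@subset_closure _ U) bg.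
have h := bounded_familyD (bounded_familyM bf' bdg) (bounded_familyM bg' bdf).
apply: eq_bounded_family (bounded_family_le _ h) => [t x t0 Ux /=|].
  by rewrite [RHS]deriveM//; [exact: df|exact: dg].
by rewrite [K' * K]mulrC.
Qed.

Lemma C1_family_cst U K (g : R -> R) : 0 <= K -> measurable_fun `[(0:R), +oo[%classic g ->
  (forall t, 0 <= t -> `|g t| <= K) -> C1_family U K (fun t _ => g t).
Proof.
move=> K0 mg bg; split; first exact: bounded_family_cst.
move=> j; split => [t x t0 Ux|]; first exact: derivable_cst.
apply: (@eq_bounded_family _ _ (fun t _ => 0)) => [t x t0 Ux /=|].
  by rewrite derive_cst.
by apply: bounded_family_cst => // t t0; rewrite normr0.
Qed.

End ParamFamilies.

(** * Coefficients smooth up to the boundary *)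

Section Smoothness.
Variables (R : realType) (m : nat).
Local Notation leb := (@lebesgue_measure R).

Lemma cvg_le_cst (u : nat -> R) (l K : R) : u k @[k --> \oo] --> l ->
  (forall k, u k <= K) -> l <= K.
Proof.
move=> ul uK; rewrite leNgt; apply/negP => Kl.
have [N _ hN] := cvgr_gt _ ul _ Kl.
by have := hN N (leqnn N); rewrite /= ltNge uK.
Qed.

Lemma within_section2 (A : set 'rV[R]_m) (g : R * 'rV[R]_m -> R) t : 0 <= t ->
  {within [set z : R * 'rV[R]_m | 0 <= z.1 /\ A z.2], continuous g} ->
  {within A, continuous (fun x => g (t, x))}.
Proof.
move=> t0 /subspace_continuousP cg; apply/subspace_continuousP => x Ax.
have /= := cg (t, x) (conj t0 Ax).
move=> h; apply: (cvg_comp (fun y => (t, y)) g _ h) => B.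
rewrite /nbhs /= => -[[B1 B2] /= [hB1 hB2] hB].
rewrite /within /=; move: hB2; apply: filterS => y B2y Ay.
apply: (hB (t, y)) => //=; split => //=; exact: nbhs_singleton.
Qed.

Lemma within_section1 (A : set 'rV[R]_m) (g : R * 'rV[R]_m -> R) x : A x ->
  {within [set z : R * 'rV[R]_m | 0 <= z.1 /\ A z.2], continuous g} ->
  {within `[(0:R), +oo[%classic, continuous (fun t => g (t, x))}.
Proof.
move=> Ax /subspace_continuousP cg; apply/subspace_continuousP => t.
rewrite /= in_itv /= andbT => t0.
have /= := cg (t, x) (conj t0 Ax).
move=> h; apply: (cvg_comp (fun y => (y, x)) g _ h) => B.
rewrite /nbhs /= => -[[B1 B2] /= [hB1 hB2] hB].
rewrite /within /=; move: hB1; apply: filterS => y B1y.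
rewrite in_itv /= andbT => y0.
apply: (hB (y, x)) => //=; split => //=; exact: nbhs_singleton.
Qed.

(** A bound on U passes to the closure by continuity. *)
Lemma C1_family_smooth (U : set 'rV[R]_m) (K : R) (f : R -> 'rV[R]_m -> R) :
  smooth_clos U 4 f ->
  (forall t x, 0 <= t -> U x -> `|f t x| <= K) ->
  (forall t x j, 0 <= t -> U x -> `|pd (f t) [:: j] x| <= K) ->
  C1_family U K f.
Proof.
move=> [df cf] bf bdf.
have c0 := cf [::] isT.
have meas (g : R -> R) : {within `[(0:R), +oo[%classic, continuous g} ->
    measurable_fun `[(0:R), +oo[%classic g.
  by move=> cg; apply: subspace_continuous_measurable_fun.
split; first split.
- by move=> x Ux; apply: meas; apply: (within_section1 Ux c0).
- by move=> t t0; apply: (within_section2 t0 c0).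
- move=> t x t0 /[dup] Ux /closure_seq[u [Uu ux]].
  apply: (@cvg_le_cst (fun k => `|f t (u k)|)); last by move=> k; exact: bf.
  apply: cvg_norm; apply: (within_cvg_seq Ux (within_section2 t0 c0)) => // k.
  exact: subset_closure.
move=> j; split; first by move=> t x t0 Ux; apply: (df t t0 [::] j x).
have cj := cf [:: j] isT.
have pE t x : U x -> pdc U (f t) [:: j] x = pd (f t) [:: j] x.
  by move=> Ux; rewrite /pdc /= mem_set.
split.
- move=> x Ux; have := meas _ (within_section1 (subset_closure Ux) cj).
  by apply: eq_measurable_fun => t _ /=; rewrite pE.
- move=> t t0; have := continuous_subspaceW (@subset_closure _ U) (within_section2 t0 cj).
  by apply: subspace_eq_continuous => x /set_mem Ux; rewrite /from_subspace /= pE.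
- by move=> t x t0 Ux; exact: bdf.
Qed.

Lemma C1_param_int (U : set 'rV[R]_m) (K T : R) (f : R -> 'rV[R]_m -> R) (D : set R) :
  open U -> C1_family U K f -> measurable D -> D `<=` `[(0:R), T]%classic ->
  C1 U (fun y => \int[leb]_(t in D) f t y) /\
  forall j x, U x -> pd (fun y => \int[leb]_(t in D) f t y) [:: j] x =
    \int[leb]_(t in D) pd (f t) [:: j] x.
Proof.
move=> oU Cf mD sub.
have pE j x : U x -> pd (fun y => \int[leb]_(t in D) f t y) [:: j] x =
    \int[leb]_(t in D) pd (f t) [:: j] x.
  by move=> Ux; have [_] := param_int_deriv j oU Cf mD sub Ux.
split=> //; split.
  by move=> [|//] j x _ Ux; have [] := param_int_deriv j oU Cf mD sub Ux.
move=> [|j [|//]] _.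
  have := param_int_continuous Cf.1 mD sub.
  exact: continuous_subspaceW (@subset_closure _ U).
have := param_int_continuous (Cf.2 j).2 mD sub.
by apply: subspace_eq_continuous => x /set_mem Ux; rewrite /from_subspace pE.
Qed.

End Smoothness.

(** * Limits of matrices *)

Section MatrixLimits.
Variable R : realType.

Lemma cvg_prodr (T : Type) {F : set_system T} {FF : Filter F} (I : Type)
    (r : seq I) (f : I -> T -> R) (l : I -> R) :
  (forall i, f i t @[t --> F] --> l i) ->
  (\prod_(i <- r) f i t) @[t --> F] --> \prod_(i <- r) l i.
Proof.
move=> fl; elim: r => [|i r IH].
  by rewrite big_nil; under eq_fun do rewrite big_nil; exact: cvg_cst.
by rewrite big_cons; under eq_fun do rewrite big_cons; exact: cvgM.
Qed.

Section Filter.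
Context (T : Type) {F : set_system T} {FF : Filter F}.

Definition mx_cvg p q (A : T -> 'M[R]_(p, q)) (L : 'M[R]_(p, q)) :=
  forall i j, A t i j @[t --> F] --> L i j.

Lemma mx_cvg_cst p q (A : 'M[R]_(p, q)) : mx_cvg (fun=> A) A.
Proof. by move=> i j; exact: cvg_cst. Qed.

Lemma mx_cvg_mul p q r (A : T -> 'M[R]_(p, q)) (B : T -> 'M[R]_(q, r)) LA LB :
  mx_cvg A LA -> mx_cvg B LB -> mx_cvg (fun t => A t *m B t) (LA *m LB).
Proof.
move=> cA cB i j; under eq_fun do rewrite mxE; rewrite mxE.
by apply: cvg_sumr => k; apply: cvgM; [exact: cA|exact: cB].
Qed.

Lemma mx_cvg_opp p q (A : T -> 'M[R]_(p, q)) LA :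
  mx_cvg A LA -> mx_cvg (fun t => - A t) (- LA).
Proof.
by move=> cA i j; under eq_fun do rewrite mxE; rewrite mxE; apply: cvgN; exact: cA.
Qed.

Lemma mx_cvg_add p q (A B : T -> 'M[R]_(p, q)) LA LB :
  mx_cvg A LA -> mx_cvg B LB -> mx_cvg (fun t => A t + B t) (LA + LB).
Proof.
move=> cA cB i j; under eq_fun do rewrite mxE; rewrite mxE.
by apply: cvgD; [exact: cA|exact: cB].
Qed.

Lemma cvg_det p (A : T -> 'M[R]_p) LA : mx_cvg A LA ->
  \det (A t) @[t --> F] --> \det LA.
Proof.
move=> cA; rewrite /determinant.
apply: cvg_sumr => s.
by apply: cvgM; [exact: cvg_cst|apply: cvg_prodr => i; exact: cA].
Qed.

(** Cramer's rule writes the inverse as a quotient of polynomials in the entries. *)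
Lemma mx_cvg_inv p (A : T -> 'M[R]_p) LA : mx_cvg A LA -> LA \in unitmx ->
  mx_cvg (fun t => invmx (A t)) (invmx LA).
Proof.
move=> cA uL i j.
have dL : \det LA != 0 by move: uL; rewrite unitmxE unitfE.
have nd : \forall t \near F, \det (A t) != 0 by exact: (cvgr_neq0 _ (cvg_det cA) dL).
apply: (@cvg_trans _ ((\det (A t))^-1 * (\adj (A t)) i j @[t --> F])).
  by apply: near_eq_cvg; apply: filterS nd => t nt; rewrite /invmx unitmxE unitfE nt [RHS]mxE.
rewrite /invmx uL mxE; apply: cvgM; first by apply: cvgV => //; exact: cvg_det.
rewrite mxE; under eq_fun do rewrite mxE.
rewrite /cofactor; apply: cvgM; first exact: cvg_cst.
apply: cvg_det => k l; rewrite !mxE; under eq_fun do rewrite !mxE.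
exact: cA.
Qed.

End Filter.

End MatrixLimits.

(** * Covariance forms of overlapping intervals *)

Section QuadraticForms.
Variables (R : realType) (N : nat) (psi : 'I_N -> 'I_2) (lo hi : 'I_N -> R) (T : R).
Local Notation leb := (@lebesgue_measure R).
Hypothesis lohi : forall i, [/\ 0 <= lo i, lo i < hi i & hi i <= T].
Hypothesis disj : forall i j t, psi i = psi j -> lo i < t <= hi i ->
  lo j < t <= hi j -> i = j.

Definition bil p q (A : 'M[R]_(p, q)) (x : 'cV[R]_p) (y : 'cV[R]_q) : R :=
  (x^T *m A *m y) ord0 ord0.

Lemma bilE p q (A : 'M[R]_(p, q)) x y :
  bil A x y = \sum_i \sum_j x i ord0 * A i j * y j ord0.
Proof.
rewrite /bil mxE exchange_big /=; apply: eq_bigr => j _.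
by rewrite mxE mulr_suml; apply: eq_bigr => i _; rewrite mxE.
Qed.

Definition itv_ind i (t : R) : R := \1_(`]lo i, hi i]) t.

Lemma itv_indE i t : itv_ind i t = ((lo i < t <= hi i)%R : bool)%:R.
Proof.
rewrite /itv_ind indicE; congr (nat_of_bool _)%:R; apply/idP/idP.
  by move=> /set_mem /=; rewrite in_itv.
by move=> h; apply/mem_set; rewrite /= in_itv.
Qed.

Lemma itv_ind_mul i j t : psi i = psi j -> i != j -> itv_ind i t * itv_ind j t = 0.
Proof.
move=> ij; rewrite !itv_indE; case: (boolP (lo i < t <= hi i)) => hi_; last by rewrite mul0r.
case: (boolP (lo j < t <= hi j)) => hj; last by rewrite mulr0.
by rewrite (disj ij hi_ hj) eqxx.
Qed.

Lemma itv_ind_sq i t : itv_ind i t * itv_ind i t = itv_ind i t.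
Proof. by rewrite itv_indE; case: (_ && _); rewrite ?mul1r ?mul0r. Qed.

(** The R^2-valued step function whose component l takes the value x_i on the interval I_i
    when that interval belongs to component l.  Intervals of the same component are
    disjoint, so at most one term of each sum is nonzero. *)
Definition stepv (x : 'cV[R]_N) t (l : 'I_2) : R :=
  \sum_i (psi i == l)%:R * (x i ord0 * itv_ind i t).

Lemma sq_sum_orth n (a : 'I_n -> R) :
  (forall i j, i != j -> a i * a j = 0) -> (\sum_i a i) ^+ 2 = \sum_i a i ^+ 2.
Proof.
move=> h; rewrite expr2 mulr_suml; apply: eq_bigr => i _.
rewrite mulr_sumr (bigD1 i)//= big1 ?addr0// => j ji.
by rewrite h// eq_sym.
Qed.

Lemma stepv_norm x t : \sum_l stepv x t l ^+ 2 = \sum_i x i ord0 ^+ 2 * itv_ind i t.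
Proof.
transitivity (\sum_l \sum_i (psi i == l)%:R * (x i ord0 ^+ 2 * itv_ind i t)).
  apply: eq_bigr => l _; rewrite /stepv sq_sum_orth.
    apply: eq_bigr => i _; rewrite !exprMn [itv_ind i t ^+ 2]itv_ind_sq.
    by case: eqP => _; rewrite ?expr1n ?expr0n.
  move=> i j ij; case: eqP => [il|]; last by rewrite !mul0r.
  case: eqP => [jl|]; last by rewrite !mul0r mulr0.
  rewrite !mul1r mulrACA itv_ind_mul ?mulr0//; by rewrite il jl.
rewrite exchange_big /=; apply: eq_bigr => i _; rewrite -mulr_suml.
rewrite (bigD1 (psi i))//= eqxx big1 ?addr0 ?mul1r// => l.
by rewrite eq_sym => /negbTE ->.
Qed.

Definition bounded_coef (K : R) (Sig : R -> 'M[R]_2) :=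
  forall l k, measurable_fun `[(0:R), T]%classic (fun t => Sig t l k) /\
    forall t, 0 <= t -> `|Sig t l k| <= K.

(** The matrix S_n for an arbitrary family of labelled intervals; [cov_mxE] matches it with
    the observation scheme. *)
Definition cov_of (Sig : R -> 'M[R]_2) : 'M[R]_N :=
  \matrix_(i, j) \int[leb]_(t in `]lo i, hi i]%classic `&` `]lo j, hi j]%classic)
    Sig t (psi i) (psi j).

Lemma mul_itv i : `]lo i, hi i]%classic `<=` `[(0:R), T]%classic.
Proof.
move=> t /=; rewrite !in_itv /= => /andP[h1 h2]; have [h3 h4 h5] := lohi i.
by rewrite (le_trans h3 (ltW h1)) (le_trans h2 h5).
Qed.

Lemma itv_ind_bound i t : 0 <= itv_ind i t <= 1.
Proof. by rewrite itv_indE; case: (lo i < t <= hi i)%R; rewrite /= ?lexx ?ler01. Qed.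

Lemma measurable_ind i D : measurable_fun D (itv_ind i).
Proof. by apply: measurable_funTS; exact: measurable_indic. Qed.

Lemma integrable_bnd (f : R -> R) (K : R) : measurable_fun `[(0:R), T]%classic f ->
  (forall t, 0 <= t -> `|f t| <= K) -> leb.-integrable `[(0:R), T]%classic (EFin \o f).
Proof.
move=> mf bf; apply: (@bounded_integrable _ _ T K) => // t /=.
by rewrite in_itv /= => /andP[t0 _]; exact: bf.
Qed.

Lemma integrable_ind2 K Sig i j (l k : 'I_2) (c : R) : bounded_coef K Sig ->
  leb.-integrable `[(0:R), T]%classic
    (EFin \o (fun t => c * (itv_ind i t * itv_ind j t * Sig t l k))).
Proof.
move=> ok; have [mS bS] := ok l k.
apply: (@integrable_bnd _ (`|c| * K)).
  apply: measurable_funM => //; apply: measurable_funM => //.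
  by apply: measurable_funM; exact: measurable_ind.
move=> t t0; rewrite !normrM ler_wpM2l//.
have [/andP[i0 i1] /andP[j0 j1]] := (itv_ind_bound i t, itv_ind_bound j t).
have := bS t t0; rewrite (ger0_norm i0) (ger0_norm j0) => h.
rewrite -[leRHS]mul1r ler_pM ?mulr_ge0//.
by rewrite -[leRHS]mul1r ler_pM.
Qed.

Lemma Rint_sum (D : set R) (I : Type) (r : seq I) (f : I -> R -> R) : measurable D ->
  (forall i, leb.-integrable D (EFin \o f i)) ->
  leb.-integrable D (EFin \o (fun t => \sum_(i <- r) f i t)) /\
  \int[leb]_(t in D) (\sum_(i <- r) f i t) = \sum_(i <- r) \int[leb]_(t in D) f i t.
Proof.
move=> mD fi; elim: r => [|i r [IH1 IH2]].
  rewrite (_ : (fun t => _) = fun=> 0); last by apply/funext => t; rewrite big_nil.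
  rewrite big_nil Rintegral_cst// mul0r; split => //.
  exact: integrable0.
rewrite (_ : (fun t => _) = fun t => f i t + \sum_(j <- r) f j t); last first.
  by apply/funext => t; rewrite big_cons.
rewrite big_cons -IH2 RintegralD//; split => //.
exact: (integrableD (mu := leb) mD (fi i) IH1).
Qed.

Lemma cov_entry K Sig i j : bounded_coef K Sig ->
  cov_of Sig i j = \int[leb]_(t in `[(0:R), T])
     (itv_ind i t * itv_ind j t * Sig t (psi i) (psi j)).
Proof.
move=> ok; rewrite mxE Rintegral_mkcond [RHS]Rintegral_mkcond.
apply: eq_Rintegral => t _; rewrite !patchE /itv_ind !indicE in_setI.
have [ti|ti] := boolP (t \in `]lo i, hi i]%classic); rewrite ?mul0r ?mul1r //=.
  have -> : t \in `[(0:R), T]%classic by apply/mem_set/(mul_itv (i := i)); exact: set_mem.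
  by case: ifP => _; rewrite ?mul1r ?mul0r.
by case: ifP.
Qed.

(** The entry S_ij integrates Sigma_t over the intersection of I_i and I_j, so the quadratic
    form is the time integral of the 2 x 2 form of Sigma_t at the step functions.  Overlaps
    between the two components are absorbed by the step functions. *)
Lemma cov_form K Sig x y : bounded_coef K Sig ->
  bil (cov_of Sig) x y = \int[leb]_(t in `[(0:R), T])
    (\sum_l \sum_k stepv x t l * Sig t l k * stepv y t k).
Proof.
move=> ok; rewrite bilE.
have mI : measurable `[(0:R), T]%classic by [].
transitivity (\sum_i \sum_j \int[leb]_(t in `[(0:R), T])
    (x i ord0 * y j ord0 * (itv_ind i t * itv_ind j t * Sig t (psi i) (psi j)))).
  apply: eq_bigr => i _; apply: eq_bigr => j _.
  rewrite RintegralZl//; last first.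
    have := integrable_ind2 i j (psi i) (psi j) 1 ok.
    by apply: eq_integrable => // t _ /=; rewrite mul1r.
  by rewrite (cov_entry i j ok) mulrAC.
transitivity (\int[leb]_(t in `[(0:R), T]) (\sum_i \sum_j
    (x i ord0 * y j ord0 * (itv_ind i t * itv_ind j t * Sig t (psi i) (psi j))))).
  have h i := @Rint_sum `[(0:R), T]%classic _ (index_enum 'I_N) (fun j t =>
    x i ord0 * y j ord0 * (itv_ind i t * itv_ind j t * Sig t (psi i) (psi j))) mI
    (fun j => integrable_ind2 i j (psi i) (psi j) (x i ord0 * y j ord0) ok).
  have [_ ->] := Rint_sum (index_enum 'I_N) mI (fun i => (h i).1).
  by apply: eq_bigr => i _; rewrite (h i).2.
apply: eq_Rintegral => t _.
transitivity (\sum_i \sum_j \sum_l \sum_k ((psi i == l)%:R * (x i ord0 * itv_ind i t)) * Sig t l k *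
    ((psi j == k)%:R * (y j ord0 * itv_ind j t))).
  apply: eq_bigr => i _; apply: eq_bigr => j _.
  rewrite (bigD1 (psi i))//= [X in _ + X]big1 ?addr0; last first.
    move=> l; rewrite eq_sym => /negbTE li; apply: big1 => k _.
    by rewrite li !mul0r.
  rewrite (bigD1 (psi j))//= [X in _ + X]big1 ?addr0; last first.
    by move=> k; rewrite eq_sym => /negbTE kj; rewrite kj !mul0r mulr0.
  by rewrite !eqxx !mul1r; ring.
under eq_bigr => i _ do rewrite exchange_big /=.
rewrite exchange_big /=; apply: eq_bigr => l _.
under eq_bigr => i _ do rewrite exchange_big /=.
rewrite exchange_big /=; apply: eq_bigr => k _.
rewrite /stepv !mulr_suml; apply: eq_bigr => i _.
by rewrite mulr_sumr.
Qed.

(** The squared norm with the interval lengths as weights and its dual, between which S is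
    bounded and boundedly invertible with constants free of the intervals. *)
Definition len_norm2 (x : 'cV[R]_N) := \sum_i x i ord0 ^+ 2 * (hi i - lo i).
Definition dual_norm2 (x : 'cV[R]_N) := \sum_i x i ord0 ^+ 2 / (hi i - lo i).

Lemma hilo i : 0 < hi i - lo i.
Proof. by have [_ h _] := lohi i; rewrite subr_gt0. Qed.

Lemma integrableZ (c : R) (f : R -> R) (D : set R) : measurable D ->
  leb.-integrable D (EFin \o f) -> leb.-integrable D (EFin \o (fun t => c * f t)).
Proof.
move=> mD fi.
by have := @integrableZl _ _ _ leb _ mD c _ fi; apply: eq_integrable.
Qed.

Lemma integrableA (f g : R -> R) (D : set R) : measurable D ->
  leb.-integrable D (EFin \o f) -> leb.-integrable D (EFin \o g) ->
  leb.-integrable D (EFin \o (fun t => f t + g t)).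
Proof.
move=> mD fi gi.
by have := @integrableD _ _ _ leb _ mD _ _ fi gi; apply: eq_integrable.
Qed.

Lemma fine_oc (a c : R) : a <= c -> fine (leb `]a, c]%classic) = c - a.
Proof.
move=> ac; have -> : leb `]a, c]%classic = (c - a)%:E.
  have := lebesgue_measure_itv `]a, c]; rewrite /= lte_fin => ->.
  case: ltP => [_|ca]; first by rewrite -EFinD.
  by have -> : a = c; [apply/eqP; rewrite eq_le ac|rewrite subrr].
by [].
Qed.

Lemma fine_cc (a c : R) : a <= c -> fine (leb `[a, c]%classic) = c - a.
Proof.
move=> ac; have -> : leb `[a, c]%classic = (c - a)%:E.
  have := lebesgue_measure_itv `[a, c]; rewrite /= lte_fin => ->.
  case: ltP => [_|ca]; first by rewrite -EFinD.
  by have -> : a = c; [apply/eqP; rewrite eq_le ac|rewrite subrr].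
by [].
Qed.

Lemma integral_ind i : \int[leb]_(t in `[(0:R), T]) itv_ind i t = hi i - lo i.
Proof.
have [h1 h2 h3] := lohi i.
transitivity (\int[leb]_(t in `]lo i, hi i]) (1:R)).
  rewrite Rintegral_mkcond [RHS]Rintegral_mkcond; apply: eq_Rintegral => t _; rewrite !patchE /itv_ind indicE.
  case: (boolP (t \in `]lo i, hi i]%classic)) => ti; last by case: ifP.
  by rewrite mem_set//; apply: (mul_itv (i := i)); exact: set_mem.
by rewrite (@Rintegral_cst _ _ _ leb)// mul1r fine_oc ?ltW.
Qed.

(** The weighted squared norm is the squared L2 norm of the step function. *)
Lemma integral_stepv_norm x :
  leb.-integrable `[(0:R), T]%classic (EFin \o (fun t => \sum_l stepv x t l ^+ 2)) /\
  \int[leb]_(t in `[(0:R), T]) (\sum_l stepv x t l ^+ 2) = len_norm2 x.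
Proof.
rewrite (_ : (fun t => _) = fun t => \sum_i x i ord0 ^+ 2 * itv_ind i t); last first.
  by apply/funext => t; exact: stepv_norm.
have mI : measurable `[(0:R), T]%classic by [].
have ii i c : leb.-integrable `[(0:R), T]%classic (EFin \o (fun t => c * itv_ind i t)).
  apply: (@integrable_bnd _ `|c|).
    by apply: measurable_funM => //; exact: measurable_ind.
  move=> t _; have /andP[i0 i1] := itv_ind_bound i t.
  by rewrite normrM [`|itv_ind i t|]ger0_norm// ler_piMr.
have [h ->] := Rint_sum (index_enum 'I_N) mI (fun i => ii i (x i ord0 ^+ 2)).
split => //; apply: eq_bigr => i _; rewrite RintegralZl//; first by rewrite integral_ind.
by have := ii i 1; apply: eq_integrable => // t _ /=; rewrite mul1r.
Qed.

Lemma measurable_stepv x l D : measurable_fun D (fun t => stepv x t l).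
Proof.
apply: measurable_sum => i; apply: measurable_funM => //; apply: measurable_funM => //.
exact: measurable_ind.
Qed.

Lemma stepv_bound x l : exists K, forall t, `|stepv x t l| <= K.
Proof.
exists (\sum_i `|x i ord0|) => t; apply: (le_trans (ler_norm_sum _ _ _)).
apply: ler_sum => i _; rewrite !normrM.
have /andP[i0 i1] := itv_ind_bound i t; rewrite (ger0_norm i0).
case: eqP => _; rewrite ?normr1 ?mul1r ?normr0 ?mul0r//.
by rewrite ler_piMr.
Qed.

Lemma integrable_form K Sig x y : bounded_coef K Sig ->
  leb.-integrable `[(0:R), T]%classic
    (EFin \o (fun t => \sum_l \sum_k stepv x t l * Sig t l k * stepv y t k)).
Proof.
move=> ok; have mI : measurable `[(0:R), T]%classic by [].
apply: (proj1 (Rint_sum (index_enum 'I_2) mI _)) => l.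
apply: (proj1 (Rint_sum (index_enum 'I_2) mI _)) => k.
have [Kx hx] := stepv_bound x l; have [Ky hy] := stepv_bound y k.
have [mS bS] := ok l k.
apply: (@integrable_bnd _ (Kx * K * Ky)).
  by apply: measurable_funM; [apply: measurable_funM => //|]; exact: measurable_stepv.
by move=> t t0; rewrite !normrM; apply: ler_pM => //; apply: ler_pM => //; exact: bS.
Qed.

Lemma form_colE (A : 'M[R]_2) (a b : 'I_2 -> R) :
  bil A (\col_l a l) (\col_l b l) = \sum_l \sum_k a l * A l k * b k.
Proof. by rewrite bilE; apply: eq_bigr => l _; apply: eq_bigr => k _; rewrite !mxE. Qed.

Lemma form_scalar (c : R) (a : 'I_2 -> R) :
  bil c%:M (\col_l a l) (\col_l a l) = c * \sum_l a l ^+ 2.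
Proof.
rewrite form_colE mulr_sumr; apply: eq_bigr => l _.
rewrite (bigD1 l)//= big1 ?addr0; last first.
  by move=> k kl; rewrite mxE eq_sym (negbTE kl) mulr0n mulr0 mul0r.
by rewrite mxE eqxx mulr1n; ring.
Qed.

(** Ellipticity of Sigma_t at each time, integrated against the step function. *)
Lemma cov_lower K c Sig x : bounded_coef K Sig ->
  (forall t, 0 <= t -> loewner_le c%:M (Sig t)) -> c * len_norm2 x <= bil (cov_of Sig) x x.
Proof.
move=> ok hc; rewrite (cov_form x x ok).
have [i1 <-] := integral_stepv_norm x.
have mI : measurable `[(0:R), T]%classic by [].
rewrite -RintegralZl//; apply: le_Rintegral => //.
- exact: integrableZ.
- exact: integrable_form ok.
move=> t /=; rewrite in_itv /= => /andP[t0 _].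
have := hc t t0 (\col_l stepv x t l).
by rewrite -!/(bil _ _ _) form_scalar form_colE.
Qed.

Lemma cov_upper K c Sig x : bounded_coef K Sig ->
  (forall t, 0 <= t -> loewner_le (Sig t) c%:M) -> bil (cov_of Sig) x x <= c * len_norm2 x.
Proof.
move=> ok hc; rewrite (cov_form x x ok).
have [i1 <-] := integral_stepv_norm x.
have mI : measurable `[(0:R), T]%classic by [].
rewrite -RintegralZl//; apply: le_Rintegral => //.
- exact: integrable_form ok.
- exact: integrableZ.
move=> t /=; rewrite in_itv /= => /andP[t0 _].
have := hc t t0 (\col_l stepv x t l).
by rewrite -!/(bil _ _ _) form_scalar form_colE.
Qed.

(** Young's inequality z s w <= z^2 / 4 + s^2 w^2 for each of the four entries of Sigma_t.
    It is meant for derivatives of the covariance, whose entries are all that is controlled. *)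
Lemma cov_young K Sig x y : 0 <= K -> bounded_coef K Sig ->
  bil (cov_of Sig) x y <= 2^-1 * (len_norm2 x + (2 * K) ^+ 2 * len_norm2 y).
Proof.
move=> K0 ok; rewrite (cov_form x y ok).
have [i1 <-] := integral_stepv_norm x.
have [i2 <-] := integral_stepv_norm y.
have mI : measurable `[(0:R), T]%classic by [].
have i3 := integrableZ ((2 * K) ^+ 2) mI i2.
have i4 := integrableA mI i1 i3.
rewrite -RintegralZl// -RintegralD// -RintegralZl//.
apply: le_Rintegral => //.
- exact: integrable_form ok.
- exact: integrableZ.
move=> t /=; rewrite in_itv /= => /andP[t0 _].
rewrite !big_ord_recl !big_ord0 !addr0.
set l1 := lift ord0 ord0.
have b l k : `|Sig t l k| <= K by have [_] := ok l k; exact.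
move: (b ord0 ord0) (b ord0 l1) (b l1 ord0) (b l1 l1).
move: (stepv x t ord0) (stepv x t l1) (stepv y t ord0) (stepv y t l1) => x0 x1 y0 y1.
move: (Sig t ord0 ord0) (Sig t ord0 l1) (Sig t l1 ord0) (Sig t l1 l1) => a b' c d ha hb hc hd.
have h (z s w : R) : `|s| <= K -> z * s * w <= 4^-1 * z ^+ 2 + K ^+ 2 * w ^+ 2.
  move=> hs; have : s ^+ 2 <= K ^+ 2 by rewrite -real_normK ?num_real// lerXn2r ?nnegrE.
  move=> hs2; have := ler_wpM2r (sqr_ge0 w) hs2.
  have := sqr_ge0 (2^-1 * z - s * w); rewrite !expr2 => k1 k2; lra.
have := h x0 a y0 ha; have := h x0 b' y1 hb; have := h x1 c y0 hc; have := h x1 d y1 hd.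
rewrite !expr2 => k1 k2 k3 k4; lra.
Qed.

Lemma bil_mul (A : 'M[R]_N) (x u : 'cV[R]_N) :
  bil A x u = \sum_i x i ord0 * (A *m u) i ord0.
Proof. by rewrite /bil -mulmxA mxE; apply: eq_bigr => i _; rewrite mxE. Qed.

Lemma len_norm2_ge0 x : 0 <= len_norm2 x.
Proof. by apply: sumr_ge0 => i _; rewrite mulr_ge0 ?sqr_ge0 ?ltW ?hilo. Qed.

Lemma len_norm2_eq0 x : len_norm2 x = 0 -> x = 0.
Proof.
move=> x0; apply/colP => i; rewrite mxE.
have /eqP := x0; rewrite psumr_eq0; last first.
  by move=> j _; rewrite mulr_ge0 ?sqr_ge0 ?ltW ?hilo.
move/allP/(_ i (mem_index_enum _)) => /=; rewrite mulf_eq0 sqrf_eq0.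
by rewrite (gt_eqF (hilo i)) orbF => /eqP.
Qed.

Definition divlen (x : 'cV[R]_N) : 'cV[R]_N := \col_i (x i ord0 / (hi i - lo i)).

Lemma len_norm2_divlen x : len_norm2 (divlen x) = dual_norm2 x.
Proof.
apply: eq_bigr => i _; rewrite mxE; have /lt0r_neq0 := hilo i.
by move=> h; field.
Qed.

Lemma divlen_dot x : \sum_i divlen x i ord0 * x i ord0 = dual_norm2 x.
Proof. by apply: eq_bigr => i _; rewrite mxE expr2; ring. Qed.

Section Form.
Variables (A : 'M[R]_N) (c : R).
Hypothesis c0 : 0 < c.
Hypothesis lowA : forall x, c * len_norm2 x <= bil A x x.

Lemma form_unit : A \in unitmx.
Proof.
rewrite unitmxE unitfE; apply/negP => /det0P[v v0 vA].
have := lowA v^T; rewrite /bil trmxK vA mul0mx mxE => h.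
have : len_norm2 v^T = 0.
  by apply/eqP; rewrite eq_le len_norm2_ge0 andbT -(ler_pM2l c0) mulr0.
by move/len_norm2_eq0 => /(congr1 trmx); rewrite trmxK trmx0 => h0; rewrite h0 eqxx in v0.
Qed.

(** With u = A^-1 D one has c |u|^2 <= u^T A u = u^T D, and Young's inequality between the
    norm and its dual absorbs half of the left side. *)
Lemma inv_norm2 (D : 'cV[R]_N) : c ^+ 2 * len_norm2 (invmx A *m D) <= dual_norm2 D.
Proof.
set u := invmx A *m D.
have Au : A *m u = D by rewrite mulmxA mulmxV ?mul1mx// form_unit.
have := lowA u; rewrite bil_mul Au => h.
(* Young, with weights c |I_i| *)
have : \sum_i u i ord0 * D i ord0 <= 2^-1 * (c * len_norm2 u + c^-1 * dual_norm2 D).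
  rewrite /len_norm2 /dual_norm2 !mulr_sumr -big_split /= mulr_sumr; apply: ler_sum => i _.
  have h0 := hilo i; set L := hi i - lo i in h0 *.
  set a := u i ord0; set e := D i ord0.
  have : 0 <= (c * L) * (a - e / (c * L)) ^+ 2 by rewrite mulr_ge0 ?sqr_ge0 ?ltW ?mulr_gt0.
  have -> : (c * L) * (a - e / (c * L)) ^+ 2 = c * (a ^+ 2 * L) + c^-1 * (e ^+ 2 / L) - 2 * (a * e).
    by field; rewrite !gt_eqF.
  by move=> ?; lra.
move=> h2; have h3 : c * len_norm2 u <= c^-1 * dual_norm2 D by lra.
by rewrite expr2 -mulrA -ler_pdivlMl.
Qed.

(** Cauchy's inequality for the form A between u = A^-1 D and the vector w with entries
    D_i / |I_i|: the product w^T A u = w^T D is the dual norm of D, and w^T A w is at most C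
    times that norm.  It is obtained from the nonnegativity of A at w - C u. *)
Lemma inv_form_ge (C : R) (D : 'cV[R]_N) : 0 < C -> A^T = A ->
  (forall x, bil A x x <= C * len_norm2 x) -> dual_norm2 D <= C * bil (invmx A) D D.
Proof.
move=> C0 sA upA; set u := invmx A *m D.
have Au : A *m u = D by rewrite mulmxA mulmxV ?mul1mx// form_unit.
have bs x y : bil A x y = bil A y x.
  rewrite !bilE exchange_big /=; apply: eq_bigr => i _; apply: eq_bigr => j _.
  by rewrite -{1}sA mxE; ring.
have -> : bil (invmx A) D D = bil A u u.
  by rewrite !bil_mul Au; apply: eq_bigr => i _; rewrite mulrC.
set w := divlen D.
have dD : bil A w u = dual_norm2 D by rewrite bil_mul Au divlen_dot.
(* C is the multiple for which the cross terms produce the claimed bound *)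
have h : 0 <= bil A (w - C *: u) (w - C *: u).
  by apply: le_trans (lowA _); rewrite mulr_ge0 ?len_norm2_ge0 ?ltW.
have e : bil A (w - C *: u) (w - C *: u) =
    bil A w w - C * bil A w u - C * bil A u w + C ^+ 2 * bil A u u.
  rewrite !bilE mulr_sumr -sumrB mulr_sumr -sumrB mulr_sumr -big_split /=.
  apply: eq_bigr => i _; rewrite mulr_sumr -sumrB mulr_sumr -sumrB mulr_sumr -big_split /=.
  by apply: eq_bigr => j _; rewrite !mxE; ring.
rewrite e (bs u w) dD in h.
have := upA w; rewrite len_norm2_divlen => h2.
rewrite -(ler_pM2l C0) mulrA -expr2.
lra.
Qed.

End Form.

(** The dual norm is attained at the vector with entries (S u)_i / |I_i|, so [cov_young]
    bounds it. *)
Lemma cov_apply_dual_norm2 K Sig (u : 'cV[R]_N) : 0 <= K -> bounded_coef K Sig ->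
  dual_norm2 (cov_of Sig *m u) <= (2 * K) ^+ 2 * len_norm2 u.
Proof.
move=> K0 ok; have := cov_young (divlen (cov_of Sig *m u)) u K0 ok.
rewrite bil_mul divlen_dot len_norm2_divlen => h; lra.
Qed.

Lemma cov_of_sym Sig : (forall t, (Sig t)^T = Sig t) -> (cov_of Sig)^T = cov_of Sig.
Proof.
move=> h; apply/matrixP => i j; rewrite !mxE setIC.
by apply: eq_Rintegral => t _; rewrite -{1}h mxE.
Qed.

(** The sum of indicators of disjoint intervals is its own square. *)
Lemma sum_ind_le l t : 0 <= \sum_i (psi i == l)%:R * itv_ind i t <= 1.
Proof.
set a := \sum_i _; have a0 : 0 <= a.
  by apply: sumr_ge0 => i _; rewrite mulr_ge0 ?ler0n//; case/andP: (itv_ind_bound i t).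
rewrite a0 /=; have : a ^+ 2 = a.
  rewrite /a sq_sum_orth.
    apply: eq_bigr => i _; rewrite exprMn [itv_ind i t ^+ 2]itv_ind_sq.
    by case: eqP => _; rewrite ?expr1n ?expr0n.
  move=> i j ij; case: eqP => [il|]; last by rewrite !mul0r.
  case: eqP => [jl|]; last by rewrite !mul0r mulr0.
  by rewrite !mul1r itv_ind_mul// il jl.
by rewrite expr2; nra.
Qed.

Lemma sum_ind t (g : 'I_2 -> R) :
  \sum_i itv_ind i t * g (psi i) = \sum_l g l * (\sum_i (psi i == l)%:R * itv_ind i t).
Proof.
transitivity (\sum_i \sum_l g l * ((psi i == l)%:R * itv_ind i t)).
  apply: eq_bigr => i _; rewrite (bigD1 (psi i))//= eqxx big1 ?addr0; first by rewrite mul1r mulrC.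
  by move=> l; rewrite eq_sym => /negbTE ->; rewrite mul0r mulr0.
by rewrite exchange_big /=; apply: eq_bigr => l _; rewrite mulr_sumr.
Qed.

(** Each of the two components covers [0, T] at most once. *)
Lemma sum_length : 0 <= T -> \sum_i (hi i - lo i) <= 2 * T.
Proof.
move=> T0; have mI : measurable `[(0:R), T]%classic by [].
have ii i : leb.-integrable `[(0:R), T]%classic (EFin \o (fun t => itv_ind i t)).
  apply: (@integrable_bnd _ 1) => [|t _]; first exact: measurable_ind.
  by have /andP[i0 i1] := itv_ind_bound i t; rewrite ger0_norm.
have [h1 h2] := Rint_sum (index_enum 'I_N) mI ii.
under eq_bigr do rewrite -integral_ind.
rewrite -h2 (_ : 2 * T = \int[leb]_(t in `[0, T]) (2:R)); last first.
  by rewrite (@Rintegral_cst _ _ _ leb)// fine_cc// subr0.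
apply: le_Rintegral => //.
  by apply: (@bounded_integrable _ _ T 2) => // t _; rewrite ger0_norm.
move=> t _; have := sum_ind t (fun=> 1).
under eq_bigr do rewrite mulr1.
move=> ->; rewrite !big_ord_recl big_ord0 addr0 !mul1r.
have /andP[_ h3] := sum_ind_le ord0 t.
have /andP[_ h4] := sum_ind_le (lift ord0 ord0) t.
lra.
Qed.

Definition dincr (g : R -> 'I_2 -> R) : 'cV[R]_N :=
  \col_i \int[leb]_(t in `]lo i, hi i]) g t (psi i).

Lemma length_itv i : fine (leb `]lo i, hi i]%classic) = hi i - lo i.
Proof.
by rewrite fine_oc// ltW//; have [] := lohi i.
Qed.

Lemma dincr_dual_norm2 K (g : R -> 'I_2 -> R) : 0 <= T -> 0 <= K ->
  (forall l, measurable_fun `[(0:R), T]%classic (g ^~ l)) ->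
  (forall t l, 0 <= t -> `|g t l| <= K) -> dual_norm2 (dincr g) <= K ^+ 2 * (2 * T).
Proof.
move=> T0 K0 mg bg; apply: le_trans (ler_wpM2l (sqr_ge0 K) (sum_length T0)).
rewrite mulr_sumr; apply: ler_sum => i _; rewrite mxE.
have L0 := hilo i; rewrite ler_pdivrMr// -mulrA -expr2 -exprMn.
have gi := integrable_bnd (mg (psi i)) (fun t => bg t (psi i)).
have gi2 : leb.-integrable `]lo i, hi i]%classic (EFin \o (g ^~ (psi i))).
  by apply: integrableS gi => //; exact: mul_itv.
rewrite -real_normK ?num_real//; apply: lerXn2r; rewrite ?nnegrE ?mulr_ge0 ?(ltW L0)//.
apply: le_trans (le_normr_Rintegral _ gi2) _ => //.
rewrite -length_itv -(@Rintegral_cst _ _ _ leb)//; apply: le_Rintegral => //.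
- by have := integrable_norm gi2.
- apply: (@bounded_integrable _ _ T K) => //; last by move=> t _; rewrite ger0_norm.
  exact: mul_itv.
- move=> t /(mul_itv (i := i)) /=; rewrite in_itv /= => /andP[t0 _]; exact: bg.
Qed.

(** On an interval where g oscillates by at most e, g differs from its mean by at most e, so
    g^2 <= 2 mean^2 + 2 e^2; the integral of the squared mean over I_i is the term
    D_i^2 / |I_i| of the dual norm. *)
Lemma dincr_lower K (e : R) (g : R -> 'I_2 -> R) : 0 <= T -> 0 <= e ->
  (forall l, measurable_fun `[(0:R), T]%classic (g ^~ l)) ->
  (forall t l, 0 <= t -> `|g t l| <= K) ->
  (forall i t s, lo i < t <= hi i -> lo i < s <= hi i -> `|g t (psi i) - g s (psi i)| <= e) ->
  (forall l t, 0 < t <= T -> exists2 i, psi i = l & lo i < t <= hi i) ->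
  \int[leb]_(t in `[0, T]) (\sum_l g t l ^+ 2) <=
    2 * dual_norm2 (dincr g) + 4 * e ^+ 2 * T.
Proof.
move=> T0 e0 mg bg osc cov; have mI : measurable `[(0:R), T]%classic by [].
have bg2 t l : 0 <= t -> `|g t l ^+ 2| <= K ^+ 2.
  move=> t0; rewrite normrX lerXn2r ?nnegrE//; last exact: bg.
  exact: le_trans (bg t l t0).
have mg2 l : measurable_fun `[(0:R), T]%classic (fun t => g t l ^+ 2).
  exact: (measurable_funX _ (mg l)).
have ii i : leb.-integrable `[(0:R), T]%classic
    (EFin \o (fun t => itv_ind i t * g t (psi i) ^+ 2)).
  apply: (@integrable_bnd _ (K ^+ 2)).
    by apply: measurable_funM => //; exact: measurable_ind.
  move=> t t0; have /andP[i0 i1] := itv_ind_bound i t.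
  rewrite normrM (ger0_norm i0); apply: le_trans (bg2 t (psi i) t0).
  by rewrite ler_piMl.
have [h1 h2] := Rint_sum (index_enum 'I_N) mI ii.
have gsum : leb.-integrable `[(0:R), T]%classic (EFin \o (fun t => \sum_l g t l ^+ 2)).
  apply: (proj1 (Rint_sum (index_enum 'I_2) mI _)) => l.
  exact: (integrable_bnd (mg2 l) (fun t => bg2 t l)).
(* every time in ]0, T] lies in an interval of each component *)
have le1 : \int[leb]_(t in `[0, T]) (\sum_l g t l ^+ 2) <=
    \sum_i \int[leb]_(t in `[0, T]) (itv_ind i t * g t (psi i) ^+ 2).
  rewrite -h2 -!(@Rintegral_itv_obnd_cbnd R 0 (BRight T)); first last.
  - by apply: integrableS h1 => //; exact: subset_itv_oc_cc.
  - by apply: integrableS gsum => //; exact: subset_itv_oc_cc.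
  - apply: le_Rintegral => //.
    + by apply: integrableS gsum => //; exact: subset_itv_oc_cc.
    + by apply: integrableS h1 => //; exact: subset_itv_oc_cc.
    move=> t /=; rewrite in_itv /= => tT.
    rewrite (sum_ind t (fun l => g t l ^+ 2)); apply: ler_sum => l _.
    have [i il ti] := cov l t tT.
    rewrite ler_peMr ?sqr_ge0// (bigD1 i)//= il eqxx mul1r itv_indE ti lerDl.
    by apply: sumr_ge0 => j _; rewrite mulr_ge0 ?ler0n.
apply: (le_trans le1).
have le2 i : \int[leb]_(t in `[0, T]) (itv_ind i t * g t (psi i) ^+ 2) <=
    2 * (dincr g i ord0 ^+ 2 / (hi i - lo i)) + 2 * e ^+ 2 * (hi i - lo i).
  have L0 := hilo i; set L := hi i - lo i in L0 *.
  have mi : measurable `]lo i, hi i]%classic by [].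
  have gi2 : leb.-integrable `]lo i, hi i]%classic (EFin \o (g ^~ (psi i))).
    apply: integrableS (integrable_bnd (mg (psi i)) (fun t => bg t (psi i))) => //.
    exact: mul_itv.
  (* the mean of g over the interval *)
  set a := dincr g i ord0 / L.
  have ci (c : R) : leb.-integrable `]lo i, hi i]%classic (EFin \o (fun=> c)).
    apply: (@bounded_integrable _ _ T `|c|) => //; exact: mul_itv.
  have da t : lo i < t <= hi i -> `|g t (psi i) - a| <= e.
    move=> ti; rewrite -(ler_pM2r L0) -{1}(gtr0_norm L0) -normrM mulrBl mulfVK ?gt_eqF//.
    have -> : g t (psi i) * L - dincr g i ord0 =
        \int[leb]_(s in `]lo i, hi i]) (g t (psi i) - g s (psi i)).
      by rewrite RintegralB// (@Rintegral_cst _ _ _ leb)// length_itv mxE.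
    have di : leb.-integrable `]lo i, hi i]%classic
        (EFin \o (fun s => g t (psi i) - g s (psi i))).
      have := @integrableB _ _ _ leb _ mi _ _ (ci (g t (psi i))) gi2.
      by apply: eq_integrable.
    apply: le_trans (le_normr_Rintegral _ di) _ => //.
    rewrite /L -length_itv -(@Rintegral_cst _ _ _ leb)//; apply: le_Rintegral => //.
    - by have := integrable_norm di.
    - by move=> s /=; rewrite in_itv /= => si; exact: osc.
  have -> : 2 * (dincr g i ord0 ^+ 2 / L) + 2 * e ^+ 2 * L =
      \int[leb]_(t in `[0, T]) ((2 * a ^+ 2 + 2 * e ^+ 2) * itv_ind i t).
    rewrite RintegralZl//; last first.
      apply: (@integrable_bnd _ 1) => [|t _]; first exact: measurable_ind.
      by have /andP[i0 i1] := itv_ind_bound i t; rewrite ger0_norm.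
    by rewrite integral_ind -/L /a; field; rewrite gt_eqF.
  apply: le_Rintegral => //.
    apply: (@integrable_bnd _ `|2 * a ^+ 2 + 2 * e ^+ 2|).
      by apply: measurable_funM => //; exact: measurable_ind.
    move=> t _; have /andP[i0 i1] := itv_ind_bound i t.
    by rewrite normrM (ger0_norm i0) ler_piMr.
  move=> t _; rewrite itv_indE; have [ti|ti] := boolP (lo i < t <= hi i)%R; last by rewrite mul0r mulr0.
  rewrite mul1r mulr1; have := da t ti; move: (g t _) => y.
  move=> h3; have : (y - a) ^+ 2 <= e ^+ 2.
    by rewrite -real_normK ?num_real// lerXn2r ?nnegrE.
  by have := sqr_ge0 (y - 2 * a); rewrite !expr2 => h4 h5; lra.
apply: le_trans (ler_sum _ (fun i _ => le2 i)) _.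
rewrite big_split /= -!mulr_sumr lerD2l.
have := sum_length T0; have := sqr_ge0 e.
by move=> k1 k2; have := ler_wpM2l k1 k2; lra.
Qed.

End QuadraticForms.

(** * Derivatives of the solution of a linear system *)

Section Solve.
Variables (R : realType) (m N : nat) (U : set 'rV[R]_m).
Hypothesis oU : open U.

Lemma C1_within (u : 'rV[R]_m -> R) (s : seq 'I_m) x : (size s <= 1)%N ->
  C1 U u -> U x -> pd u s y @[y --> within U (nbhs x)] --> pd u s x.
Proof. by move=> ss [_ /(_ s ss)] /subspace_continuousP h Ux; exact: h. Qed.

Lemma C1_line (u : 'rV[R]_m -> R) (j : 'I_m) x : C1 U u -> U x ->
  h^-1 * (u (h *: delta_mx ord0 j + x) - u x) @[h --> (0:R)^'] --> pd u [:: j] x /\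
  u (h *: delta_mx ord0 j + x) @[h --> (0:R)^'] --> u x.
Proof.
move=> Cu Ux; split; first by apply: cvg_of_derivable; exact: (Cu.1 [::] j x isT Ux).
have cx : h *: delta_mx ord0 j + x @[h --> (0:R)^'] --> within U (nbhs x).
  have [r r0 hr] := line_nbhs (delta_mx ord0 j) oU Ux.
  have c : h *: delta_mx ord0 j + x @[h --> (0:R)^'] --> x.
    rewrite -[X in _ --> X]add0r -(scale0r (delta_mx ord0 j)).
    apply: cvgD; last exact: cvg_cst.
    by apply: cvgZr_tmp; apply: cvg_within_filter; exact: cvg_id.
  move=> B hB; have := c _ hB; rewrite /nbhs /=.
  have : \forall h \near (0:R)^', U (h *: delta_mx ord0 j + x).
    apply: (cvg_within_filter (F := nbhs (0:R)) (f := id) (G := nbhs (0:R))); first exact: cvg_id.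
    apply/nbhs_ballP; exists r => //= h; rewrite -ball_normE /= sub0r normrN => hh.
    exact: hr.
  by apply: filterS2 => h h1 h2; exact: h2.
exact: (cvg_comp _ _ cx (C1_within (s := [::]) isT Cu Ux)).
Qed.

Variables (S : 'rV[R]_m -> 'M[R]_N) (D : 'rV[R]_m -> 'cV[R]_N).
Hypothesis CS : forall i j, C1 U (fun y => S y i j).
Hypothesis CD : forall i, C1 U (fun y => D y i ord0).
Hypothesis uS : forall y, U y -> S y \in unitmx.

Definition solution y := invmx (S y) *m D y.
Definition pd_mx p q (A : 'rV[R]_m -> 'M[R]_(p, q)) (s : seq 'I_m) y : 'M[R]_(p, q) :=
  \matrix_(i, k) pd (fun z => A z i k) s y.
Definition dsolution j y := invmx (S y) *m (pd_mx D [:: j] y - pd_mx S [:: j] y *m solution y).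

(** Differentiating S u = D gives u' = S^-1 (D' - S' u); at the level of difference
    quotients this is the exact identity S(y_h) (u(y_h) - u(y)) / h = dD - dS u(y). *)
Lemma solution_deriv j x i : U x ->
  derivable (fun y => solution y i ord0) x (delta_mx ord0 j) /\
  pd (fun y => solution y i ord0) [:: j] x = dsolution j x i ord0.
Proof.
move=> Ux; apply: derivable_of_cvg.
have [r r0 hr] := line_nbhs (delta_mx ord0 j) oU Ux.
have nU : \forall h \near (0:R)^', U (h *: delta_mx ord0 j + x).
  apply: (cvg_within_filter (F := nbhs (0:R)) (f := id) (G := nbhs (0:R))); first exact: cvg_id.
  apply/nbhs_ballP; exists r => //= h; rewrite -ball_normE /= sub0r normrN => hh.
  exact: hr.
pose xh (h : R) := h *: delta_mx ord0 j + x.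
pose quo p q (A : 'rV[R]_m -> 'M[R]_(p, q)) (h : R) := h^-1 *: (A (xh h) - A x).
have cquo p q (A : 'rV[R]_m -> 'M[R]_(p, q)) : (forall i j, C1 U (fun y => A y i j)) ->
    mx_cvg (F := (0:R)^') (quo p q A) (pd_mx A [:: j] x).
  move=> CA k l; rewrite /pd_mx mxE; under eq_fun do rewrite !mxE.
  exact: (C1_line j (CA k l) Ux).1.
have cS : mx_cvg (F := (0:R)^') (fun h => S (xh h)) (S x).
  by move=> k l; exact: (C1_line j (CS k l) Ux).2.
have CD' k l : C1 U (fun y => D y k l) by rewrite (ord1 l).
have : mx_cvg (F := (0:R)^')
    (fun h => invmx (S (xh h)) *m (quo _ _ D h - quo _ _ S h *m solution x))
    (invmx (S x) *m (pd_mx D [:: j] x - pd_mx S [:: j] x *m solution x)).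
  apply: mx_cvg_mul; first by apply: mx_cvg_inv cS _; exact: uS.
  apply: mx_cvg_add; first exact: cquo.
  by apply: mx_cvg_opp; apply: mx_cvg_mul; [exact: cquo|exact: mx_cvg_cst].
move=> /(_ i ord0); apply: cvg_trans; apply: near_eq_cvg.
move: nU; apply: filterS => h Uh.
have uh := uS Uh.
(* product rule for S u = D at the level of quotients *)
have e : quo _ _ D h - quo _ _ S h *m solution x =
    S (xh h) *m (h^-1 *: (solution (xh h) - solution x)).
  rewrite /quo -scalemxAr -scalemxAl -scalerBr; congr (_ *: _).
  rewrite mulmxBr mulmxBl /solution !mulmxA !mulmxV ?mul1mx//; last exact: uS.
  by rewrite opprB addrA subrK.
by rewrite e mulmxA mulVmx// mul1mx !mxE.
Qed.

Lemma C1_solution i : C1 U (fun y => solution y i ord0).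
Proof.
have CD' k l : C1 U (fun y => D y k l) by rewrite (ord1 l).
have c p q (A : 'rV[R]_m -> 'M[R]_(p, q)) s x : (size s <= 1)%N ->
    (forall i j, C1 U (fun y => A y i j)) -> U x ->
    mx_cvg (F := within U (nbhs x)) (pd_mx A s) (pd_mx A s x).
  move=> ss CA Ux k l; rewrite /pd_mx mxE; under eq_fun do rewrite !mxE.
  exact: C1_within.
have p0 p q (A : 'rV[R]_m -> 'M[R]_(p, q)) : pd_mx A [::] = A.
  by apply/funext => y; apply/matrixP => k l; rewrite mxE.
have cu x : U x -> mx_cvg (F := within U (nbhs x)) solution (solution x).
  move=> Ux; apply: mx_cvg_mul.
    apply: mx_cvg_inv; last exact: uS.
    by have := c _ _ S [::] x isT CS Ux; rewrite p0.
  by have := c _ _ D [::] x isT CD' Ux; rewrite p0.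
split; first by move=> [|//] j x _ Ux; exact: (solution_deriv j i Ux).1.
move=> [|j [|//]] _; apply/subspace_continuousP => x Ux; first exact: cu.
rewrite /from_subspace (solution_deriv j i Ux).2.
have h : dsolution j y i ord0 @[y --> within U (nbhs x)] --> dsolution j x i ord0.
  apply: mx_cvg_mul.
    apply: mx_cvg_inv; last exact: uS.
    by have := c _ _ S [::] x isT CS Ux; rewrite p0.
  apply: mx_cvg_add; first exact: c.
  by apply: mx_cvg_opp; apply: mx_cvg_mul; [exact: c|exact: cu].
apply: cvg_trans h; apply: near_eq_cvg.
by apply: filterS (withinT _ _) => y Uy; rewrite (solution_deriv j i Uy).2.
Qed.

End Solve.

(** * Functions of one of the two parameters *)

Section Lifts.
Variables (R : realType) (d1 d2 : nat) (Th1 : set 'rV[R]_d1) (Th2 : set 'rV[R]_d2).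
Local Notation U := (prod_set Th1 Th2).

Lemma cvg_lsub : continuous (@lsubmx R 1 d1 d2 : 'rV[R]_(d1 + d2) -> 'rV[R]_d1).
Proof.
move=> x B [P hP PB].
exists (fun i j => if fintype.split j is inl k then P i k else setT).
  move=> i j; case: (splitP j) => k jk; last exact: filterT.
  have -> : j = lshift d2 k by apply/val_inj.
  by have := hP i k; rewrite mxE.
move=> y hy; apply: PB => i k; have := hy i (lshift d2 k).
by rewrite mxE (unsplitK (inl k)).
Qed.

Lemma cvg_rsub : continuous (@rsubmx R 1 d1 d2 : 'rV[R]_(d1 + d2) -> 'rV[R]_d2).
Proof.
move=> x B [P hP PB].
exists (fun i j => if fintype.split j is inr k then P i k else setT).
  move=> i j; case: (splitP j) => k jk; first exact: filterT.
  have -> : j = rshift d1 k by apply/val_inj.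
  by have := hP i k; rewrite mxE.
move=> y hy; apply: PB => i k; have := hy i (rshift d1 k).
by rewrite mxE (unsplitK (inr k)).
Qed.

Lemma closure_prod x : closure U x -> closure Th1 (lsubmx x) /\ closure Th2 (rsubmx x).
Proof.
move=> cx; split => B hB.
  have [y [[Uy _] By]] := cx _ (cvg_lsub hB).
  by exists (lsubmx y).
have [y [[_ Uy] By]] := cx _ (cvg_rsub hB).
by exists (rsubmx y).
Qed.

Lemma open_prod : open Th1 -> open Th2 -> open U.
Proof.
move=> o1 o2; apply: openI.
  by apply: open_comp => // x _; exact: cvg_lsub.
by apply: open_comp => // x _; exact: cvg_rsub.
Qed.

Lemma within_comp m n (A : set 'rV[R]_m) (B : set 'rV[R]_n) (p : 'rV[R]_m -> 'rV[R]_n)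
    (f : 'rV[R]_n -> R) : continuous p -> (forall x, A x -> B (p x)) ->
  {within B, continuous f} -> {within A, continuous (fun x => f (p x))}.
Proof.
move=> cp AB /subspace_continuousP cf; apply/subspace_continuousP => x Ax.
apply: (cvg_comp p f) (cf _ (AB _ Ax)) => C hC.
have h : nbhs x [set y | B (p y) -> C (p y)] := cp x _ hC.
change (nbhs x [set y | A y -> C (p y)]).
by apply: filterS h => y hy Ay; apply: hy; exact: AB.
Qed.

Lemma lsub_delta (j : 'I_(d1 + d2)) : lsubmx (delta_mx ord0 j : 'rV[R]_(d1 + d2)) =
  if fintype.split j is inl k then delta_mx ord0 k else 0.
Proof.
case: (splitP j) => k jk; apply/rowP => i; rewrite !mxE eqxx /=.
  by rewrite -val_eqE /= jk val_eqE.
case: eqP => // /(congr1 val) /= h; have := ltn_ord i; rewrite h jk.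
by rewrite ltnNge leq_addr.
Qed.

Lemma rsub_delta (j : 'I_(d1 + d2)) : rsubmx (delta_mx ord0 j : 'rV[R]_(d1 + d2)) =
  if fintype.split j is inr k then delta_mx ord0 k else 0.
Proof.
case: (splitP j) => k jk; apply/rowP => i; rewrite !mxE eqxx /=.
  case: eqP => // /(congr1 val) /= h; have := ltn_ord k; rewrite -jk -h.
  by rewrite ltnNge leq_addr.
by rewrite -val_eqE /= jk eqn_add2l val_eqE.
Qed.

(** Coordinate directions of the large space map either to a coordinate direction or to 0,
    as recorded by sel, so the partial derivatives of the composition are those of f or 0. *)
Lemma C1_family_lift m n (p : {linear 'rV[R]_m -> 'rV[R]_n}) (A : set 'rV[R]_m)
    (B : set 'rV[R]_n) (sel : 'I_m -> option 'I_n) (K : R) (f : R -> 'rV[R]_n -> R) :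
  continuous p -> (forall x, A x -> B (p x)) ->
  (forall x, closure A x -> closure B (p x)) ->
  (forall j, p (delta_mx ord0 j) = if sel j is Some k then delta_mx ord0 k else 0) ->
  0 <= K -> C1_family B K f -> C1_family A K (fun t y => f t (p y)).
Proof.
move=> cp AB cAB hsel K0 [[h1 h2 h3] h4].
split; first split.
- by move=> x /cAB; exact: h1.
- by move=> t t0; exact: within_comp cp cAB (h2 t t0).
- by move=> t x t0 /cAB; exact: h3.
have q j t x : (fun h : R => h^-1 * (f t (p (h *: delta_mx ord0 j + x)) - f t (p x))) =
    if sel j is Some k then fun h : R => h^-1 * (f t (h *: delta_mx ord0 k + p x) - f t (p x))
    else fun=> 0.
  apply/funext => h; rewrite linearD linearZ /= hsel; case: (sel j) => [k//|].
  by rewrite scaler0 add0r subrr mulr0.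
have D j t x : 0 <= t -> A x -> derivable (fun y => f t (p y)) x (delta_mx ord0 j) /\
    'D_(delta_mx ord0 j) (fun y => f t (p y)) x =
    if sel j is Some k then pd (f t) [:: k] (p x) else 0.
  move=> t0 Ax; apply: derivable_of_cvg; rewrite q; case: (sel j) => [k|]; last exact: cvg_cst.
  by apply: cvg_of_derivable; apply: (h4 k).1 => //; exact: AB.
move=> j; split; first by move=> t x t0 Ax; exact: (D j t x t0 Ax).1.
apply: (@eq_bounded_family _ _ _ _ (fun t x => if sel j is Some k then pd (f t) [:: k] (p x) else 0)).
  by move=> t x t0 Ax; rewrite -(D j t x t0 Ax).2.
case: (sel j) => [k|]; last first.
  by apply: bounded_family_cst => // t _; rewrite normr0.
have [g1 g2 g3] := (h4 k).2; split.
- by move=> x /AB; exact: g1.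
- by move=> t t0; exact: within_comp cp AB (g2 t t0).
- by move=> t x t0 /AB; exact: g3.
Qed.

Lemma C1_family_lsub K f : 0 <= K -> C1_family Th1 K f ->
  C1_family U K (fun t y => f t (lsubmx y)).
Proof.
move=> K0; apply: (@C1_family_lift _ _ (@lsubmx R 1 d1 d2) U Th1
  (fun j => if fintype.split j is inl k then Some k else None)) => //.
- exact: cvg_lsub.
- by move=> x [].
- by move=> x /closure_prod[].
- by move=> j; apply: (eq_trans (lsub_delta j)); case: fintype.split.
Qed.

Lemma C1_family_rsub K f : 0 <= K -> C1_family Th2 K f ->
  C1_family U K (fun t y => f t (rsubmx y)).
Proof.
move=> K0; apply: (@C1_family_lift _ _ (@rsubmx R 1 d1 d2) U Th2
  (fun j => if fintype.split j is inr k then Some k else None)) => //.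
- exact: cvg_rsub.
- by move=> x [].
- by move=> x /closure_prod[].
- by move=> j; apply: (eq_trans (rsub_delta j)); case: fintype.split.
Qed.

End Lifts.

(** * The weight vector for fixed times *)

Section FixedTimes.
Variables (R : realType) (m : nat) (U : set 'rV[R]_m).
Variables (Sg : R -> 'rV[R]_m -> 'M[R]_2) (g : R -> 'rV[R]_m -> 'I_2 -> R) (K c T : R).
Hypotheses (oU : open U) (K0 : 0 <= K) (c0 : 0 < c) (T0 : 0 <= T).
Hypothesis CSg : forall l k, C1_family U K (fun t y => Sg t y l k).
Hypothesis Cg : forall l, C1_family U K (fun t y => g t y l).
Hypothesis low : forall t y, 0 <= t -> closure U y -> loewner_le c%:M (Sg t y).
Variables (N : nat) (psi : 'I_N -> 'I_2) (lo hi : 'I_N -> R).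
Hypothesis lohi : forall i, [/\ 0 <= lo i, lo i < hi i & hi i <= T].
Hypothesis disj : forall i j t, psi i = psi j -> lo i < t <= hi i ->
  lo j < t <= hi j -> i = j.

Definition cov_at y := cov_of psi lo hi (Sg ^~ y).
Definition drift_at y := dincr psi lo hi (g ^~ y).
(** The weight vector S(sigma)^-1 D(theta) as a function of the joint parameter. *)
Definition solved_at y := solution cov_at drift_at y.

Lemma bounded_family_measurable A (f : R -> 'rV[R]_m -> R) K' y : bounded_family A K' f -> A y ->
  measurable_fun `[(0:R), T]%classic (f ^~ y) /\ forall t, 0 <= t -> `|f t y| <= K'.
Proof.
move=> [h1 h2 h3] Ay; split; last by move=> t t0; exact: h3.
by apply: measurable_funS (h1 y Ay) => //; exact: (@sub_itv0 R _ T).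
Qed.

Lemma bounded_coef_Sg y : closure U y -> bounded_coef T K (Sg ^~ y).
Proof. by move=> Uy l k; exact: (bounded_family_measurable (CSg l k).1 Uy). Qed.

Lemma cov_at_lower y x : closure U y -> c * len_norm2 lo hi x <= bil (cov_at y) x x.
Proof. by move=> Uy; apply: (cov_lower lohi disj x (bounded_coef_Sg Uy)) => t t0; exact: low. Qed.

Lemma cov_at_unit y : closure U y -> cov_at y \in unitmx.
Proof. by move=> Uy; apply: (form_unit lohi c0) => x; exact: cov_at_lower. Qed.

Lemma C1_cov_at i j : C1 U (fun y => cov_at y i j) /\
  forall k y, U y -> pd (fun y => cov_at y i j) [:: k] y =
    cov_of psi lo hi (fun t => \matrix_(a, b) pd (fun z => Sg t z a b) [:: k] y) i j.
Proof.
pose D := `]lo i, hi i]%classic `&` `]lo j, hi j]%classic.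
have sub : D `<=` `[(0:R), T]%classic.
  by move=> t [ti _]; apply: (mul_itv lohi (i := i)).
have mD : measurable D by apply: measurableI.
have e : (fun y => cov_at y i j) = (fun y => \int[lebesgue_measure]_(t in D) Sg t y (psi i) (psi j)).
  by apply/funext => y; rewrite mxE.
rewrite e; have [h1 h2] := C1_param_int oU (CSg (psi i) (psi j)) mD sub.
split=> // k y Uy; rewrite h2// mxE; apply: eq_Rintegral => t _.
by rewrite mxE.
Qed.

Lemma C1_drift_at i : C1 U (fun y => drift_at y i ord0) /\
  forall k y, U y -> pd (fun y => drift_at y i ord0) [:: k] y =
    dincr psi lo hi (fun t a => pd (fun z => g t z a) [:: k] y) i ord0.
Proof.
pose D := `]lo i, hi i]%classic.
have sub : D `<=` `[(0:R), T]%classic by exact: mul_itv.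
have mD : measurable D by exact: measurable_itv.
have e : (fun y => drift_at y i ord0) = (fun y => \int[lebesgue_measure]_(t in D) g t y (psi i)).
  by apply/funext => y; rewrite mxE.
rewrite e; have [h1 h2] := C1_param_int oU (Cg (psi i)) mD sub.
by split=> // k y Uy; rewrite h2// mxE.
Qed.

Lemma C1_solved_at i : C1 U (fun y => solved_at y i ord0).
Proof.
apply: C1_solution => //.
- by move=> k l; exact: (C1_cov_at k l).1.
- by move=> k; exact: (C1_drift_at k).1.
- by move=> y Uy; apply: cov_at_unit; exact: subset_closure.
Qed.

(** A common bound per unit of time for the weighted squared norms of the weight vector and
    of its first derivatives. *)
Definition ubound : R := c ^- 2 * (4 * K ^+ 2 + 16 * K ^+ 4 * c ^- 2).

Lemma drift_at_dual_norm2 y : closure U y -> dual_norm2 lo hi (drift_at y) <= K ^+ 2 * (2 * T).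
Proof.
move=> Uy; apply: (dincr_dual_norm2 lohi disj) => //.
  by move=> l; exact: (bounded_family_measurable (Cg l).1 Uy).1.
by move=> t l t0; exact: (bounded_family_measurable (Cg l).1 Uy).2.
Qed.

Lemma ubound_ge : c ^- 2 * (2 * K ^+ 2) <= ubound.
Proof.
rewrite /ubound ler_wpM2l ?invr_ge0 ?sqr_ge0//.
have h1 := sqr_ge0 K.
have : 0 <= 16 * K ^+ 4 * c ^- 2.
  by rewrite mulr_ge0 ?invr_ge0 ?sqr_ge0// mulr_ge0// exprn_ge0.
lra.
Qed.

Lemma solved_at_norm2_sharp y : closure U y -> len_norm2 lo hi (solved_at y) <= c ^- 2 * (2 * K ^+ 2) * T.
Proof.
move=> Uy; have := inv_norm2 lohi c0 (fun x => cov_at_lower x Uy) (drift_at y).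
move=> h; have := le_trans h (drift_at_dual_norm2 Uy).
rewrite -ler_pdivlMl ?exprn_gt0// => h2; apply: le_trans h2 _.
by rewrite -!mulrA ler_wpM2l ?invr_ge0 ?sqr_ge0//; lra.
Qed.

Lemma solved_at_norm2 y : closure U y -> len_norm2 lo hi (solved_at y) <= ubound * T.
Proof.
by move=> Uy; apply: le_trans (solved_at_norm2_sharp Uy) _; rewrite ler_wpM2r// ubound_ge.
Qed.

Lemma dual_norm2B (x y : 'cV[R]_N) :
  dual_norm2 lo hi (x - y) <= 2 * dual_norm2 lo hi x + 2 * dual_norm2 lo hi y.
Proof.
rewrite /dual_norm2 !mulr_sumr -big_split /=; apply: ler_sum => i _; rewrite !mxE !mulrA -mulrDl.
rewrite ler_wpM2r ?invr_ge0 ?subr_ge0//; first by have [_ /ltW h _] := lohi i.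
have := sqr_ge0 (x i ord0 + y i ord0); rewrite !expr2; lra.
Qed.

(** In S^-1 (D' - S' u) the vectors D' and S' u have dual norm of order T by the uniform
    bounds on the derivatives of the coefficients, and [inv_norm2] takes S^-1 into account. *)
Lemma dsolved_norm2 j y : U y ->
  len_norm2 lo hi (\col_i pd (fun y => solved_at y i ord0) [:: j] y) <= ubound * T.
Proof.
move=> Uy; have cUy := subset_closure Uy.
have -> : \col_i pd (fun y => solved_at y i ord0) [:: j] y = dsolution cov_at drift_at j y.
  apply/colP => i; rewrite mxE.
  apply: (solution_deriv oU _ _ _ j i Uy).2.
  - by move=> k l; exact: (C1_cov_at k l).1.
  - by move=> k; exact: (C1_drift_at k).1.
  - by move=> z Uz; apply: cov_at_unit; exact: subset_closure.
rewrite /dsolution.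
have -> : pd_mx cov_at [:: j] y = cov_of psi lo hi
    (fun t => \matrix_(a, b) pd (fun z => Sg t z a b) [:: j] y).
  by apply/matrixP => k l; rewrite mxE (C1_cov_at k l).2.
have -> : pd_mx drift_at [:: j] y = dincr psi lo hi (fun t a => pd (fun z => g t z a) [:: j] y).
  by apply/colP => k; rewrite mxE (C1_drift_at k).2.
have ok : bounded_coef T K (fun t => \matrix_(a, b) pd (fun z => Sg t z a b) [:: j] y).
  move=> l k; have [h1 h2] := bounded_family_measurable ((CSg l k).2 j).2 Uy.
  split; first by apply: eq_measurable_fun h1 => t _; rewrite mxE.
  by move=> t t0; rewrite mxE; exact: h2.
set dS := cov_of _ _ _ _; set dD := dincr _ _ _ _.
have := inv_norm2 lohi c0 (fun x => cov_at_lower x cUy) (dD - dS *m solved_at y).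
set X := len_norm2 _ _ _ => h1.
have h2 := dual_norm2B dD (dS *m solved_at y).
have h3 : dual_norm2 lo hi dD <= K ^+ 2 * (2 * T).
  apply: (dincr_dual_norm2 lohi disj) => //.
    by move=> l; exact: (bounded_family_measurable ((Cg l).2 j).2 Uy).1.
  by move=> t l t0; exact: (bounded_family_measurable ((Cg l).2 j).2 Uy).2.
have h4 := cov_apply_dual_norm2 lohi disj (solved_at y) K0 ok.
have h5 := ler_wpM2l (sqr_ge0 (2 * K)) (solved_at_norm2_sharp cUy).
have : c ^+ 2 * X <= 2 * (K ^+ 2 * (2 * T)) + 2 * ((2 * K) ^+ 2 * (c ^- 2 * (2 * K ^+ 2) * T)).
  lra.
rewrite -ler_pdivlMl ?exprn_gt0// => h6; apply: le_trans h6 _.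
rewrite /ubound le_eqVlt; apply/orP; left; apply/eqP; field; exact: lt0r_neq0.
Qed.

End FixedTimes.

(** * Moments of weighted noise increments *)

Section GaussianSums.
Context (R : realType) d (Om : measurableType d) (P : probability Om R).
Variables (F : R -> set (set Om)) (W X : R -> Om -> 'cV[R]_2) (x0 : 'cV[R]_2).
Variables (mt : R -> 'cV[R]_2) (gt : R -> 'M[R]_2).
Hypotheses (hF : rc_filtration F) (hW : wiener P F W).
Hypothesis hX : solves_sde P F W x0 mt gt X.
Variables (K c T : R).
Hypotheses (T0 : 0 <= T) (gok : bounded_coef T K gt).
Hypothesis gup : forall t, 0 <= t -> loewner_le (gt t *m (gt t)^T) c%:M.
Variables (N : nat) (psi : 'I_N -> 'I_2) (lo hi : 'I_N -> R).
Hypothesis lohi : forall i, [/\ 0 <= lo i, lo i < hi i & hi i <= T].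
Hypothesis disj : forall i j t, psi i = psi j -> lo i < t <= hi i ->
  lo j < t <= hi j -> i = j.
Local Notation leb := (@lebesgue_measure R).

Definition drift (t : R) : 'cV[R]_2 :=
  \col_l \int[leb]_(s in `[0, t]) mt s l ord0.

Definition noise (i : 'I_N) (o : Om) : R :=
  (X (hi i) o (psi i) ord0 - X (lo i) o (psi i) ord0) -
  (drift (hi i) (psi i) ord0 - drift (lo i) (psi i) ord0).

Let fi (i : 'I_N) (j : 'I_2) (s : R) : R :=
  \1_(`[0, hi i]) s * gt s (psi i) j + (-1) * (\1_(`[0, lo i]) s * gt s (psi i) j).

(** What remains of an increment of X is a difference of two Wiener integrals, up to times
    hi i and lo i. *)
Lemma noise_wiener i : exists2 Q, wiener_int P W T (fi i ord0) (fi i ord_max) Q &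
  {ae P, forall o, noise i o = Q o}.
Proof.
have [h1 h2 h3] := lohi i; have h4 := le_trans h1 (ltW h2).
have [_ _ hx] := hX.
have [Y1 [w1 e1]] := hx _ (psi i) h4.
have [Y2 [w2 e2]] := hx _ (psi i) h1.
have mg t : t <= T -> forall j, measurable_fun `[0%R, t]%classic (fun s => gt s (psi i) j).
  move=> tT j; have [mg _] := gok (psi i) j; apply: measurable_funS mg => //.
  by apply: subset_itvl; rewrite bnd_simp.
have I1 := wiener_int_restrict hF hW h3 (mg _ h3 ord0) (mg _ h3 ord_max) (w1 ord0) (w1 ord_max).
have loT := le_trans (ltW h2) h3.
have I2 := wiener_int_restrict hF hW loT (mg _ loT ord0) (mg _ loT ord_max) (w2 ord0) (w2 ord_max).
exists (fun o => (Y1 ord0 o + Y1 ord_max o) + (-1) * (Y2 ord0 o + Y2 ord_max o)).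
  exact: (wiener_int_lin hF hW (-1) I1 I2).
have S2 (f : 'I_2 -> R) : \sum_j f j = f ord0 + f ord_max.
  rewrite !big_ord_recl big_ord0 addr0; congr (_ + f _); exact/val_inj.
apply: filterS2 e1 e2 => o E1 E2.
by rewrite /noise E1 E2 !mxE !S2; ring.
Qed.

Lemma sum_wiener (v : 'cV[R]_N) : exists2 Q,
  wiener_int P W T (fun s => \sum_i v i ord0 * fi i ord0 s)
    (fun s => \sum_i v i ord0 * fi i ord_max s) Q &
  {ae P, forall o, \sum_i noise i o * v i ord0 = Q o}.
Proof.
suff : forall r : seq 'I_N, exists2 Q,
  wiener_int P W T (fun s => \sum_(i <- r) v i ord0 * fi i ord0 s)
    (fun s => \sum_(i <- r) v i ord0 * fi i ord_max s) Q &
  {ae P, forall o, \sum_(i <- r) noise i o * v i ord0 = Q o} by move=> /(_ (index_enum _)).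
elim=> [|i r [Q IH1 IH2]].
  exists (fun=> 0); last by apply: aeW => o; rewrite big_nil.
  have := wiener_int0 P W T; congr (wiener_int _ _ _ _ _ _);
    by apply/funext => s; rewrite big_nil.
have [Q' h1 h2] := noise_wiener i.
exists (fun o => Q o + v i ord0 * Q' o).
  have := wiener_int_lin hF hW (v i ord0) IH1 h1; congr (wiener_int _ _ _ _ _ _);
    by apply/funext => s; rewrite big_cons addrC.
apply: filterS2 IH2 h2 => o E1 E2.
by rewrite big_cons E1 E2 addrC mulrC.
Qed.

(** The integrand of the weighted sum of noise increments is the step function of the
    weights times the diffusion coefficient. *)
Lemma sum_fi (v : 'cV[R]_N) j s : 0 <= s ->
  \sum_i v i ord0 * fi i j s = \sum_l stepv psi lo hi v s l * gt s l j.
Proof.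
move=> s0.
transitivity (\sum_i \sum_l (psi i == l)%:R * (v i ord0 * itv_ind lo hi i s) * gt s l j).
  apply: eq_bigr => i _; rewrite (bigD1 (psi i))//= big1 ?addr0; last first.
    by move=> l; rewrite eq_sym => /negbTE ->; rewrite !mul0r.
  rewrite eqxx mul1r -mulrA; congr (_ * _).
  rewrite /fi mulN1r -mulrBl; congr (_ * _).
  have [h1 h2 h3] := lohi i.
  rewrite /itv_ind !indicE.
  have e (a : R) : (s \in `[(0:R), a]%classic) = (s <= a).
    by apply/idP/idP => [/set_mem|h]; [|apply/mem_set]; rewrite /= in_itv /= s0.
  have -> : (s \in `]lo i, hi i]%classic) = (lo i < s) && (s <= hi i).
    by apply/idP/idP => [/set_mem|h]; [|apply/mem_set]; rewrite /= in_itv.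
  rewrite !e; case: (leP s (lo i)) => /= h.
    by rewrite (le_trans h (ltW h2)) subrr.
  by rewrite subr0.
by rewrite exchange_big /=; apply: eq_bigr => l _; rewrite /stepv mulr_suml.
Qed.

(** The bound on the diffusion matrix is applied at each time to the step function, so the
    variance of the weighted sum is at most c times the weighted squared norm. *)
Lemma gauss_var (v : 'cV[R]_N) :
  (\int[leb]_(s in `[0%R, T]) ((\sum_i v i ord0 * fi i ord0 s) ^+ 2 +
     (\sum_i v i ord0 * fi i ord_max s) ^+ 2)%:E <= (c * len_norm2 lo hi v)%:E)%E.
Proof.
have [h1 h2] := integral_stepv_norm lohi disj v.
have mI : measurable `[(0:R), T]%classic by [].
have h3 := integrableZ c mI h1.
have -> : (c * len_norm2 lo hi v)%:E =
    (\int[leb]_(s in `[0%R, T]) (c * \sum_l stepv psi lo hi v s l ^+ 2)%:E)%E.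
  rewrite -h2 -RintegralZl// /Rintegral fineK//.
  by apply: (@integrable_fin_num _ _ _ leb); [exact: measurable_itv|exact: h3].
have mf j : measurable_fun `[(0:R), T]%classic (fun s => \sum_i v i ord0 * fi i j s).
  apply: (@eq_measurable_fun _ _ _ _ _ (fun s => \sum_l stepv psi lo hi v s l * gt s l j)).
    by move=> s; rewrite inE /= in_itv /= => /andP[s0 _]; rewrite sum_fi.
  apply: measurable_sum => l; apply: measurable_funM; first exact: measurable_stepv.
  exact: (gok l j).1.
apply: ge0_le_integral => //.
- by move=> s _; rewrite lee_fin addr_ge0// sqr_ge0.
- apply/measurable_EFinP; apply: measurable_funD; apply: measurable_funX; exact: mf.
- exact: (measurable_int leb h3).
move=> s /=; rewrite in_itv /= => /andP[s0 _]; rewrite lee_fin !sum_fi//.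
have := gup s0 (\col_l stepv psi lo hi v s l).
rewrite -!/(bil _ _ _) form_scalar form_colE; apply: le_trans.
rewrite le_eqVlt; apply/orP; left; apply/eqP.
rewrite !big_ord_recl !big_ord0 !addr0 !mxE !big_ord_recl !big_ord0 !addr0 !mxE.
rewrite (_ : ord_max = lift ord0 ord0); last exact/val_inj.
ring.
Qed.

Lemma noise_Fmeas i : Fmeas F T (noise i).
Proof.
have [h1 h2 h3] := lohi i; have h4 := le_trans h1 (ltW h2).
have [aX _ _] := hX.
have mX t : 0 <= t -> t <= T -> Fmeas F T (fun o => X t o (psi i) ord0).
  move=> t0 tT; apply: (Fmeas_mono hF t0 tT) => A mA; exact: aX.
have m1 := (FmeasE hF _ T0).1 (mX _ h4 h3).
have m2 := (FmeasE hF _ T0).1 (mX _ h1 (le_trans (ltW h2) h3)).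
by apply/(FmeasE hF _ T0); apply: measurable_funB => //; exact: measurable_funB.
Qed.

(** The constant of [moment_of_mgf] with the factor 2 of [mgf_wiener_int] included. *)
Definition gauss_const q : R := 2 * (2 * q)`!%:R * expR (1 / 2) * 2 ^+ q.

Lemma gauss_moment (v : 'cV[R]_N) (B : R) q : 0 < B -> c * len_norm2 lo hi v <= B ->
  (\int[P]_o ((\sum_i noise i o * v i ord0) ^+ (2 * q))%:E <=
   (gauss_const q * B ^+ q)%:E)%E.
Proof.
move=> B0 cB; have [Q wQ aQ] := sum_wiener v.
have mQ : measurable_fun setT Q by case: wQ.
have hm l : (\int[P]_w (expR (l * Q w))%:E <= (expR (l ^+ 2 * (2 * B) / 2))%:E)%E.
  apply: (mgf_wiener_int hF hW l wQ); apply: le_trans (gauss_var v) _.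
  by rewrite lee_fin.
have B20 : 0 < 2 * B by rewrite mulr_gt0.
have := moment_of_mgf q B20 mQ hm.
rewrite /gauss_const -[_ * 2 ^+ q * _]mulrA -exprMn; apply: le_trans.
rewrite le_eqVlt; apply/orP; left; apply/eqP.
have mZ i : measurable_fun setT (noise i) by exact: (Fmeas_measurable hF T0 (noise_Fmeas i)).
apply: ae_eq_integral => //.
- apply/measurable_EFinP; apply: measurable_funX; apply: measurable_sum => i.
  by apply: measurable_funM.
- by apply/measurable_EFinP; apply: measurable_funX.
- by apply: filterS aQ => o e _; rewrite e.
Qed.

End GaussianSums.

(** * Supremum of the cross term for fixed times *)

Section FixedSup.
Context (R : realType) d (Om : measurableType d) (P : probability Om R).
Variables (F : R -> set (set Om)) (W X : R -> Om -> 'cV[R]_2) (x0 : 'cV[R]_2).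
Variables (mt : R -> 'cV[R]_2) (gt : R -> 'M[R]_2).
Hypotheses (hF : rc_filtration F) (hW : wiener P F W).
Hypothesis hX : solves_sde P F W x0 mt gt X.
Variables (m : nat) (U : set 'rV[R]_m).
Variables (Sg : R -> 'rV[R]_m -> 'M[R]_2) (g : R -> 'rV[R]_m -> 'I_2 -> R).
Variables (K c1 c2 r : R) (q : nat).
Hypotheses (oU : open U) (sU : sobolev U) (Ur : forall y, U y -> forall j, `|y ord0 j| <= r).
Hypotheses (m0 : (0 < m)%N) (mq : (m < 2 * q)%N) (r0 : 0 < r).
Hypotheses (K0 : 0 <= K) (c10 : 0 < c1) (c20 : 0 < c2).
Hypothesis CSg : forall l k, C1_family U K (fun t y => Sg t y l k).
Hypothesis Cg : forall l, C1_family U K (fun t y => g t y l).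
Hypothesis low : forall t y, 0 <= t -> closure U y -> loewner_le c1%:M (Sg t y).
Hypothesis gok : forall T, bounded_coef T K gt.
Hypothesis gup : forall t, 0 <= t -> loewner_le (gt t *m (gt t)^T) c2%:M.

(** The constant C depends neither on the horizon nor on the number and position of the
    intervals.  The exceptional event has to belong to F T, for that is the sigma-algebra of
    which random times are independent; therefore [sobolev_prob] is applied on the sample
    space equipped with F T alone, to the image of P under the identity. *)
Lemma fixed_sup : exists2 C : R, 0 < C & forall (T eta : R) (N : nat) (psi : 'I_N -> 'I_2)
    (lo hi : 'I_N -> R),
  0 < T -> 0 < eta ->
  (forall i, [/\ 0 <= lo i, lo i < hi i & hi i <= T]) ->
  (forall i j t, psi i = psi j -> lo i < t <= hi i -> lo j < t <= hi j -> i = j) ->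
  exists A : set Om, [/\ F T A, (P A <= (C / (eta ^+ (2 * q) * T ^+ q))%:E)%E &
    forall w, ~ A w -> forall y, U y ->
      `|\sum_i noise X mt psi lo hi i w * solved_at Sg g psi lo hi y i ord0| <= eta * T].
Proof.
have [C C0 hC] := sobolev_prob m0 mq r0 oU sU Ur.
(* a positive variance bound per unit of time for the cross term and its derivatives *)
pose V := c2 * (ubound K c1 + 1).
have ub0 : 0 <= ubound K c1.
  rewrite /ubound mulr_ge0 ?invr_ge0 ?sqr_ge0// addr_ge0// ?mulr_ge0 ?sqr_ge0//.
  by rewrite invr_ge0 sqr_ge0.
have V0 : 0 < V by rewrite mulr_gt0// ltr_wpDl.
have g0 : 0 < gauss_const R q.
  by rewrite /gauss_const !mulr_gt0 ?expR_gt0 ?exprn_gt0// ltr0n fact_gt0.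
exists (C * (gauss_const R q * V ^+ q)); first by rewrite !mulr_gt0// exprn_gt0.
move=> T eta N psi lo hi T0 eta0 lohi disj.
have T0' := ltW T0.
pose T' := g_sigma_algebraType (F T).
have mid : measurable_fun setT (id : Om -> T').
  move=> _ B; rewrite setTI /measurable /= (F_gE hF)// => FB.
  exact: (F_measurable hF T0').
pose idm : {mfun Om >-> T'} := HB.pack_for {mfun Om >-> T'} (id : Om -> T')
  (@isMeasurableFun.Build _ _ Om T' id mid).
pose P' := distribution P idm.
pose Z i : T' -> R := noise X mt psi lo hi i.
have FZ i : Fmeas F T (noise X mt psi lo hi i).
  exact: (noise_Fmeas hF hX T0').
have mZ i : measurable_fun setT (Z i) by exact: (FmeasE hF _ T0').1.
pose B := V * T.
have B0 : 0 < B by rewrite mulr_gt0.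
have mom (v : 'cV[R]_N) : len_norm2 lo hi v <= ubound K c1 * T ->
    (\int[P']_w ((\sum_i Z i w * v i ord0) ^+ (2 * q))%:E <=
      (gauss_const R q * B ^+ q)%:E)%E.
  move=> hv; rewrite /P' /distribution ge0_integral_pushforward//.
  - rewrite preimage_setT.
    have hB : c2 * len_norm2 lo hi v <= B.
      rewrite /B /V -mulrA ler_wpM2l// ?(ltW c20)//; apply: le_trans hv _.
      by rewrite ler_wpM2r// lerDl.
    have h := gauss_moment hF hW hX T0' (@gok T) gup lohi disj q B0 hB.
    apply: le_trans h; rewrite le_eqVlt; apply/orP; left; apply/eqP.
    by apply: eq_integral => w _.
  - apply/measurable_EFinP; apply: measurable_funX; apply: measurable_sum => i.
    by apply: measurable_funM.
  - by move=> w _; rewrite lee_fin mulnC exprM sqr_ge0.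
have Cu i := C1_solved_at oU c10 CSg Cg low lohi disj i.
have [||||A [mA PA hA]] := hC _ T' P' N Z (fun i y => solved_at Sg g psi lo hi y i ord0)
  (gauss_const R q * B ^+ q) (eta * T) mZ Cu.
- by rewrite mulr_ge0 ?exprn_ge0 ?ltW.
- by rewrite mulr_gt0.
- move=> y Uy; apply: mom; apply: (solved_at_norm2 K0 c10 T0' CSg Cg low lohi disj).
  exact: subset_closure.
- move=> y j Uy.
  have := mom (\col_i pd (fun y => solved_at Sg g psi lo hi y i ord0) [:: j] y).
  under eq_integral do under eq_bigr do rewrite mxE.
  by apply; exact: (dsolved_norm2 oU K0 c10 T0' CSg Cg low lohi disj).
exists A; split => //.
- by move: mA; rewrite /measurable /= (F_gE hF).
- apply: le_trans PA _; rewrite lee_fin le_eqVlt; apply/orP; left; apply/eqP.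
  rewrite /B !exprMn mul2n -addnn !exprD.
  have e0 : eta ^+ q != 0 by rewrite expf_neq0// gt_eqF.
  have t0 : T ^+ q != 0 by rewrite expf_neq0// gt_eqF.
  move: (eta ^+ q) (T ^+ q) (V ^+ q) e0 t0 => a b v a0 b0.
  by field; rewrite a0 b0.
Qed.

End FixedSup.

(** * Realizations of the observation times *)

Section Configurations.
Variables (R : realType) (T : R).
Implicit Types (tau : 'I_2 -> nat -> R) (m : 'I_2 -> nat).

(** Past its last index the sequence of times stays at the horizon, so that the sequence
    alone determines the number of observations ([valid_times_uniq]). *)
Definition valid_times tau m := forall l, [/\ (0 < m l)%N, tau l 0%N = 0,
  forall i, (i < m l)%N -> tau l i < tau l i.+1 & forall i, (m l <= i)%N -> tau l i = T].

Definition left_time tau m (i : 'I_(m ord0 + m ord_max)) := tau (psi i) (phi i).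
Definition right_time tau m (i : 'I_(m ord0 + m ord_max)) := tau (psi i) (phi i).+1.

Lemma I2_cases (l : 'I_2) : l = ord0 \/ l = ord_max.
Proof. by case: l => [[|[|//]] h]; [left|right]; exact/val_inj. Qed.

Lemma phi_lt m (i : 'I_(m ord0 + m ord_max)) : (phi i < m (psi i))%N.
Proof. by rewrite /phi /psi; case: fintype.split => j. Qed.

Lemma psi_phi_inj m (i j : 'I_(m ord0 + m ord_max)) :
  psi i = psi j -> phi i = phi j -> i = j.
Proof.
rewrite /psi /phi => h1 h2; apply: (can_inj (@splitK _ _)).
case: fintype.split h1 h2 => a; case: fintype.split => b //= _ h; congr (_ _); exact/val_inj.
Qed.

Lemma psi_phi_onto m l k : (k < m l)%N ->
  exists i : 'I_(m ord0 + m ord_max), psi i = l /\ phi i = k.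
Proof.
case: (I2_cases l) => -> h.
  by exists (unsplit (inl (Ordinal h))); rewrite /psi /phi unsplitK.
by exists (unsplit (inr (Ordinal h))); rewrite /psi /phi unsplitK.
Qed.

Section Valid.
Variables (tau : 'I_2 -> nat -> R) (m : 'I_2 -> nat).
Hypothesis v : valid_times tau m.

Lemma valid_times_le l i j : (i <= j)%N -> tau l i <= tau l j.
Proof.
have [_ _ h1 h2] := v l.
elim: j => [|j IH]; first by rewrite leqn0 => /eqP ->.
rewrite leq_eqVlt => /orP[/eqP -> //|]; rewrite ltnS => /IH h; apply: le_trans h _.
by case: (ltnP j (m l)) => k; [exact/ltW/h1|rewrite !h2// leqW].
Qed.

Lemma valid_times_ge0 l i : 0 <= tau l i.
Proof. by have [_ <- _ _] := v l; exact: valid_times_le. Qed.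

Lemma valid_times_leT l i : tau l i <= T.
Proof.
have [_ _ _ h] := v l; case: (leqP i (m l)) => im; last by rewrite h// ltnW.
by rewrite -(h (m l))//; exact: valid_times_le.
Qed.

Lemma valid_times_lohi (i : 'I_(m ord0 + m ord_max)) :
  [/\ 0 <= left_time tau i, left_time tau i < right_time tau i & right_time tau i <= T].
Proof.
split; [exact: valid_times_ge0| |exact: valid_times_leT].
by have [_ _ h _] := v (psi i); exact: (h _ (phi_lt i)).
Qed.

Lemma valid_times_disj (i j : 'I_(m ord0 + m ord_max)) t : psi i = psi j ->
  left_time tau i < t <= right_time tau i -> left_time tau j < t <= right_time tau j -> i = j.
Proof.
move=> ij; rewrite /left_time /right_time ij => /andP[h1 h2] /andP[h3 h4].
apply: psi_phi_inj => //; case: (ltngtP (phi i) (phi j)) => // h.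
  by have := le_lt_trans (le_trans h2 (valid_times_le _ h)) h3; rewrite ltxx.
by have := le_lt_trans (le_trans h4 (valid_times_le _ h)) h1; rewrite ltxx.
Qed.

(** The interval containing t ends at the first observation time not before t. *)
Lemma valid_times_cover l t : 0 < t <= T ->
  exists2 i : 'I_(m ord0 + m ord_max), psi i = l & left_time tau i < t <= right_time tau i.
Proof.
move=> /andP[t0 tT]; have [m0 h0 h1 h2] := v l.
have ex : exists k, t <= tau l k by exists (m l); rewrite h2.
case: (ex_minnP ex) => -[|k] tk kmin; first by rewrite h0 leNgt t0 in tk.
have kt : tau l k < t by rewrite ltNge; apply/negP => /kmin; rewrite ltnn.
have km : (k < m l)%N.
  by rewrite ltnNge; apply/negP => mk; move: kt; rewrite h2// ltNge tT.
have [i [il ik]] := psi_phi_onto km.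
by exists i => //; rewrite /left_time /right_time il ik kt.
Qed.

End Valid.

Lemma valid_times_uniq tau m m' : valid_times tau m -> valid_times tau m' -> m = m'.
Proof.
suff h a b l : valid_times tau a -> valid_times tau b -> (a l <= b l)%N.
  by move=> v v'; apply/funext => l; apply/eqP; rewrite eqn_leq !h.
move=> va vb; rewrite leqNgt; apply/negP => ba.
have [_ _ h1 _] := va l; have [_ _ _ h2] := vb l.
by have := h1 _ ba; rewrite !h2// ?ltxx.
Qed.

End Configurations.

(** * Continuity of the cross term in the times *)

Section Convergence.
Context (R : realType) d (Om : measurableType d).
Variables (X : R -> Om -> 'cV[R]_2) (mt : R -> 'cV[R]_2).
Variables (m : nat) (U : set 'rV[R]_m).
Variables (Sg : R -> 'rV[R]_m -> 'M[R]_2) (g : R -> 'rV[R]_m -> 'I_2 -> R).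
Variables (K c T : R).
Hypotheses (K0 : 0 <= K) (c0 : 0 < c) (T0 : 0 <= T).
Hypothesis CSg : forall l k, C1_family U K (fun t y => Sg t y l k).
Hypothesis Cg : forall l, C1_family U K (fun t y => g t y l).
Hypothesis low : forall t y, 0 <= t -> closure U y -> loewner_le c%:M (Sg t y).
Hypothesis mok : forall l, measurable_fun `[(0:R), +oo[%classic (fun t => mt t l ord0) /\
  forall t, 0 <= t -> `|mt t l ord0| <= K.
Variable w : Om.
Hypothesis cX : {within [set t | 0 <= t], continuous (X ^~ w)}.
Local Notation leb := (@lebesgue_measure R).

(** For half-open intervals whose endpoints converge from the right, the indicators converge
    at every point, the endpoints included. *)
Lemma cvg_ind_oc (a b : R) (ak bk : nat -> R) : (forall k, a <= ak k) ->
  (forall k, b <= bk k) -> ak k @[k --> \oo] --> a -> bk k @[k --> \oo] --> b ->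
  forall t, \1_(`]ak k, bk k]%classic) t @[k --> \oo] --> (\1_(`]a, b]%classic) t : R).
Proof.
move=> ha hb ca cb t.
have e (x y : R) : (t \in `]x, y]%classic) = (x < t) && (t <= y).
  by apply/idP/idP => [/set_mem|h]; [|apply/mem_set]; rewrite /= in_itv.
under eq_fun do rewrite indicE e.
rewrite indicE e; apply: cvg_near_cst.
case: (leP t a) => ta /=.
  by apply: nearW => k; rewrite ltNge (le_trans ta (ha k)).
have n1 : \forall k \near \oo, ak k < t by exact: (cvgr_lt _ ca).
case: (leP t b) => tb /=.
  by apply: filterS n1 => k ->; rewrite (le_trans tb (hb k)).
have n2 : \forall k \near \oo, bk k < t by exact: (cvgr_lt _ cb).
by apply: filterS2 n1 n2 => k _; rewrite ltNge => /negbTE ->; rewrite andbF.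
Qed.

Lemma drift_cvg (b : R) (bk : nat -> R) l : 0 <= b -> b <= T -> (forall k, b <= bk k <= T) ->
  bk k @[k --> \oo] --> b -> drift mt (bk k) l ord0 @[k --> \oo] --> drift mt b l ord0.
Proof.
move=> b0 bT hb cb; rewrite mxE; under eq_fun do rewrite mxE.
have [mm bm] := mok l.
have bf : bounded_family (setT : set 'rV[R]_m) K (fun t _ => mt t l ord0) by exact: bounded_family_cst.
have sub x : x <= T -> `[(0:R), x]%classic `<=` `[(0:R), T]%classic.
  by move=> xT; apply: subset_itvl; rewrite bnd_simp.
apply: (param_int_cvg (x := 0) (u := fun=> 0) (T := T) bf) => //.
- exact: cvg_cst.
- exact: sub.
- by move=> k; apply: sub; case/andP: (hb k).
move=> t.
have e (y : R) : (t \in `[0, y]%classic) = (0 <= t) && (t <= y).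
  by apply/idP/idP => [/set_mem|h]; [|apply/mem_set]; rewrite /= in_itv.
under eq_fun do rewrite indicE e.
rewrite indicE e; apply: cvg_near_cst.
case: (leP 0 t) => t0 /=; last exact: nearW.
case: (leP t b) => tb /=.
  by apply: nearW => k; rewrite (le_trans tb)//; case/andP: (hb k).
have n2 : \forall k \near \oo, bk k < t by exact: (cvgr_lt _ cb).
by apply: filterS n2 => k; rewrite ltNge => /negbTE ->.
Qed.

Lemma path_cvg (b : R) (bk : nat -> R) l : 0 <= b -> (forall k, b <= bk k) ->
  bk k @[k --> \oo] --> b -> X (bk k) w l ord0 @[k --> \oo] --> X b w l ord0.
Proof.
move=> b0 hb cb; have /subspace_continuousP/(_ b b0) := cX => h.
have cxb : X (bk k) w @[k --> \oo] --> X b w.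
  apply: (cvg_comp bk (X ^~ w)) h => B hB; have := cb _ hB; rewrite /nbhs /=.
  by apply: filterS => k; apply; rewrite /= (le_trans b0).
exact: (cvg_comp _ (fun M : 'cV[R]_2 => M l ord0) cxb (@coord_continuous _ _ _ l ord0 (X b w))).
Qed.

Variables (N : nat) (psi : 'I_N -> 'I_2) (lo hi : 'I_N -> R) (lok hik : nat -> 'I_N -> R).
Hypothesis lohi : forall i, [/\ 0 <= lo i, lo i < hi i & hi i <= T].
Hypothesis disj : forall i j t, psi i = psi j -> lo i < t <= hi i ->
  lo j < t <= hi j -> i = j.
Hypothesis lohik : forall k i, [/\ 0 <= lok k i, lok k i < hik k i & hik k i <= T].
Hypothesis ge_lo : forall k i, lo i <= lok k i.
Hypothesis ge_hi : forall k i, hi i <= hik k i.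
Hypothesis clo : forall i, lok k i @[k --> \oo] --> lo i.
Hypothesis chi : forall i, hik k i @[k --> \oo] --> hi i.

(** Let the times converge from the right.  The paths converge by continuity, the
    covariance and the drift increments by dominated convergence, and the inverse because
    the limiting covariance is invertible. *)
Lemma sum_cvg (y : 'rV[R]_m) (yk : nat -> 'rV[R]_m) : closure U y ->
  (forall k, closure U (yk k)) -> yk k @[k --> \oo] --> y ->
  \sum_i noise X mt psi (lok k) (hik k) i w * solved_at Sg g psi (lok k) (hik k) (yk k) i ord0
    @[k --> \oo] -->
  \sum_i noise X mt psi lo hi i w * solved_at Sg g psi lo hi y i ord0.
Proof.
move=> Uy Uyk cy.
have cu : mx_cvg (F := \oo) (fun k => solved_at Sg g psi (lok k) (hik k) (yk k)) (solved_at Sg g psi lo hi y).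
  apply: mx_cvg_mul.
    apply: mx_cvg_inv; last exact: (cov_at_unit c0 CSg low lohi disj).
    move=> i j; rewrite /cov_at mxE; under eq_fun do rewrite mxE.
    apply: (param_int_cvg (T := T) (CSg (psi i) (psi j)).1) => //.
    - by apply: measurableI.
    - by move=> t [h _]; exact: (mul_itv lohi h).
    - by move=> k; apply: measurableI.
    - by move=> k t [h _]; exact: (mul_itv (lohik k) h).
    move=> t; rewrite indicI; under eq_fun do rewrite indicI.
    by apply: cvgM; apply: cvg_ind_oc => // k.
  move=> i j; rewrite /drift_at mxE; under eq_fun do rewrite mxE.
  apply: (param_int_cvg (T := T) (Cg (psi i)).1) => //.
  - exact: mul_itv.
  - by move=> k; exact: (mul_itv (lohik k)).
  by apply: cvg_ind_oc => // k.
apply: cvg_sumr => i; apply: cvgM; last exact: cu.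
have [h1 h2 h3] := lohi i; have h4 := le_trans h1 (ltW h2).
rewrite /noise; apply: cvgB; apply: cvgB.
- by apply: path_cvg.
- by apply: path_cvg.
- apply: drift_cvg => // k; rewrite ge_hi /=; by have [] := lohik k i.
- apply: drift_cvg => //; first exact: le_trans (ltW h2) h3.
  move=> k; rewrite ge_lo /=; have [_ h5 h6] := lohik k i; exact: le_trans (ltW h5) h6.
Qed.

End Convergence.

(** * Independent selection among events *)

Section Decoupling.
Context (R : realType) d (Om : measurableType d) (P : probability Om R).

(** Summing over the finitely many values of the selector, independence makes each term the
    product of the probability of that value and at most c. *)
Lemma decouple (G H : set (set Om)) (I : finType) (kappa : Om -> I)
    (B : I -> set Om) (c : R) : 0 <= c -> indep P G H ->
  (forall i, G (kappa @^-1` [set i])) -> (forall i, measurable (kappa @^-1` [set i])) ->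
  (forall i, H (B i)) -> (forall i, measurable (B i)) -> (forall i, P (B i) <= c%:E)%E ->
  measurable [set w | B (kappa w) w] /\ (P [set w | B (kappa w) w] <= c%:E)%E.
Proof.
move=> c0 iGH GC mC HB mB PB.
have fI : finite_set [set: I] by exact: finite_finset.
have -> : [set w | B (kappa w) w] = \bigcup_(i in [set: I]) (kappa @^-1` [set i] `&` B i).
  by apply/seteqP; split => [w Bw|w [i _ [<- //]]]; exists (kappa w).
have mCB i : measurable (kappa @^-1` [set i] `&` B i) by exact: measurableI.
have tC : trivIset [set: I] (fun i => kappa @^-1` [set i]).
  by move=> i j _ _ [w [<- <-]].
split; first by apply: fin_bigcup_measurable.
rewrite measure_fin_bigcup//; last first.
  by move=> i j _ _ [w [[<- _] [<- _]]].
apply: (@le_trans _ _ (\sum_(i \in [set: I]) (P (kappa @^-1` [set i]) * c%:E))%E).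
  apply: lee_fsum => // i _.
  apply: (@le_trans _ _ (P (kappa @^-1` [set i]) * P (B i))%E).
    by rewrite le_eqVlt; apply/orP; left; apply/eqP; exact: iGH.
  by apply: lee_wpmul2l => //; exact: PB.
rewrite -ge0_mule_fsuml// -measure_fin_bigcup//.
apply: (@le_trans _ _ (1 * c%:E)%E); last by rewrite mul1e.
by apply: lee_wpmul2r; rewrite ?lee_fin//; exact: probability_le1 (fin_bigcup_measurable _ _).
Qed.

(** The set of points that belong to all but finitely many A k is an increasing union of
    intersections, each of probability at most c. *)
Lemma liminf_le (A : nat -> set Om) (c : R) : (forall k, measurable (A k)) ->
  (forall k, P (A k) <= c%:E)%E ->
  exists L : set Om, [/\ measurable L, (P L <= c%:E)%E &
    forall w, (\forall k \near \oo, A k w) -> L w].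
Proof.
move=> mA PA; pose B j := \bigcap_(k in [set k | (j <= k)%N]) A k.
have mB j : measurable (B j).
  by apply: bigcap_measurable => // ; exists j => /=.
have mL : measurable (\bigcup_j B j) by apply: bigcup_measurable.
exists (\bigcup_j B j); split => //.
  have cB : (P \o B) x @[x --> \oo] --> P (\bigcup_j B j).
    apply: nondecreasing_cvg_mu => // i j ij; apply/subsetPset => w Bw k /= jk.
    by apply: Bw => /=; exact: leq_trans jk.
  rewrite -(cvg_lim _ cB)//; apply: lime_le; first by apply/cvg_ex; exists (P (\bigcup_j B j)).
  apply: nearW => k; apply: le_trans (PA k); apply: le_measure; rewrite ?inE//.
  by move=> w; apply => /=.
Qed.

End Decoupling.

(** * Rounding times up to a grid *)

Section Rounding.
Variables (R : realType) (T : R) (N : nat).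
Hypotheses (T0 : 0 < T).
Let dl : R := T / N.+1%:R.

Lemma dl_gt0 : 0 < dl. Proof. by rewrite divr_gt0// ltr0n. Qed.

(** Cell number a consists of the times rounded up to a dl.  Cell 0 contains the time 0, and
    N + 2 cells reach the horizon. *)
Definition cell (a : nat) : set R := `](a%:R - 1) * dl, a%:R * dl].

Lemma cell_ex s : 0 <= s <= T -> exists a : 'I_N.+2, cell a s.
Proof.
move=> /andP[s0 sT].
have NT : N.+1%:R * dl = T by rewrite /dl mulrCA divff ?mulr1// pnatr_eq0.
have ex : exists a : nat, s <= a%:R * dl by exists N.+1; rewrite NT.
case: (ex_minnP ex) => a sa amin.
have aN : (a < N.+2)%N by rewrite ltnS; apply: amin; rewrite NT.
exists (Ordinal aN); rewrite /cell /= in_itv /= sa andbT.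
case: a sa amin aN => [|a] sa amin aN.
  by rewrite sub0r mulN1r (lt_le_trans _ s0)// oppr_lt0 dl_gt0.
rewrite -natr1 addrK ltNge; apply/negP => h.
by have := amin a h; rewrite ltnn.
Qed.

Lemma cell_inj s a b : cell a s -> cell b s -> a = b.
Proof.
have d0 := dl_gt0.
suff h x y : (x < y)%N -> cell x s -> cell y s -> False.
  by move=> ha hb; case: (ltngtP a b) => // ab; [case: (h _ _ ab ha hb)|case: (h _ _ ab hb ha)].
move=> xy; rewrite /cell /= !in_itv /= => /andP[_ h1] /andP[h2 _].
have := lt_le_trans h2 h1; rewrite ltr_pM2r// ltrBlDr natr1 ltr_nat.
by rewrite ltnS leqNgt xy.
Qed.

Definition cell_index (s : R) : 'I_N.+2 := xget ord0 [set a | cell (a : 'I_N.+2) s].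

Lemma cell_indexP s : 0 <= s <= T -> cell (cell_index s) s.
Proof. by move=> /cell_ex[a ha]; rewrite /cell_index; case: xgetP => [x -> //|/(_ a)]. Qed.

Lemma cell_indexE s a : 0 <= s <= T -> (cell_index s = a) <-> cell a s.
Proof.
move=> sT; split => [<-|h]; first exact: cell_indexP.
by apply/val_inj; exact: (cell_inj (cell_indexP sT) h).
Qed.

Definition grid (a : nat) : R := a%:R * dl.

Lemma grid_cell_index s : 0 <= s <= T -> s <= grid (cell_index s) < s + dl.
Proof.
move=> /cell_indexP; rewrite /cell /= in_itv /= => /andP[h ->] /=.
by move: h; rewrite mulrBl mul1r ltrBlDr.
Qed.

Lemma grid_leT (a : 'I_N.+2) : grid a <= T.
Proof.
have NT : N.+1%:R * dl = T by rewrite /dl mulrCA divff ?mulr1// pnatr_eq0.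
by rewrite -[leRHS]NT /grid ler_pM2r ?dl_gt0// ler_nat -ltnS.
Qed.

Lemma cell_index0 : grid (cell_index 0) = 0.
Proof.
have -> : cell_index 0 = ord0; last by rewrite /grid mul0r.
apply/cell_indexE; first by rewrite lexx ltW.
by rewrite /cell /= in_itv /= mul0r lexx sub0r mulN1r oppr_lt0 dl_gt0.
Qed.

Lemma cell_indexT : grid (cell_index T) = T.
Proof.
apply/eqP; rewrite eq_le grid_leT /=.
have TT : 0 <= T <= T by rewrite lexx ltW.
by have /andP[] := grid_cell_index TT.
Qed.

End Rounding.

(** * Supremum of the cross term for random times *)

Section RandomTimes.
Context (R : realType) d (Om : measurableType d) (P : probability Om R).
Variables (F : R -> set (set Om)).
Hypothesis hF : rc_filtration F.
Variables (X : R -> Om -> 'cV[R]_2) (mt : R -> 'cV[R]_2).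
Variables (m : nat) (U : set 'rV[R]_m).
Variables (Sg : R -> 'rV[R]_m -> 'M[R]_2) (g : R -> 'rV[R]_m -> 'I_2 -> R).
Variables (K c1 T : R).
Hypotheses (K0 : 0 <= K) (c10 : 0 < c1) (T0 : 0 < T).
Hypothesis CSg : forall l k, C1_family U K (fun t y => Sg t y l k).
Hypothesis Cg : forall l, C1_family U K (fun t y => g t y l).
Hypothesis low : forall t y, 0 <= t -> closure U y -> loewner_le c1%:M (Sg t y).
Hypothesis mok : forall l, measurable_fun `[(0:R), +oo[%classic (fun t => mt t l ord0) /\
  forall t, 0 <= t -> `|mt t l ord0| <= K.

(** The product Z^T S^-1 D at the joint parameter y, for a realization tau of the times. *)
Definition cross_term (tau : 'I_2 -> nat -> R) (M : 'I_2 -> nat) (w : Om) (y : 'rV[R]_m) : R :=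
  \sum_i noise X mt (@psi M) (@left_time R tau M) (@right_time R tau M) i w *
     solved_at Sg g (@psi M) (@left_time R tau M) (@right_time R tau M) y i ord0.

Variables (b c : R).
Hypothesis c0 : 0 <= c.
Hypothesis fixed : forall (N : nat) (psi : 'I_N -> 'I_2) (lo hi : 'I_N -> R),
  (forall i, [/\ 0 <= lo i, lo i < hi i & hi i <= T]) ->
  (forall i j t, psi i = psi j -> lo i < t <= hi i -> lo j < t <= hi j -> i = j) ->
  exists A : set Om, [/\ F T A, (P A <= c%:E)%E &
    forall w, ~ A w -> forall y, U y ->
      `|\sum_i noise X mt psi lo hi i w * solved_at Sg g psi lo hi y i ord0| <= b].

(** One event serves for the whole time sequence tau, since tau determines the number of
    observations; sequences that are no realization get the empty event. *)
Lemma exceptional_set tau : exists A : set Om, [/\ F T A, (P A <= c%:E)%E &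
  forall M, valid_times T tau M -> forall w, ~ A w -> forall y, U y -> `|cross_term tau M w y| <= b].
Proof.
have [[M v]|nv] := pselect (exists M, valid_times T tau M).
  have [A [FA PA hA]] := fixed (valid_times_lohi v) (valid_times_disj v).
  by exists A; split => // M' v'; rewrite (valid_times_uniq v' v).
exists set0; split; last by move=> M v; case: nv; exists M.
  by have [h _ _] := hF; have [[]] := h T (ltW T0).
by rewrite measure0 lee_fin.
Qed.

Variables (S : 'I_2 -> nat -> Om -> R) (M : 'I_2 -> Om -> nat).
Hypothesis vS : forall w, valid_times T (fun l i => S l i w) (M ^~ w).
Hypothesis mS : forall l i, measurable_fun setT (S l i).
Hypothesis iS : indep P <<s [set C | exists l i (A : set R),
   measurable A /\ C = S l i @^-1` A] >> (F T).

Let Sr l i w : 0 <= S l i w <= T.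
Proof. by rewrite (valid_times_ge0 (vS w)) (valid_times_leT (vS w)). Qed.

Let kappa k (w : Om) : {ffun 'I_2 * 'I_k.+2 -> 'I_k.+2} :=
  [ffun p : 'I_2 * 'I_k.+2 => cell_index T k (S p.1 p.2 w)].

Let tauk k (f : {ffun 'I_2 * 'I_k.+2 -> 'I_k.+2}) l i : R :=
  if (i < k.+2)%N then grid T k (f (l, inord i)) else T.

Let kappa_pre k f : kappa k @^-1` [set f] =
  \bigcap_(p in [set: 'I_2 * 'I_k.+2]) (S p.1 p.2 @^-1` cell T k (f p)).
Proof.
apply/seteqP; split => [w /= <- p _|w h] /=.
  by rewrite ffunE; exact: (@cell_indexP R T k T0 _ (Sr p.1 p.2 w)).
apply/ffunP => p; rewrite ffunE; by apply/(@cell_indexE R T k T0 _ _ (Sr p.1 p.2 w)); exact: h.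
Qed.

Let kappaG k f : <<s [set C | exists l i (A : set R),
   measurable A /\ C = S l i @^-1` A] >> (kappa k @^-1` [set f]).
Proof.
rewrite kappa_pre.
pose Gt := g_sigma_algebraType [set C | exists l i (A : set R),
   measurable A /\ C = S l i @^-1` A].
apply: (@fin_bigcap_measurable _ Gt); first exact: finite_finset.
move=> p _; apply: sub_sigma_algebra; exists p.1, p.2, (cell T k (f p)).
by split => //; exact: measurable_itv.
Qed.

Let kappa_meas k f : measurable (kappa k @^-1` [set f]).
Proof.
rewrite kappa_pre; apply: fin_bigcap_measurable; first exact: finite_finset.
move=> p _; rewrite -[X in measurable X]setTI; apply: mS => //; exact: measurable_itv.
Qed.

(** Rounding up to the k-th grid leaves finitely many possible time sequences, so [decouple]
    bounds the probability of the exceptional event A k of the selected sequence.  A path on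
    which the cross term exceeds b for the true times lies in A k for all large k, because
    the cross term converges as the grid is refined; [liminf_le] bounds the probability of
    such paths. *)
Lemma random_sup : exists L : set Om, [/\ measurable L, (P L <= c%:E)%E &
  forall w, {within [set t | 0 <= t], continuous (X ^~ w)} -> ~ L w ->
    forall y, closure U y -> `|cross_term (fun l i => S l i w) (M ^~ w) w y| <= b].
Proof.
have [AA hAA] := choice exceptional_set.
pose A k := [set w | AA (tauk (kappa k w)) w].
have FA tau : F T (AA tau) by have [] := hAA tau.
have mFA tau : measurable (AA tau) by exact: (F_measurable hF (ltW T0) (FA tau)).
have hA k := decouple c0 iS (@kappaG k) (@kappa_meas k) (fun f => FA (tauk f))
  (fun f => mFA (tauk f)) (fun f => let: And3 _ h _ := hAA (tauk f) in h).
have [L [mL PL hL]] := liminf_le (fun k => (hA k).1) (fun k => (hA k).2).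
exists L; split => // w cX nLw y Uy; rewrite leNgt; apply/negP => by_.
apply: nLw; apply: hL.
pose tau l i := S l i w; pose m0 l := M l w.
have v : valid_times T tau m0 := vS w.
(* by continuity the excess also occurs at a parameter inside U, where the fixed-times
   bound is available *)
have [y' Uy' by'] : exists2 y', U y' & b < `|cross_term tau m0 w y'|.
  have [yk [Uyk cyk]] := closure_seq Uy.
  have cc : cross_term tau m0 w (yk k) @[k --> \oo] --> cross_term tau m0 w y.
    have cUyk k : closure U (yk k) by exact: subset_closure.
    apply: (sum_cvg c10 CSg Cg low mok cX (valid_times_lohi v) (valid_times_disj v)
      (fun=> valid_times_lohi v)) => // [i|i]; exact: cvg_cst.
  have [n _ hn] : \forall k \near \oo, b < `|cross_term tau m0 w (yk k)|.
    by apply: (cvgr_gt _ (cvg_norm cc)).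
  by exists (yk n) => //; exact: (hn n (leqnn n)).
pose rk k l i := grid T k (cell_index T k (tau l i)).
have rk_ge k l i : tau l i <= rk k l i.
  by have /andP[] := grid_cell_index k T0 (Sr l i w).
have crk l i : rk k l i @[k --> \oo] --> tau l i.
  apply: (@squeeze_cvgr _ _ _ _ (fun=> tau l i) (fun k => tau l i + T / k.+1%:R)).
  - apply: nearW => k; rewrite rk_ge /= ltW//.
    by have /andP[] := grid_cell_index k T0 (Sr l i w).
  - exact: cvg_cst.
  - rewrite -[X in _ --> X]addr0; apply: cvgD; first exact: cvg_cst.
    rewrite -[X in _ --> X](mulr0 T); apply: cvgM; first exact: cvg_cst.
    exact: cvg_harmonic.
(* on a fine grid distinct times stay distinct, since the rounding error is eventually
   smaller than the gaps *)
have vk : \forall k \near \oo, valid_times T (rk k) m0.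
  have : \forall k \near \oo, forall i : 'I_(m0 ord0 + m0 ord_max),
      rk k (psi i) (phi i) < rk k (psi i) (phi i).+1.
    apply: filter_forall => i; have [_ lt_i _] := valid_times_lohi v i.
    have n1 : \forall k \near \oo, rk k (psi i) (phi i) < right_time tau i.
      exact: (cvgr_lt _ (crk (psi i) (phi i))).
    apply: filterS n1 => k h.
    exact: lt_le_trans h (rk_ge _ _ _).
  apply: filterS => k hk l; have [h1 h2 h3 h4] := v l; split => //.
  - by rewrite /rk h2 cell_index0.
  - by move=> i /psi_phi_onto[j [<- <-]].
  - by move=> i im; rewrite /rk h4// cell_indexT.
(* the k-th rounding records k + 2 times per component, which is all of them for large k *)
have tk : \forall k \near \oo, tauk (kappa k w) = rk k.
  exists (maxn (m0 ord0) (m0 ord_max)) => // k /= mk.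
  have ml l : (m0 l <= k)%N.
    by apply: leq_trans mk; case: (I2_cases l) => ->; [exact: leq_maxl|exact: leq_maxr].
  apply/funext => l; apply/funext => i; rewrite /tauk; case: ltnP => ik.
    by rewrite ffunE /= inordK.
  have [_ _ _ h4] := v l; rewrite /rk h4 ?cell_indexT//.
  by apply: leq_trans (ml l) _; apply: leq_trans ik; exact: leq_trans (leqnSn _) (leqnSn _).
(* shift so that every rounded sequence is a valid one *)
have [k0 _ vk0] := vk.
have vk' k : valid_times T (rk (k + k0)%N) m0 by apply: vk0 => /=; exact: leq_addl.
have cY : cross_term (rk k) m0 w y' @[k --> \oo] --> cross_term tau m0 w y'.
  rewrite -(cvg_shiftn k0 (fun k => cross_term (rk k) m0 w y')).
  have cUy' : closure U y' by exact: subset_closure.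
  apply: (sum_cvg c10 CSg Cg low mok cX (valid_times_lohi v) (valid_times_disj v)
      (fun k => valid_times_lohi (vk' k))) => //.
  - by move=> k i; exact: rk_ge.
  - by move=> k i; exact: rk_ge.
  - by move=> i; rewrite /left_time (cvg_shiftn k0 (fun k => rk k (psi i) (phi i))); exact: crk.
  - by move=> i; rewrite /right_time (cvg_shiftn k0 (fun k => rk k (psi i) (phi i).+1)); exact: crk.
  - exact: cvg_cst.
have bk : \forall k \near \oo, b < `|cross_term (rk k) m0 w y'|.
  by apply: (cvgr_gt _ (cvg_norm cY)).
near=> k.
have e : tauk (kappa k w) = rk k by near: k.
rewrite /A /= e; apply: contrapT => nA.
have [_ _ h] := hAA (rk k).
have vkk : valid_times T (rk k) m0 by near: k.
have := h m0 vkk w nA y' Uy'; rewrite leNgt => /negP; apply.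
by near: k.
Unshelve. all: by end_near. Qed.

End RandomTimes.

(** * Bounds for the coefficients of the model *)

Section ModelCoefficients.
Variables (R : realType) (d1 d2 : nat) (Th1 : set 'rV[R]_d1) (Th2 : set 'rV[R]_d2).
Variables (mu : R -> 'rV[R]_d2 -> 'cV[R]_2) (b : R -> 'rV[R]_d1 -> 'M[R]_2).
Variables (sigma0 : 'rV[R]_d1) (theta0 : 'rV[R]_d2).
Hypotheses (s0 : Th1 sigma0) (t0 : Th2 theta0).
Hypothesis hA1 : A1 Th1 Th2 mu b.

Lemma anorm_entry (J : finType) (a : J -> R) j : `|a j| <= anorm a.
Proof.
rewrite /anorm -sqrtr_sqr; apply: ler_wsqrtr.
by rewrite (bigD1 j)//= lerDl sumr_ge0// => i _; exact: sqr_ge0.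
Qed.

Lemma C1_family_le m (U : set 'rV[R]_m) K K' f : K <= K' -> C1_family U K f -> C1_family U K' f.
Proof.
move=> KK [h1 h2]; split; first exact: bounded_family_le KK h1.
by move=> j; have [h3 h4] := h2 j; split => //; exact: bounded_family_le KK h4.
Qed.

(** The modulus-of-continuity condition at two equal times yields the uniform bounds. *)
Lemma A1_bounds : exists K, [/\ 0 <= K,
  forall l, C1_family Th2 K (fun t th => mu t th l ord0) &
  forall i j, C1_family Th1 K (fun t sg => b t sg i j)].
Proof.
have [_ [smu sb] unif] := hA1.
have [dl [K [dl0 K0 hK]]] := unif 1 ltr01.
exists K; split; first exact: ltW.
  move=> l; have bd k (j : k.-tuple 'I_d2) t th : (k <= 4)%N -> 0 <= t -> Th2 th ->
      `|pdc Th2 (fun y => mu t y l ord0) j th| <= K.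
    move=> k4 tt Tth; have ts : `|t - t| < dl by rewrite subrr normr0.
    have [h _] := hK k sigma0 th t t k4 s0 Tth tt tt ts.
    have := anorm_entry (@dmu R d2 Th2 mu k t th) (j, l); rewrite /dmu /= => h2.
    apply: le_trans h2 _; apply: le_trans h.
    by rewrite lerDl anorm_ge0.
  apply: C1_family_smooth; first exact: smu.
    by move=> t x tt Ux; exact: (bd 0%N [tuple] t x isT tt Ux).
  move=> t x j tt Ux; have := bd 1%N [tuple j] t x isT tt Ux.
  by rewrite /pdc mem_set.
move=> i j; have bd k (s : k.-tuple 'I_d1) t sg : (k <= 4)%N -> 0 <= t -> Th1 sg ->
    `|pdc Th1 (fun y => b t y i j) s sg| <= K.
  move=> k4 tt Tth; have ts : `|t - t| < dl by rewrite subrr normr0.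
  have [h _] := hK k sg theta0 t t k4 Tth t0 tt tt ts.
  have := anorm_entry (@db R d1 Th1 b k t sg) (s, (i, j)); rewrite /db /= => h2.
  apply: le_trans h2 _; apply: le_trans h.
  by rewrite lerDr anorm_ge0.
apply: C1_family_smooth; first exact: sb.
  by move=> t x tt Ux; exact: (bd 0%N [tuple] t x isT tt Ux).
move=> t x k tt Ux; have := bd 1%N [tuple k] t x isT tt Ux.
by rewrite /pdc mem_set.
Qed.

Lemma bounded_family_seq m (A : set 'rV[R]_m) K f t x (u : nat -> 'rV[R]_m) : bounded_family A K f -> 0 <= t ->
  A x -> (forall k, A (u k)) -> u k @[k --> \oo] --> x -> f t (u k) @[k --> \oo] --> f t x.
Proof. by move=> [_ h _] tt Ax Au ux; apply: within_cvg_seq Ax (h t tt) Au ux. Qed.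

(** The oscillation bound holds inside the parameter set and extends to its closure by
    continuity. *)
Lemma A1_osc e : 0 < e -> exists2 dl, 0 < dl & forall t s th l, closure Th2 th ->
  0 <= t -> 0 <= s -> `|t - s| < dl -> `|mu t th l ord0 - mu s th l ord0| <= e.
Proof.
move=> e0; have [_ _ unif] := hA1; have [dl [K [dl0 K0 hK]]] := unif e e0.
have [K' [_ Cmu _]] := A1_bounds.
exists dl => // t s th l /[dup] cth /closure_seq[u [Uu cu]] tt ss ts.
have bf := (Cmu l).1.
have cUu k : closure Th2 (u k) by exact: subset_closure.
apply: (@cvg_le_cst _ (fun k => `|mu t (u k) l ord0 - mu s (u k) l ord0|)).
  by apply: cvg_norm; apply: cvgB; [exact: (bounded_family_seq bf tt cth cUu cu)|exact: (bounded_family_seq bf ss cth cUu cu)].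
move=> k; have [_ h] := hK 0%N sigma0 (u k) t s isT s0 (Uu k) tt ss ts.
have := anorm_entry (fun j => @dmu R d2 Th2 mu 0 t (u k) j - @dmu R d2 Th2 mu 0 s (u k) j)
  ([tuple], l).
rewrite /dmu /= => h2; apply: le_trans h2 _; apply: le_trans h.
by rewrite lerDl anorm_ge0.
Qed.

Lemma SigmaE t sg l k : Sigma b t sg l k =
  b t sg l ord0 * b t sg k ord0 + b t sg l ord_max * b t sg k ord_max.
Proof.
rewrite /Sigma mxE !big_ord_recl big_ord0 addr0 !mxE.
by rewrite (_ : lift ord0 ord0 = ord_max)//; exact/val_inj.
Qed.

Lemma Sigma_sym t sg : (Sigma b t sg)^T = Sigma b t sg.
Proof. by rewrite /Sigma trmx_mul trmxK. Qed.

Lemma C1_family_Sigma : exists2 K, 0 <= K &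
  forall l k, C1_family Th1 K (fun t sg => Sigma b t sg l k).
Proof.
have [K [K0 _ Cb]] := A1_bounds.
exists ((K * K + K * K) + (K * K + K * K)); first by rewrite !addr_ge0 ?mulr_ge0.
move=> l k; have := C1_familyD (C1_familyM K0 K0 (Cb l ord0) (Cb k ord0))
  (C1_familyM K0 K0 (Cb l ord_max) (Cb k ord_max)).
congr (C1_family _ _ _); apply/funext => t; apply/funext => sg.
by rewrite SigmaE.
Qed.

Lemma C1_family_mudiff : exists2 K, 0 <= K &
  forall l, C1_family Th2 K (fun t th => mu t th l ord0 - mu t theta0 l ord0).
Proof.
have [K [K0 Cmu _]] := A1_bounds.
exists (K + K); first by rewrite addr_ge0.
move=> l; have [mf _ bf] := (Cmu l).1.
have c0 : closure Th2 theta0 by exact: subset_closure.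
apply: (C1_familyD (Cmu l)); apply: C1_family_cst => //.
  by apply: measurableT_comp => //; exact: mf.
by move=> t tt; rewrite normrN; exact: bf.
Qed.

Lemma bil_cvg p (x : 'cV[R]_p) (A : nat -> 'M[R]_p) L : mx_cvg (F := \oo) A L ->
  bil (A k) x x @[k --> \oo] --> bil L x x.
Proof.
move=> cA; have c : mx_cvg (F := \oo) (fun k => x^T *m A k *m x) (x^T *m L *m x).
  by apply: mx_cvg_mul; [apply: mx_cvg_mul => //|]; exact: mx_cvg_cst.
exact: c.
Qed.

(** Bounds on quadratic forms pass to the closure of the parameter set by continuity. *)
Lemma A1_loewner : exists c1 c2 : R, [/\ 0 < c1, 0 < c2 &
  forall t sg, 0 <= t -> closure Th1 sg ->
    loewner_le c1%:M (Sigma b t sg) /\ loewner_le (Sigma b t sg) c2%:M].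
Proof.
have [[c1 [c2 [c10 c20 h]]] _ _] := hA1.
have [K K0 CS] := C1_family_Sigma.
exists c1, c2; split => // t sg tt /[dup] cs /closure_seq[u [Uu cu]].
have cUu k : closure Th1 (u k) by exact: subset_closure.
have cS : mx_cvg (F := \oo) (fun k => Sigma b t (u k)) (Sigma b t sg).
  by move=> l k; exact: (bounded_family_seq (CS l k).1 tt cs cUu cu).
split => x; rewrite -!/(bil _ _ _).
  rewrite -lerN2; apply: (cvg_le_cst (cvgN (bil_cvg (x := x) cS))).
  by move=> k; rewrite lerN2; exact: (h t (u k) tt (Uu k)).1.
by apply: (cvg_le_cst (bil_cvg (x := x) cS)) => k; exact: (h t (u k) tt (Uu k)).2.
Qed.

Lemma closure_of_seq m (A : set 'rV[R]_m) (u : nat -> 'rV[R]_m) x :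
  (forall k, A (u k)) -> u k @[k --> \oo] --> x -> closure A x.
Proof.
move=> Au ux B hB; have [n _ hn] := ux _ hB.
by exists (u n); split => //; exact: (hn n (leqnn n)).
Qed.

Lemma cvg_row_mx (u : nat -> 'rV[R]_d1) (v : nat -> 'rV[R]_d2)
    (x : 'rV[R]_d1) (y : 'rV[R]_d2) :
  u k @[k --> \oo] --> x -> v k @[k --> \oo] --> y ->
  (row_mx (u k) (v k) : 'rV[R]_(d1 + d2)) @[k --> \oo] --> (row_mx x y : 'rV[R]_(d1 + d2)).
Proof.
move=> cu cv B [Q hQ QB].
have : \forall k \near \oo, forall j : 'I_(d1 + d2), Q ord0 j (row_mx (u k) (v k) ord0 j).
  apply: filter_forall => j; have := hQ ord0 j; rewrite mxE.
  case: (splitP j) => i ij nQ.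
    have c := cvg_comp _ _ cu (@coord_continuous _ _ _ ord0 i x).
    have n1 : \forall k \near \oo, Q ord0 j (u k ord0 i) := c _ nQ.
    apply: filterS n1 => k.
    by have -> : j = lshift d2 i by [exact/val_inj]; rewrite row_mxEl.
  have c := cvg_comp _ _ cv (@coord_continuous _ _ _ ord0 i y).
  have n1 : \forall k \near \oo, Q ord0 j (v k ord0 i) := c _ nQ.
  apply: filterS n1 => k.
  by have -> : j = rshift d1 i by [exact/val_inj]; rewrite row_mxEr.
by apply: filterS => k hk; apply: QB => i j; rewrite (ord1 i); exact: hk.
Qed.

Lemma closure_row_mx sg th : closure Th1 sg -> closure Th2 th ->
  closure (prod_set Th1 Th2) (row_mx sg th).
Proof.
move=> /closure_seq[u [Uu cu]] /closure_seq[v [Uv cv]].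
apply: (closure_of_seq _ (cvg_row_mx cu cv)) => k.
by split; rewrite ?row_mxKl ?row_mxKr.
Qed.

Definition Sigma_at t (y : 'rV[R]_(d1 + d2)) := Sigma b t (lsubmx y).
Definition drift_gap t (y : 'rV[R]_(d1 + d2)) (l : 'I_2) :=
  mu t (rsubmx y) l ord0 - mu t theta0 l ord0.

Lemma model_bounds : exists K, [/\ 0 <= K,
  forall l k, C1_family (prod_set Th1 Th2) K (fun t y => Sigma_at t y l k),
  forall l, C1_family (prod_set Th1 Th2) K (fun t y => drift_gap t y l),
  forall l, measurable_fun `[(0:R), +oo[%classic (fun t => mu t theta0 l ord0) /\
    forall t, 0 <= t -> `|mu t theta0 l ord0| <= K &
  forall T, bounded_coef T K (b ^~ sigma0)].
Proof.
have [K1 K10 C1] := C1_family_Sigma.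
have [K2 K20 C2] := C1_family_mudiff.
have [K3 [K30 C3 C4]] := A1_bounds.
exists (K1 + K2 + K3); split.
- by rewrite !addr_ge0.
- move=> l k; apply: C1_family_le (C1_family_lsub Th2 K10 (C1 l k)).
  by rewrite -addrA lerDl addr_ge0.
- move=> l; apply: C1_family_le (C1_family_rsub Th1 K20 (C2 l)).
  by rewrite addrAC lerDr addr_ge0.
- move=> l; have [mf _ bf] := (C3 l).1.
  have ct : closure Th2 theta0 by exact: subset_closure.
  split; first exact: mf.
  by move=> t tt; apply: le_trans (bf t _ tt ct) _; rewrite lerDr addr_ge0.
- move=> T l k; have [mf _ bf] := (C4 l k).1.
  have ct : closure Th1 sigma0 by exact: subset_closure.
  split; first by apply: measurable_funS (mf _ ct) => //; exact: (@sub_itv0 R _ T).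
  by move=> t tt; apply: le_trans (bf t _ tt ct) _; rewrite lerDr addr_ge0.
Qed.

End ModelCoefficients.

(** * Uniform convergence of time averages *)

Section TimeAverages.
Variables (R : realType) (m : nat) (U : set 'rV[R]_m) (r : R).
Hypotheses (oU : open U) (sU : sobolev U) (r0 : 0 < r).
Hypothesis Ur : forall y, U y -> forall j, `|y ord0 j| <= r.
Variables (T_ : nat -> R).
Hypothesis T0 : forall n, 0 <= T_ n.
Local Notation leb := (@lebesgue_measure R).

Lemma cvg_sub (f : nat -> R) (l : R) (s : nat -> nat) : (forall k, (k <= s k)%N) ->
  f n @[n --> \oo] --> l -> f (s k) @[k --> \oo] --> l.
Proof.
move=> hs c B hB; have [N _ hN] := c B hB; exists N => // k /= Nk.
by apply: hN => /=; exact: leq_trans (hs k).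
Qed.

Lemma time_avg_bound A K (f : R -> 'rV[R]_m -> R) T x : bounded_family A K f -> 0 <= T -> A x ->
  `|time_avg (f ^~ x) T| <= K.
Proof.
move=> bf TT Ax; rewrite /time_avg normrM normfV (ger0_norm TT).
have K0 : 0 <= K by have [_ _ h] := bf; exact: le_trans (h 0 x (lexx _) Ax).
have := param_int_le bf Ax (measurable_itv `[(0:R), T]) (@subset_refl _ _).
rewrite fine_cc// subr0 => h.
have [->|Tn] := eqVneq T 0; first by rewrite invr0 mul0r.
by rewrite ler_pdivrMl ?lt0r ?Tn//= mulrC.
Qed.

(** The sequence is uniformly Cauchy: otherwise there are indices n_k, m_k tending to
    infinity for which the difference of the two time averages does not tend to 0
    uniformly, although it tends to 0 pointwise together with its gradient, against
    [sobolev_unif]. *)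
Lemma time_avg_cvg_unif K (f : R -> 'rV[R]_m -> R) (Phi : 'rV[R]_m -> R) : 0 <= K -> C1_family U K f ->
  (forall x, U x -> time_avg (f ^~ x) (T_ n) @[n --> \oo] --> Phi x) ->
  (forall j x, U x -> exists l : R,
     time_avg (fun t => pd (f t) [:: j] x) (T_ n) @[n --> \oo] --> l) ->
  forall e, 0 < e -> \forall n \near \oo, forall x, U x ->
    `|time_avg (f ^~ x) (T_ n) - Phi x| <= e.
Proof.
move=> K0 Cf cPhi cd e e0.
pose a n x := time_avg (f ^~ x) (T_ n).
have C1a n n' : C1 U (fun x => a n x - a n' x) /\
    forall x j, U x -> pd (fun x => a n x - a n' x) [:: j] x =
      time_avg (fun t => pd (f t) [:: j] x) (T_ n) -
      time_avg (fun t => pd (f t) [:: j] x) (T_ n').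
  (* the difference is a linear combination of two integrals over different time intervals *)
  pose s (i : 'I_2) := if i == ord0 then n else n'.
  pose z (i : 'I_2) : R := if i == ord0 then (T_ n)^-1 else - (T_ n')^-1.
  pose v (i : 'I_2) x := \int[leb]_(t in `[0, T_ (s i)]) f t x.
  have Cv i := C1_param_int oU Cf (measurable_itv `[(0:R), T_ (s i)]) (@subset_refl _ _).
  have [h1 h2] := C1_lin z oU (fun i => (Cv i).1).
  have e1 : (fun x => a n x - a n' x) = (fun y => \sum_i z i * v i y).
    by apply/funext => y; rewrite !big_ord_recl big_ord0 addr0 /z /v /s /= mulNr.
  rewrite e1; split => // x j Ux; rewrite h2//.
  rewrite (eq_bigr (fun i => z i * \int[leb]_(t in `[0, T_ (s i)]) pd (f t) [:: j] x)).
    by rewrite !big_ord_recl big_ord0 addr0 /z /s /= mulNr.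
  by move=> i _; rewrite (Cv i).2.
have [N hN] : exists N, forall n n' x, (N <= n)%N -> (N <= n')%N -> U x ->
    `|a n x - a n' x| <= e.
  apply: contrapT => nC.
  have ex N : exists p : nat * nat, [/\ (N <= p.1)%N, (N <= p.2)%N &
      exists2 x, U x & e < `|a p.1 x - a p.2 x|].
    apply: contrapT => nP; apply: nC; exists N => n n' x Nn Nn' Ux.
    by rewrite leNgt; apply/negP => ex; apply: nP; exists (n, n'); split => //; exists x.
  have [p hp] := choice ex.
  have p1 k : (k <= (p k).1)%N by have [] := hp k.
  have p2 k : (k <= (p k).2)%N by have [] := hp k.
  have c0 (g : nat -> R) (l : R) : g n @[n --> \oo] --> l ->
      g (p k).1 - g (p k).2 @[k --> \oo] --> (0:R).
    by move=> cg; rewrite -(subrr l); apply: cvgB; exact: cvg_sub.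
  have [n _ /(_ n (leqnn n))] := sobolev_unif r0 (addr_ge0 K0 K0) oU sU Ur
    (u := fun k x => a (p k).1 x - a (p k).2 x) (fun k => (C1a _ _).1)
    (fun k x Ux => le_trans (ler_normB _ _) (lerD
       (time_avg_bound (bounded_family_sub (@subset_closure _ U) Cf.1) (T0 _) Ux)
       (time_avg_bound (bounded_family_sub (@subset_closure _ U) Cf.1) (T0 _) Ux)))
    (fun k x j Ux => ltac:(rewrite (C1a _ _).2//; exact: (le_trans (ler_normB _ _) (lerD
       (time_avg_bound (Cf.2 j).2 (T0 _) Ux) (time_avg_bound (Cf.2 j).2 (T0 _) Ux)))))
    (fun x Ux => c0 (fun n => a n x) _ (cPhi x Ux))
    (fun x j Ux => ltac:(under eq_fun do rewrite (C1a _ _).2//;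
       have [l cl] := cd j x Ux; exact: (c0 _ _ cl))) e0.
  move=> /= h; have [_ _ [x Ux]] := hp n; by rewrite ltNge h.
exists N => // n /= Nn x Ux.
apply: (@cvg_le_cst _ (fun k => `|a n x - a (k + N)%N x|)).
  apply: cvg_norm; apply: cvgB; first exact: cvg_cst.
  by apply: (@cvg_sub (fun k => a k x)) (cPhi x Ux) => k; exact: leq_addr.
by move=> k; apply: hN => //; exact: leq_addl.
Qed.

End TimeAverages.

(** * Identifiability of the drift *)

Section Identifiability.
Variables (R : realType) (d1 d2 : nat) (Th1 : set 'rV[R]_d1) (Th2 : set 'rV[R]_d2).
Variables (mu : R -> 'rV[R]_d2 -> 'cV[R]_2) (b : R -> 'rV[R]_d1 -> 'M[R]_2).
Variables (sigma0 : 'rV[R]_d1) (theta0 : 'rV[R]_d2) (a1 : nat -> R) (r : R).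
Hypotheses (o2 : open Th2) (sob2 : sobolev Th2) (r0 : 0 < r).
Hypothesis Tr : forall y, Th2 y -> forall j, `|y ord0 j| <= r.
Hypotheses (s0 : Th1 sigma0) (t0 : Th2 theta0).
Hypothesis hA1 : A1 Th1 Th2 mu b.
Hypothesis hA3 : A3 Th1 Th2 mu b sigma0 theta0.
Hypothesis hA6 : A6 Th1 Th2 mu b sigma0 theta0 a1.
Variables (T_ : nat -> R).
Hypothesis T0 : forall n, 0 <= T_ n.
Hypothesis Toy : T_ n @[n --> \oo] --> +oo.
Local Notation leb := (@lebesgue_measure R).

Lemma loewner_diag p (A : 'M[R]_p) (c : R) l :
  (loewner_le c%:M A -> c <= A l l) /\ (loewner_le A c%:M -> A l l <= c).
Proof.
have e (B : 'M[R]_p) : bil B (delta_mx l ord0) (delta_mx l ord0) = B l l.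
  rewrite bilE (bigD1 l)//= [X in _ + X]big1 ?addr0.
    rewrite (bigD1 l)//= [X in _ + X]big1 ?addr0; first by rewrite !mxE !eqxx mulr1 mul1r.
    by move=> j jl; rewrite !mxE (negbTE jl) mulr0.
  by move=> i il; apply: big1 => j _; rewrite !mxE (negbTE il) !mul0r.
by split => /(_ (delta_mx l ord0)); rewrite -!/(bil _ _ _) !e mxE eqxx mulr1n.
Qed.

Let s11 t l := Sigma b t sigma0 l l.

Lemma C1_family_phi : exists2 K, 0 <= K &
  forall l, C1_family Th2 K (fun t th => mudiff mu b sigma0 theta0 l t th).
Proof.
have [K1 K10 CS] := C1_family_Sigma s0 t0 hA1.
have [K2 K20 Cg] := C1_family_mudiff s0 t0 hA1.
have [c1 [c2 [c10 c20 hl]]] := A1_loewner s0 t0 hA1.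
have cs0 : closure Th1 sigma0 by exact: subset_closure.
have S_ge t l : 0 <= t -> c1 <= s11 t l.
  by move=> tt; apply: (loewner_diag _ _ _).1; exact: (hl t sigma0 tt cs0).1.
pose K3 := (Num.sqrt c1)^-1.
have K30 : 0 <= K3 by rewrite invr_ge0 sqrtr_ge0.
exists (K3 * K2 + K3 * K2); first by rewrite addr_ge0 ?mulr_ge0.
move=> l.
have Cinv : C1_family Th2 K3 (fun t (_ : 'rV[R]_d2) => (Num.sqrt (s11 t l))^-1).
  apply: C1_family_cst => //.
    apply: subspace_continuous_measurable_fun => //.
    have [_ [_ sb] _] := hA1.
    have cb j : {within `[(0:R), +oo[%classic, continuous (fun t => b t sigma0 l j)}.
      have := within_section1 cs0 ((sb l j).2 [::] isT).
      by apply: subspace_eq_continuous.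
    apply/subspace_continuousP => t tt.
    have t_ge : 0 <= t by move: tt; rewrite /= in_itv /= andbT.
    apply: cvgV; first by rewrite gt_eqF// sqrtr_gt0 (lt_le_trans c10)// S_ge.
    apply: (cvg_comp (fun t => s11 t l) Num.sqrt); last exact: sqrt_continuous.
    rewrite /s11 SigmaE; under eq_fun do rewrite SigmaE.
    have c j : b t' sigma0 l j @[t' --> within `[(0:R), +oo[%classic (nbhs t)] --> b t sigma0 l j.
      by have /subspace_continuousP := cb j; apply.
    exact: (cvgD (cvgM (c ord0) (c ord0)) (cvgM (c ord_max) (c ord_max))).
  move=> t tt; rewrite ger0_norm ?invr_ge0 ?sqrtr_ge0// lef_pV2 ?posrE ?sqrtr_gt0//.
    by rewrite ler_wsqrtr// S_ge.
  by rewrite (lt_le_trans c10)// S_ge.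
exact: (C1_familyM K30 K20 Cinv (Cg l)).
Qed.

Let phi2 l t th := mudiff mu b sigma0 theta0 l t th ^+ 2.
Let dm2 l t th := (mu t th l ord0 - mu t theta0 l ord0) ^+ 2.

Lemma C1_family_sq (f : R -> 'rV[R]_d2 -> R) K : 0 <= K -> C1_family Th2 K f ->
  C1_family Th2 (K * K + K * K) (fun t th => f t th ^+ 2).
Proof.
move=> K0 Cf; have := C1_familyM K0 K0 Cf Cf; congr (C1_family _ _ _).
Qed.

Lemma avg_le A K K' (f f' : R -> 'rV[R]_d2 -> R) (a T : R) x : bounded_family A K f -> bounded_family A K' f' ->
  A x -> 0 <= T -> (forall t, 0 <= t -> f t x <= a * f' t x) ->
  time_avg (f ^~ x) T <= a * time_avg (f' ^~ x) T.
Proof.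
move=> bf bf' Ax TT h; rewrite /time_avg mulrCA ler_wpM2l ?invr_ge0//.
have sub := @subset_refl _ `[(0:R), T]%classic.
have i1 := bounded_family_integrable bf Ax (measurable_itv `[(0:R), T]) sub.
have i2 := bounded_family_integrable bf' Ax (measurable_itv `[(0:R), T]) sub.
rewrite -RintegralZl//; apply: le_Rintegral => //.
  exact: integrableZ.
by move=> t /=; rewrite in_itv /= => /andP[tt _]; exact: h.
Qed.

Lemma avg_add A K K' (f f' : R -> 'rV[R]_d2 -> R) (T : R) x : bounded_family A K f -> bounded_family A K' f' ->
  A x -> 0 <= T ->
  time_avg (fun t => f t x + f' t x) T = time_avg (f ^~ x) T + time_avg (f' ^~ x) T.
Proof.
move=> bf bf' Ax TT; rewrite /time_avg -mulrDr; congr (_ * _).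
have sub := @subset_refl _ `[(0:R), T]%classic.
have i1 := bounded_family_integrable bf Ax (measurable_itv `[(0:R), T]) sub.
have i2 := bounded_family_integrable bf' Ax (measurable_itv `[(0:R), T]) sub.
by rewrite RintegralD.
Qed.

(** The squares of the two normalized drift differences are the products with exponents
    (2, 0) and (0, 2). *)
Lemma phi2_limit l : exists Phi : 'rV[R]_d2 -> R,
  (forall th, closure Th2 th -> time_avg (phi2 l ^~ th) T @[T --> +oo] --> Phi th) /\
  forall j th, Th2 th -> exists l' : R,
    time_avg (fun t => pd (phi2 l t) [:: j] th) T @[T --> +oo] --> l'.
Proof.
have [_ _ h3] := hA3.
have key k1 k2 : (k1 + k2 = 2)%N ->
    (forall t, (fun y => mudiff mu b sigma0 theta0 ord0 t y ^+ k1 *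
       mudiff mu b sigma0 theta0 ord_max t y ^+ k2) = phi2 l t) ->
    exists Phi : 'rV[R]_d2 -> R,
  (forall th, closure Th2 th -> time_avg (phi2 l ^~ th) T @[T --> +oo] --> Phi th) /\
  forall j th, Th2 th -> exists l' : R,
    time_avg (fun t => pd (phi2 l t) [:: j] th) T @[T --> +oo] --> l'.
  move=> k12 e.
  have [Phi _ hPhi] := h3 0%N [::] k1 k2 isT k12.
  exists Phi; split.
    move=> th cth; have := hPhi th cth.
    under eq_fun do under eq_fun do rewrite e expr0 mulr1.
    by [].
  move=> j th Tth; have [Phi' _ hPhi'] := h3 0%N [:: j] k1 k2 isT k12.
  exists (Phi' th); have := hPhi' th (subset_closure Tth).
  under eq_fun do under eq_fun do rewrite e expr0 mulr1 /pdc mem_set//=.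
  by [].
case: (I2_cases l) => el.
  by apply: (key 2%N 0%N erefl) => t; apply/funext => y; rewrite /phi2 el expr0 mulr1.
by apply: (key 0%N 2%N erefl) => t; apply/funext => y; rewrite /phi2 el expr0 mul1r.
Qed.

Let q2 (th : 'rV[R]_d2) : R := \sum_j (th ord0 j - theta0 ord0 j) ^+ 2.

Let S2 (f : 'I_2 -> R) : \sum_j f j = f ord0 + f ord_max.
Proof.
rewrite !big_ord_recl big_ord0 addr0; congr (_ + f _); exact/val_inj.
Qed.

Lemma limf_esup_avg (f : R -> R) (l : R) (g : R -> \bar R) (c : R) :
  f T @[T --> +oo] --> l -> (forall T, 0 < T -> (g T <= (c * f T)%:E)%E) -> 0 < c ->
  forall e, 0 < e -> (limf_esup g (pinfty_nbhs R) <= (c * (l + e))%:E)%E.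
Proof.
move=> cf gf c0 e e0.
have n1 : \forall T \near +oo, f T < l + e by apply: (cvgr_lt _ cf); rewrite ltrDl.
have n2 : \forall T \near +oo, (g T <= (c * (l + e))%:E)%E.
  near=> T; apply: le_trans (gf T _) _; first by near: T; exact: nbhs_pinfty_gt.
  by rewrite lee_fin ler_pM2l// ltW//; near: T.
apply: (@le_trans _ _ (ereal_sup (g @` [set T | (g T <= (c * (l + e))%:E)%E]))).
  by apply: ereal_inf_lbound; exists [set T | (g T <= (c * (l + e))%:E)%E].
by apply: ub_ereal_sup => _ [T /= h <-].
Unshelve. all: by end_near. Qed.

(** Dividing the drift difference by the square root of the diffusion coefficient changes
    its square by a factor between 1 / c2 and 1 / c1, so the identifiability condition bounds
    the limit Phi(theta) of the averages of the normalized squares below by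
    (c4 / c2) |theta - theta0|^2.  Uniform convergence of the averages transfers this bound
    to all large n simultaneously in theta, with half of it lost to the error terms. *)
Lemma drift_identifiable (eps : R) : 0 < eps -> exists2 kappa : R, 0 < kappa &
  \forall n \near \oo, forall th, closure Th2 th ->
    eps < anorm (fun j => (th - theta0) ord0 j) ->
    kappa * T_ n <= \int[leb]_(t in `[0, T_ n])
      (\sum_l (mu t th l ord0 - mu t theta0 l ord0) ^+ 2).
Proof.
move=> eps0.
have [c1 [c2 [c10 c20 hl]]] := A1_loewner s0 t0 hA1.
have cs0 : closure Th1 sigma0 by exact: subset_closure.
have Sb t l : 0 <= t -> c1 <= s11 t l <= c2.
  move=> tt; have [h1 h2] := hl t sigma0 tt cs0.
  by rewrite (loewner_diag _ _ _).1// (loewner_diag _ _ _).2.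
have phi2E l t th : phi2 l t th = (s11 t l)^-1 * dm2 l t th \/ t < 0.
  case: (leP 0 t) => tt; [left|by right].
  have /andP[h _] := Sb t l tt.
  by rewrite /phi2 /mudiff exprMn exprVn sqr_sqrtr// (le_trans (ltW c10)).
have [Kp Kp0 Cp] := C1_family_phi.
have [Km Km0 Cm] := C1_family_mudiff s0 t0 hA1.
have Cp2 l := C1_family_sq Kp0 (Cp l).
have Cm2 l := C1_family_sq Km0 (Cm l).
have Kp2 : 0 <= Kp * Kp + Kp * Kp by rewrite addr_ge0 ?mulr_ge0.
have Cps := C1_familyD (Cp2 ord0) (Cp2 ord_max).
have Cms := C1_familyD (Cm2 ord0) (Cm2 ord_max).
pose ps t th := phi2 ord0 t th + phi2 ord_max t th.
pose ms t th := dm2 ord0 t th + dm2 ord_max t th.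
have ms_ps t th : 0 <= t -> ms t th <= c2 * ps t th /\ ps t th <= c1^-1 * ms t th.
  move=> tt; have dm0 l : 0 <= dm2 l t th by exact: sqr_ge0.
  have h l : dm2 l t th <= c2 * phi2 l t th /\ phi2 l t th <= c1^-1 * dm2 l t th.
    have /andP[h1 h2] := Sb t l tt; have s_gt : 0 < s11 t l := lt_le_trans c10 h1.
    case: (phi2E l t th) => [->|]; last by rewrite ltNge tt.
    split; last by rewrite ler_wpM2r// lef_pV2.
    rewrite mulrA -[leLHS]mul1r ler_wpM2r//.
    by rewrite ler_pdivlMr// mul1r.
  rewrite /ms /ps !mulrDr; split; apply: lerD.
  - exact: (h ord0).1.
  - exact: (h ord_max).1.
  - exact: (h ord0).2.
  - exact: (h ord_max).2.
have [Phi0 [cP0 dP0]] := phi2_limit ord0.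
have [Phi1 [cP1 dP1]] := phi2_limit ord_max.
pose Phi th := Phi0 th + Phi1 th.
have cPhi th : closure Th2 th -> time_avg (ps ^~ th) T @[T --> +oo] --> Phi th.
  move=> cth; have c : time_avg (phi2 ord0 ^~ th) T + time_avg (phi2 ord_max ^~ th) T
      @[T --> +oo] --> Phi th by exact: (cvgD (cP0 th cth) (cP1 th cth)).
  apply: cvg_trans c; apply: near_eq_cvg.
  have n1 : \forall T \near (pinfty_nbhs R), 0 <= T.
    by exists 0; split => [|T /ltW //]; exact: num_real.
  by apply: filterS n1 => T TT; rewrite (avg_add (Cp2 ord0).1 (Cp2 ord_max).1 cth).
have [_ [_ [c4 [_ c40 _ h6]]]] := hA6.
have anE th : anorm (fun j => (th - theta0) ord0 j) ^+ 2 = q2 th.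
  rewrite /anorm sqr_sqrtr; last by apply: sumr_ge0 => j _; exact: sqr_ge0.
  by apply: eq_bigr => j _; rewrite !mxE.
have Phi_ge th : closure Th2 th -> c4 * q2 th <= c2 * Phi th.
  move=> cth; apply/ler_addgt0Pr => e e0.
  have ec : 0 < e / c2 by rewrite divr_gt0.
  have -> : c2 * Phi th + e = c2 * (Phi th + e / c2) by field; rewrite gt_eqF.
  rewrite -lee_fin -anE; apply: le_trans (h6 th cth) _.
  apply: (limf_esup_avg (cPhi th cth)) => // T Tp; rewrite lee_fin.
  apply: (@le_trans _ _ (time_avg (ms ^~ th) T)); last first.
    by apply: (avg_le Cms.1 Cps.1 cth (ltW Tp)) => t tt; exact: (ms_ps t th tt).1.
  rewrite le_eqVlt; apply/orP; left; apply/eqP; congr time_avg; apply/funext => t.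
  rewrite /anorm sqr_sqrtr; last by apply: sumr_ge0 => j _; exact: sqr_ge0.
  by rewrite S2 /ms /dm2 !mxE.
(* each of the two averages may deviate from its limit by a quarter of the lower bound *)
pose e := c4 * eps ^+ 2 / (4 * c2).
have e0 : 0 < e by rewrite /e divr_gt0 ?mulr_gt0 ?exprn_gt0.
have cT (f : R -> R) (l : R) : f T @[T --> +oo] --> l -> f (T_ n) @[n --> \oo] --> l.
  by move=> cf; exact: (cvg_comp _ _ Toy cf).
have unif l (Ph : 'rV[R]_d2 -> R) :
    (forall th, closure Th2 th -> time_avg (phi2 l ^~ th) T @[T --> +oo] --> Ph th) ->
    (forall j th, Th2 th -> exists l' : R,
      time_avg (fun t => pd (phi2 l t) [:: j] th) T @[T --> +oo] --> l') ->
    \forall n \near \oo, forall x, Th2 x -> `|time_avg (phi2 l ^~ x) (T_ n) - Ph x| <= e.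
  move=> h1 h2; apply: (time_avg_cvg_unif o2 sob2 r0 Tr T0 Kp2 (Cp2 l)) => //.
    by move=> x Tx; apply: cT; apply: h1; exact: subset_closure.
  by move=> j x Tx; have [l' hl'] := h2 j x Tx; exists l'; exact: cT.
exists (c1 * (c4 * eps ^+ 2 / (2 * c2))); first by rewrite !mulr_gt0 ?invr_gt0 ?mulr_gt0 ?exprn_gt0.
apply: filterS2 (unif _ _ cP0 dP0) (unif _ _ cP1 dP1) => n hn0 hn1.
(* the bound inside the parameter set, where convergence is uniform *)
have inner th : Th2 th -> eps ^+ 2 < q2 th ->
    c1 * (c4 * eps ^+ 2 / (2 * c2)) * T_ n <= \int[leb]_(t in `[0, T_ n]) (ms t th).
  move=> Tth q; have cth := subset_closure Tth.
  have [Tn0|Tn] := eqVneq (T_ n) 0.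
    rewrite Tn0 mulr0; apply: Rintegral_ge0 => t _.
    by rewrite addr_ge0// sqr_ge0.
  have Tp : 0 < T_ n by rewrite lt0r Tn T0.
  have a1' : time_avg (ps ^~ th) (T_ n) <= c1^-1 * time_avg (ms ^~ th) (T_ n).
    by apply: (avg_le Cps.1 Cms.1 cth (ltW Tp)) => t tt; exact: (ms_ps t th tt).2.
  have a2 : Phi th - 2 * e <= time_avg (ps ^~ th) (T_ n).
    rewrite (avg_add (Cp2 ord0).1 (Cp2 ord_max).1 cth)//.
    have := hn0 th Tth; have := hn1 th Tth; rewrite /Phi !ler_norml => /andP[k1 _] /andP[k2 _].
    lra.
  have a3 := Phi_ge th cth.
  have a4 : c4 * eps ^+ 2 / (2 * c2) <= Phi th - 2 * e.
    have h4 : c4 * eps ^+ 2 / c2 <= Phi th.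
      rewrite ler_pdivrMr// mulrC [leRHS]mulrC; apply: le_trans a3.
      by rewrite mulrC ler_pM2l// ltW.
    have -> : e = c4 * eps ^+ 2 / c2 / 4 by rewrite /e; field; rewrite gt_eqF.
    have -> : c4 * eps ^+ 2 / (2 * c2) = c4 * eps ^+ 2 / c2 / 2 by field; rewrite gt_eqF.
    lra.
  have a5 := le_trans a4 (le_trans a2 a1').
  move: a5; rewrite /time_avg ler_pdivlMl// ler_pdivlMl// => a5.
  by rewrite mulrC.
move=> th cth hq.
have q2th : eps ^+ 2 < q2 th.
  by rewrite -anE ltrXn2r// ?nnegrE ?anorm_ge0// ltW.
(* extension to the closure by continuity of both sides at fixed n *)
have [u [Uu cu]] := closure_seq cth.
have cUu k : closure Th2 (u k) by exact: subset_closure.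
have cq : q2 (u k) @[k --> \oo] --> q2 th.
  apply: cvg_sumr => j; apply: cvg_expr; apply: cvgB; last exact: cvg_cst.
  exact: (cvg_comp _ _ cu (@coord_continuous _ _ _ ord0 j th)).
have cI : \int[leb]_(t in `[0, T_ n]) (ms t (u k)) @[k --> \oo] -->
    \int[leb]_(t in `[0, T_ n]) (ms t th).
  apply: (param_int_cvg (T := T_ n) Cms.1) => //.
  - by move=> k.
  - by move=> t; exact: cvg_cst.
have -> : \int[leb]_(t in `[0, T_ n]) (\sum_l (mu t th l ord0 - mu t theta0 l ord0) ^+ 2) =
    \int[leb]_(t in `[0, T_ n]) (ms t th).
  by apply: eq_Rintegral => t _; rewrite S2.
have nq : \forall k \near \oo, eps ^+ 2 < q2 (u k) by exact: (cvgr_gt _ cq).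
rewrite leNgt; apply/negP => hlt.
have nI : \forall k \near \oo, \int[leb]_(t in `[0, T_ n]) (ms t (u k)) <
   c1 * (c4 * eps ^+ 2 / (2 * c2)) * T_ n by exact: (cvgr_lt _ cI).
have [k _ hk] := filterI nq nI.
by have [/(inner _ (Uu k)) h1] := hk k (leqnn k); rewrite ltNge h1.
Qed.

End Identifiability.

(** * The inequality satisfied by a maximizer *)

Section BasicInequality.
Context (R : realType) dsp (Om : measurableType dsp).
Variables (d1 d2 : nat) (Th1 : set 'rV[R]_d1) (Th2 : set 'rV[R]_d2).
Variables (mu : R -> 'rV[R]_d2 -> 'cV[R]_2) (b : R -> 'rV[R]_d1 -> 'M[R]_2).
Variables (sigma0 : 'rV[R]_d1) (theta0 : 'rV[R]_d2).
Hypotheses (s0 : Th1 sigma0) (t0 : Th2 theta0).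
Hypothesis hA1 : A1 Th1 Th2 mu b.
Variables (X : R -> Om -> 'cV[R]_2) (w : Om).
Variables (T : R) (tau : 'I_2 -> nat -> R) (M : 'I_2 -> nat).
Hypotheses (T0 : 0 <= T) (v : valid_times T tau M).
Local Notation leb := (@lebesgue_measure R).
Local Notation lo := (@left_time R tau M).
Local Notation hi := (@right_time R tau M).

Lemma cov_mxE sg th : cov_mx tau M (Sigma b ^~ sg) =
  cov_at (Sigma_at b) (@psi M) lo hi (row_mx sg th : 'rV_(d1 + d2)).
Proof. by rewrite /cov_at /Sigma_at row_mxKl. Qed.

Lemma mu_integrable th l c : closure Th2 th ->
  leb.-integrable `[(0:R), c]%classic (EFin \o (fun t => mu t th l ord0)).
Proof.
move=> cth; have [K [_ Cmu _]] := A1_bounds s0 t0 hA1.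
exact: (bounded_family_integrable (T := c) (Cmu l).1 cth).
Qed.

Lemma Vint_diff th l x y : closure Th2 th -> 0 <= x -> x <= y ->
  Vint mu th y l ord0 - Vint mu th x l ord0 = \int[leb]_(t in `]x, y]) mu t th l ord0.
Proof.
move=> cth x0 xy; rewrite !mxE.
by apply: Rintegral_itvB; [exact: mu_integrable|rewrite bnd_simp|rewrite bnd_simp].
Qed.

Lemma drift_incr sg th : closure Th2 th ->
  incr tau M (Vint mu th) - incr tau M (Vint mu theta0) =
  drift_at (drift_gap mu theta0) (@psi M) lo hi (row_mx sg th : 'rV_(d1 + d2)).
Proof.
move=> cth; apply/colP => i; have [h1 h2 h3] := valid_times_lohi v i.
have ct0 : closure Th2 theta0 by exact: subset_closure.
rewrite !mxE -/(lo i) -/(hi i).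
have := Vint_diff (psi i) cth h1 (ltW h2); have := Vint_diff (psi i) ct0 h1 (ltW h2).
rewrite !mxE => -> ->.
have ii th' : closure Th2 th' -> leb.-integrable `]lo i, hi i]%classic
    (EFin \o (fun t => mu t th' (psi i) ord0)).
  move=> cth'; apply: integrableS (mu_integrable (psi i) T cth') => //.
  exact: (mul_itv (valid_times_lohi v)).
rewrite -RintegralB//; [|exact: ii|exact: ii].
by apply: eq_Rintegral => t _; rewrite /drift_gap row_mxKr.
Qed.

Lemma noise_incr i : (incr tau M (X ^~ w) - incr tau M (Vint mu theta0)) i ord0 =
  noise X (mu ^~ theta0) (@psi M) lo hi i w.
Proof. by rewrite !mxE /noise !mxE. Qed.

Lemma invmx_sym n (A : 'M[R]_n) : A^T = A -> (invmx A)^T = invmx A.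
Proof. by move=> h; rewrite trmx_inv h. Qed.

(** Expanding the square, the term in z alone cancels. *)
Lemma quad_argmax n (A : 'M[R]_n) (z d : 'cV[R]_n) : A^T = A ->
  - 2^-1 * bil A z z <= - 2^-1 * bil A (z - d) (z - d) ->
  bil A d d <= 2 * bil A z d.
Proof.
move=> sA.
have bs x y : bil A x y = bil A y x.
  rewrite !bilE exchange_big /=; apply: eq_bigr => i _; apply: eq_bigr => j _.
  by rewrite -{1}sA mxE; ring.
have -> : bil A (z - d) (z - d) = bil A z z - bil A z d - bil A d z + bil A d d.
  rewrite !bilE -sumrB -sumrB -big_split /=; apply: eq_bigr => i _.
  by rewrite -sumrB -sumrB -big_split /=; apply: eq_bigr => j _; rewrite !mxE; ring.
by rewrite (bs d z) => h; lra.
Qed.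

Lemma argmax_ineq sg th : closure Th2 th ->
  H2 mu b tau M (X ^~ w) sg theta0 <= H2 mu b tau M (X ^~ w) sg th ->
  forall y : 'rV_(d1 + d2), y = row_mx sg th ->
  forall S, S = cov_at (Sigma_at b) (@psi M) lo hi y ->
  forall D, D = drift_at (drift_gap mu theta0) (@psi M) lo hi y ->
  bil (invmx S) D D <= 2 * cross_term X (mu ^~ theta0) (Sigma_at b) (drift_gap mu theta0) tau M w y.
Proof.
move=> cth h y ey S eS D eD'.
have sS : (invmx S)^T = invmx S.
  by rewrite eS; apply: invmx_sym; apply: cov_of_sym => t; exact: Sigma_sym.
pose Z := incr tau M (X ^~ w) - incr tau M (Vint mu theta0).
have eD : incr tau M (X ^~ w) - incr tau M (Vint mu th) = Z - D.
  by rewrite eD' ey -(drift_incr sg cth) opprB addrA subrK.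
have := h; rewrite /H2 (cov_mxE sg th) -ey -eS eD -/Z -!/(bil _ _ _).
move=> /(quad_argmax sS) h2; apply: le_trans h2 _.
rewrite bil_mul le_eqVlt; apply/orP; left; apply/eqP; congr (_ * _).
by rewrite /cross_term eS eD'; apply: eq_bigr => i _; rewrite noise_incr.
Qed.

Variables (c1 c2 e dl : R).
Hypotheses (c10 : 0 < c1) (c20 : 0 < c2) (e0 : 0 <= e).
Hypothesis hl : forall t sg, 0 <= t -> closure Th1 sg ->
  loewner_le c1%:M (Sigma b t sg) /\ loewner_le (Sigma b t sg) c2%:M.
Hypothesis osc : forall t s th l, closure Th2 th -> 0 <= t -> 0 <= s -> `|t - s| < dl ->
  `|mu t th l ord0 - mu s th l ord0| <= e / 2.
Hypothesis small : forall i, hi i - lo i < dl.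

(** Combination of the maximality inequality with the lower bound of D^T S^-1 D by the dual
    norm of D, and of the latter by the energy of the drift difference. *)
Lemma drift_energy sg th : closure Th1 sg -> closure Th2 th ->
  H2 mu b tau M (X ^~ w) sg theta0 <= H2 mu b tau M (X ^~ w) sg th ->
  \int[leb]_(t in `[0, T]) (\sum_l (mu t th l ord0 - mu t theta0 l ord0) ^+ 2) <=
    4 * c2 * cross_term X (mu ^~ theta0) (Sigma_at b) (drift_gap mu theta0) tau M w
      (row_mx sg th : 'rV_(d1 + d2)) + 4 * e ^+ 2 * T.
Proof.
move=> csg cth /(argmax_ineq cth)/(_ _ erefl _ erefl _ erefl) /=.
set y := (row_mx sg th : 'rV_(d1 + d2)); set S := cov_at _ _ _ _ _; set D := drift_at _ _ _ _ _ => h.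
have [K [K0 CS Cg _ _]] := model_bounds s0 t0 hA1.
have cy : closure (prod_set Th1 Th2) y by exact: closure_row_mx.
have ok : bounded_coef T K (Sigma_at b ^~ y) by exact: (bounded_coef_Sg T CS cy).
have lS x : c1 * len_norm2 lo hi x <= bil S x x.
  apply: (cov_lower (valid_times_lohi v) (valid_times_disj v) x ok) => t tt.
  by rewrite /Sigma_at row_mxKl; exact: (hl tt csg).1.
have uS x : bil S x x <= c2 * len_norm2 lo hi x.
  apply: (cov_upper (valid_times_lohi v) (valid_times_disj v) x ok) => t tt.
  by rewrite /Sigma_at row_mxKl; exact: (hl tt csg).2.
have sS : S^T = S by apply: cov_of_sym => t; exact: Sigma_sym.
have h1 := inv_form_ge (valid_times_lohi v) c10 lS D c20 sS uS.
have ct0 : closure Th2 theta0 by exact: subset_closure.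
have h2 : \int[leb]_(t in `[0, T]) (\sum_l drift_gap mu theta0 t y l ^+ 2) <=
    2 * dual_norm2 lo hi D + 4 * e ^+ 2 * T.
  apply: (dincr_lower (K := K) (valid_times_lohi v) (valid_times_disj v)) => //.
  - by move=> l; exact: (bounded_family_measurable T (Cg l).1 cy).1.
  - by move=> t l tt; exact: (bounded_family_measurable T (Cg l).1 cy).2.
  - move=> i t s /andP[k1 k2] /andP[k3 k4].
    have lo0 : 0 <= lo i by have [] := valid_times_lohi v i.
    have tt : 0 <= t by exact: le_trans lo0 (ltW k1).
    have ss : 0 <= s by exact: le_trans lo0 (ltW k3).
    have ts : `|t - s| < dl.
      apply: le_lt_trans (small i); rewrite ler_norml.
      by apply/andP; split; lra.
    have := osc (psi i) cth tt ss ts; have := osc (psi i) ct0 tt ss ts.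
    rewrite /drift_gap row_mxKr => k5 k6.
    rewrite (_ : _ - _ - _ = (mu t th (psi i) ord0 - mu s th (psi i) ord0) -
      (mu t theta0 (psi i) ord0 - mu s theta0 (psi i) ord0)); last by ring.
    apply: le_trans (ler_normB _ _) _; lra.
  - move=> l t tT; exact: (valid_times_cover v l tT).
rewrite (_ : \int[leb]_(t in _) _ =
    \int[leb]_(t in `[0, T]) (\sum_l drift_gap mu theta0 t y l ^+ 2)); last first.
  by apply: eq_Rintegral => t _; rewrite /drift_gap row_mxKr.
(* the factor 2 of the energy bound times the factor 2 of the maximality inequality *)
apply: le_trans h2 _; rewrite lerD2r.
have := ler_wpM2l (ltW c20) h; lra.
Qed.

End BasicInequality.

(** * The mesh of random times *)

Section MeshEvent.
Context (R : realType) dsp (Om : measurableType dsp).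
Variables (T : R) (S : 'I_2 -> nat -> Om -> R) (M : 'I_2 -> Om -> nat) (dl : R).
Hypothesis vS : forall w, valid_times T (fun l i => S l i w) (M ^~ w).
Hypothesis mS : forall l i, measurable_fun setT (S l i).
Hypothesis dl0 : 0 < dl.

Lemma leng_obs w l i : leng (obs_itv (fun l i => S l i w) l i) = S l i.+1 w - S l i w.
Proof. by rewrite /leng /obs_itv fine_oc//; exact: (valid_times_le (vS w)). Qed.

(** Past the last index the increments of the times are 0, so the random range of the
    inner maximum can be replaced by all indices; this makes the event a countable union. *)
Lemma mesh_gtP w : dl < `|mesh (fun l i => S l i w) (M ^~ w) - 0| <->
  exists l i, dl < S l i.+1 w - S l i w.
Proof.
have m0 : 0 <= mesh (fun l i => S l i w) (M ^~ w) by exact: bigmax_ge_id.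
rewrite subr0 ger0_norm//; split => [h|[l [i h]]].
  apply: contrapT => nx; move: h; rewrite ltNge => /negP; apply.
  apply: bigmax_le => [|l _]; first exact: ltW.
  apply: bigmax_le => [|i _]; first exact: ltW.
  by rewrite leng_obs leNgt; apply/negP => h; apply: nx; exists l, i.
have iM : (i < M l w)%N.
  rewrite ltnNge; apply/negP => Mi; have [_ _ _ h4] := vS w l.
  by move: h; rewrite !h4 ?leqW// subrr ltNge ltW.
apply: lt_le_trans h _; rewrite -leng_obs.
apply: le_trans (le_bigmax 0 (fun l => \big[Num.max/0]_(i < M l w)
  leng (obs_itv (fun l i => S l i w) l i)) l).
exact: (le_bigmax 0 (fun i : 'I_(M l w) => leng (obs_itv (fun l i => S l i w) l i)) (Ordinal iM)).
Qed.

Lemma measurable_mesh :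
  measurable [set w | dl < `|mesh (fun l i => S l i w) (M ^~ w) - 0|].
Proof.
have -> : [set w | dl < `|mesh (fun l i => S l i w) (M ^~ w) - 0|] =
    \bigcup_(l in [set: 'I_2]) \bigcup_i ((fun w => S l i.+1 w - S l i w) @^-1` `]dl, +oo[).
  apply/seteqP; split => w /=.
    move=> /mesh_gtP[l [i h]]; exists l => //; exists i => //=.
    by rewrite in_itv /= andbT.
  move=> [l _ [i _]]; rewrite /= in_itv /= andbT => h.
  by apply/mesh_gtP; exists l, i.
apply: fin_bigcup_measurable => // l _; apply: bigcup_measurable => i _.
rewrite -[X in measurable X]setTI.
have : measurable_fun setT (fun w => S l i.+1 w - S l i w) by exact: measurable_funB.
by apply => //; exact: measurable_itv.
Qed.

End MeshEvent.

(** * Consistency of the drift estimator *)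

Lemma bounded_entries (R : realType) d (A : set 'rV[R]_d) : bounded_set A ->
  exists2 r : R, 0 < r & forall y, A y -> forall j, `|y ord0 j| <= r.
Proof.
move=> [M [_ hM]]; exists (`|M| + 1); first by rewrite ltr_wpDl.
move=> y Ay j; have := hM (`|M| + 1) _ y Ay; rewrite /= => h.
have M1 : M < `|M| + 1 by rewrite (le_lt_trans (ler_norm M))// ltrDl.
apply: le_trans (h M1); rewrite [leRHS]/Num.norm /= mx_normrE.
exact: (le_bigmax _ (fun k : 'I_1 * 'I_d => `|y k.1 k.2|) (ord0, j)).
Qed.

Theorem proposition3p6 (R : realType)
  (dsp : measure_display) (Om : measurableType dsp) (P : probability Om R)
  (F : R -> set (set Om))
  (d1 d2 : nat) (Th1 : set 'rV[R]_d1) (Th2 : set 'rV[R]_d2)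
  (h : nat -> R)
  (M : nat -> 'I_2 -> Om -> nat) (S : nat -> 'I_2 -> nat -> Om -> R)
  (mu : R -> 'rV[R]_d2 -> 'cV[R]_2) (b : R -> 'rV[R]_d1 -> 'M[R]_2)
  (sigma0 : 'rV[R]_d1) (theta0 : 'rV[R]_d2) (x0 : 'cV[R]_2)
  (W X : R -> Om -> 'cV[R]_2)
  (sigmahat : nat -> Om -> 'rV[R]_d1) (thetahat : nat -> Om -> 'rV[R]_d2)
  (a0 : 'I_2 -> R) (a1 : nat -> R)
  (h_steps : step_sizes h)
  (h_filtration : rc_filtration F)
  (h_Th1 : is_param_set Th1) (h_Th2 : is_param_set Th2)
  (h_Th : sobolev (prod_set Th1 Th2))
  (h_sigma0 : Th1 sigma0) (h_theta0 : Th2 theta0)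
  (h_wiener : wiener P F W)
  (h_X : solves_sde P F W x0 (mu ^~ theta0) (b ^~ sigma0) X)
  (h_sampling : sampling P F h M S)
  (h_sigmahat : forall n, (0 < n)%N ->
    (forall j, measurable_fun setT (fun w => sigmahat n w ord0 j)) /\
    (forall w, is_argmax (closure Th1)
       (H1 b (times S n w) (counts M n w) (X ^~ w)) (sigmahat n w)))
  (h_thetahat : forall n, (0 < n)%N ->
    (forall j, measurable_fun setT (fun w => thetahat n w ord0 j)) /\
    (forall w, is_argmax (closure Th2)
       (H2 mu b (times S n w) (counts M n w) (X ^~ w) (sigmahat n w))
       (thetahat n w)))
  (hA1 : A1 Th1 Th2 mu b)
  (hA2 : A2 P M S)
  (hA3 : A3 Th1 Th2 mu b sigma0 theta0)
  (hA4 : A4 P h M S a0 a1)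
  (hA5 : A5 P h M S)
  (hA6 : A6 Th1 Th2 mu b sigma0 theta0 a1) :
  cvg_in_prob P
    (fun n w => anorm (fun j => (thetahat n w - theta0) ord0 j)) 0.
Proof.
move=> eps eps0.
have [hpos _ Toy _] := h_steps.
have [d1p o1 bd1 _] := h_Th1; have [d2p o2 bd2 sob2] := h_Th2.
have [r1 r10 hr1] := bounded_entries bd1; have [r2 r20 hr2] := bounded_entries bd2.
pose T_ n := horizon h n.
have Tp n : (0 < n)%N -> 0 < T_ n by move=> n0; rewrite /T_ mulr_gt0 ?ltr0n ?hpos.
have T0 n : 0 <= T_ n.
  by case: n => [|n]; [rewrite /T_ /horizon mul0r|exact/ltW/Tp].
have [kappa kappa0 hident] := drift_identifiable o2 sob2 r20 hr2 h_sigma0 h_theta0 hA1 hA3 hA6 T0 Toy eps0.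
have [c1 [c2 [c10 c20 hl]]] := A1_loewner h_sigma0 h_theta0 hA1.
have [K [K0 CS Cg mok gok]] := model_bounds h_sigma0 h_theta0 hA1.
have cs0 : closure Th1 sigma0 by exact: subset_closure.
have ct0 : closure Th2 theta0 by exact: subset_closure.
pose U := prod_set Th1 Th2.
have oU : open U by exact: open_prod.
have Ur y : U y -> forall j, `|y ord0 j| <= r1 + r2.
  move=> [Uy1 Uy2] j; case: (splitP j) => k jk.
    have -> : j = lshift d2 k by exact/val_inj.
    have := hr1 _ Uy1 k; rewrite mxE => hk; apply: le_trans hk _.
    by rewrite lerDl ltW.
  have -> : j = rshift d1 k by exact/val_inj.
  have := hr2 _ Uy2 k; rewrite mxE => hk; apply: le_trans hk _.
  by rewrite lerDr ltW.
have low t y : 0 <= t -> closure U y -> loewner_le c1%:M (Sigma_at b t y).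
  by move=> tt /closure_prod[cy _]; exact: (hl t _ tt cy).1.
have gup t : 0 <= t -> loewner_le (b t sigma0 *m (b t sigma0)^T) c2%:M.
  by move=> tt; exact: (hl t _ tt cs0).2.
(* an exponent with 2 q larger than the dimension d1 + d2 *)
pose q := (d1 + d2)%N.
have q0 : (0 < q)%N by rewrite addn_gt0 d1p.
have qq : (d1 + d2 < 2 * q)%N by rewrite mul2n -addnn -/q -[ltnLHS]addn0 ltn_add2l.
have [C C0 hC] := fixed_sup h_filtration h_wiener h_X oU h_Th Ur q0 qq (addr_gt0 r10 r20)
  K0 c10 c20 CS Cg low gok gup.
(* eta and e make the upper bound of the drift energy equal to kappa T / 2, half of its
   lower bound *)
pose eta := kappa / (16 * c2).
have eta0 : 0 < eta by rewrite divr_gt0 ?mulr_gt0.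
pose e := Num.sqrt kappa / 4.
have e0 : 0 < e by rewrite divr_gt0 ?sqrtr_gt0.
have e2 : e ^+ 2 = kappa / 16.
  by rewrite /e exprMn sqr_sqrtr ?ltW// exprVn; congr (_ / _); ring.
(* the oscillation is taken for the drift at theta and at theta0, whence e / 2 *)
have [dl dl0 osc] := A1_osc h_sigma0 h_theta0 hA1 (divr_gt0 e0 (ltr0n R 2)).
have dl20 : 0 < dl / 2 by rewrite divr_gt0.
(* a null set outside of which the paths are continuous *)
have [N [mN PN hN]] : exists N, [/\ measurable N, P N = 0%E & forall w, ~ N w ->
    {within [set t | 0 <= t], continuous (X ^~ w)}].
  have [_ [N [mN PN sN]] _] := h_X; exists N; split => // w nNw.
  by apply: contrapT => nc; apply: nNw; exact: sN.
pose cn n := C / (eta ^+ (2 * q) * T_ n ^+ q).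
pose E n := [set w | eps < `|anorm (fun j => (thetahat n w - theta0) ord0 j) - 0|].
pose Me n := [set w | dl / 2 < `|mesh (times S n w) (counts M n w) - 0|].
have vS n : (0 < n)%N -> forall w, valid_times (T_ n) (fun l i => S n l i w) ((M n) ^~ w).
  by move=> n0 w l; have [_ hs _] := h_sampling n n0; exact: hs.
have mS n : (0 < n)%N -> forall l i, measurable_fun setT (S n l i).
  by move=> n0 l i; have [hs _ _] := h_sampling n n0; exact: (hs l).2.
have iS n : (0 < n)%N -> indep P <<s [set C | exists l i (A : set R),
               measurable A /\ C = S n l i @^-1` A] >> (F (T_ n)).
  by move=> n0; have [_ _ hs] := h_sampling n n0.
have cn0 n : (0 < n)%N -> 0 <= cn n.
  by move=> n0; rewrite /cn divr_ge0 ?mulr_ge0 ?exprn_ge0 ?(ltW C0) ?(ltW eta0) ?T0.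
have mE n : (0 < n)%N -> measurable (E n).
  move=> n0; have [mth _] := h_thetahat n n0.
  have ma : measurable_fun setT
      (fun w => anorm (fun j => (thetahat n w - theta0) ord0 j)).
    rewrite /anorm; apply: measurableT_comp.
      by apply: continuous_measurable_fun; exact: sqrt_continuous.
    apply: measurable_sum => j; apply: measurable_funX.
    apply: (eq_measurable_fun (fun w => thetahat n w ord0 j - theta0 ord0 j)).
      by move=> w _; rewrite !mxE.
    exact: measurable_funB.
  have -> : E n = (fun w => anorm (fun j => (thetahat n w - theta0) ord0 j)) @^-1` `]eps, +oo[.
    by apply/seteqP; split => w; rewrite /E /= in_itv /= andbT subr0 ger0_norm ?anorm_ge0.
  rewrite -[X in measurable X]setTI; apply: ma => //; exact: measurable_itv.
have mMe n : (0 < n)%N -> measurable (Me n).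
  by move=> n0; apply: (measurable_mesh (vS n n0)) => //; exact: mS.
have bound : \forall n \near \oo, (P (E n) <= (cn n)%:E + P (Me n))%E.
  near=> n.
  have n0 : (0 < n)%N by near: n; exact: nbhs_infty_gt.
  have hid : forall th, closure Th2 th ->
    eps < anorm (fun j => (th - theta0) ord0 j) ->
    kappa * T_ n <= \int[@lebesgue_measure R]_(t in `[0, T_ n])
      (\sum_l (mu t th l ord0 - mu t theta0 l ord0) ^+ 2) by near: n.
  have [L [mL PL hL]] := random_sup h_filtration c10 (Tp n n0) CS Cg low mok (cn0 n n0)
    (fun N psi lo hi lohi disj => hC (T_ n) eta N psi lo hi (Tp n n0) eta0 lohi disj)
    (vS n n0) (mS n n0) (iS n n0).
  (* outside the three events the two bounds of the drift energy contradict each other *)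
  have sub : E n `<=` (L `|` Me n) `|` N.
    move=> w Ew; apply: contrapT => nw.
    have nL : ~ L w by move=> Lw; apply: nw; left; left.
    have nM : ~ Me n w by move=> Mw; apply: nw; left; right.
    have nN : ~ N w by move=> Nw; apply: nw; right.
    have [_ /(_ w)[csg _]] := h_sigmahat n n0.
    have [_ /(_ w)[cth hmax]] := h_thetahat n n0.
    have sm (i : 'I_(M n ord0 w + M n ord_max w)) :
        @right_time R (fun l i => S n l i w) ((M n)^~ w) i - @left_time R (fun l i => S n l i w) ((M n)^~ w) i < dl.
      apply: (@le_lt_trans _ _ (dl / 2)); last by rewrite ltr_pdivrMr// ltr_pMr// ltr1n.
      rewrite leNgt; apply/negP => hdl; apply: nM.
      by apply/(mesh_gtP (vS n n0) dl20); exists (@psi ((M n)^~ w) i), (@phi ((M n)^~ w) i).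
    have := drift_energy h_sigma0 h_theta0 hA1 (T0 n) (vS n n0 w) c10 c20 (ltW e0) hl osc sm
      csg cth (hmax theta0 ct0).
    have := hL w (hN w nN) nL _ (closure_row_mx csg cth).
    rewrite ler_norml => /andP[_ hY].
    have := hid _ cth; rewrite /E /= subr0 ger0_norm ?anorm_ge0// in Ew => /(_ Ew) hI hD.
    have := le_trans hI hD; rewrite e2 => hc.
    have h1 := ler_wpM2l (mulr_ge0 (ler0n R 4) (ltW c20)) hY.
    have h2 : 4 * c2 * (eta * T_ n) = kappa / 4 * T_ n.
      by rewrite /eta; field; rewrite gt_eqF.
    have h3 : 0 < kappa * T_ n by rewrite mulr_gt0// Tp.
    rewrite h2 in h1; lra.
  have mLM : measurable (L `|` Me n) by apply: measurableU => //; exact: mMe.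
  apply: (@le_trans _ _ (P ((L `|` Me n) `|` N))).
    by apply: le_measure; rewrite ?inE//; [exact: mE|exact: measurableU].
  have PU : (P ((L `|` Me n) `|` N) <= P (L `|` Me n) + P N)%E by exact: measureU2.
  have PU' : (P (L `|` Me n) <= P L + P (Me n))%E.
    by apply: measureU2 => //; exact: mMe.
  apply: le_trans PU _; rewrite PN adde0; apply: le_trans PU' _.
  by rewrite leeD2r.
have ccn : cn n @[n --> \oo] --> 0.
  have c0' : (T_ n)^-1 @[n --> \oo] --> (0:R).
    apply/gtr0_cvgV0 => //; near=> n; apply: Tp; near: n; exact: nbhs_infty_gt.
  have -> : cn = (fun n => C / eta ^+ (2 * q) * (T_ n)^-1 ^+ q).
    by apply/funext => n; rewrite /cn invfM mulrA exprVn.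
  rewrite -[X in _ --> X](mulr0 (C / eta ^+ (2 * q))); apply: cvgM; first exact: cvg_cst.
  have -> : (0:R) = 0 ^+ q by rewrite expr0n gtn_eqF.
  exact: cvg_expr.
apply: (@squeeze_cvge _ _ _ _ (fun=> 0%E) _ (fun n => (cn n)%:E + P (Me n))%E).
- by apply: filterS bound => n ->; rewrite measure_ge0.
- exact: cvg_cst.
rewrite -[X in _ --> X](adde0 0%E); apply: cvgeD => //.
  by apply: cvg_EFin => //; exact: nearW.
exact: hA2.
Unshelve. all: by end_near. Qed.
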